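(* Let $\beta\in(0,\infty)$, $p_0,q_0\in[1,\infty)$, $p,q\in(1,\infty)$, and let $r_0,r\in(\frac1\beta,\infty)$ be such that $$\frac1q-\frac1{q_0}=\frac1r-\frac1{r_0}=\frac1p-\frac1{p_0}.$$ Then for all weights $w$ with $w^r\in A_{r\beta}$ and for all functions $f\in L^p(w^p)$ and $g\in L^{q'}(w^{-q'})$, there exists a weight $v$ with $v^{r_0}\in A_{r_0\beta}$ such that $$[v^{r_0}]_{A_{r_0\beta}}\lesssim[w^r]_{A_{r\beta}}^{\max\{1,\frac{r_0\beta-1}{r\beta-1}\}},$$ $$\|fv\|_{L^{p_0}}\,\|gv^{-1}\|_{L^{q_0'}}\le2^{\max\{\frac{r\beta}p,\frac{(r\beta)'}{q'}\}}\,\|fw\|_{L^p}\,\|gw^{-1}\|_{L^{q'}}.$$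
   Context: A weight on $\mathbb R^n$ is a measurable function $w$ with $0<w<\infty$ a.e.; $\|f\|_{L^p(w)}=(\int|f|^pw\,dx)^{1/p}$, and $L^p$ without weight is with respect to Lebesgue measure on $\mathbb R^n$; $s'$ is the conjugate exponent of $s$ ($1'=\infty$). $[w]_{A_s}=\sup_Q(\fint_Qw)(\fint_Qw^{1-s'})^{s-1}$ for $1<s<\infty$, supremum over all cubes $Q\subset\mathbb R^n$, $\fint_Q$ the average over $Q$; $A_s$ is the class of weights with $[w]_{A_s}<\infty$. The implicit constant in $\lesssim$ depends only on $n$ and the exponents, not on $w,f,g$. *)

(* Defs.v *)
From HB Require Import structures.
From mathcomp Require Import all_boot all_order all_algebra.
From mathcomp Require Import all_classical all_reals all_analysis.
From mathcomp Require Import measurable_realfun.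
From mathcomp Require Import complex.

Set Implicit Arguments.
Unset Strict Implicit.
Unset Printing Implicit Defensive.

Import Order.TTheory GRing.Theory Num.Theory.

Local Open Scope classical_set_scope.
Local Open Scope ring_scope.
Local Open Scope ereal_scope.

(* all_analysis does not provide the sigma-finite instance for products. *)
Lemma product_measure_sigma_finite d1 d2 (T1 : measurableType d1)
    (T2 : measurableType d2) (R : realType)
    (m1 : {sigma_finite_measure set T1 -> \bar R})
    (m2 : {sigma_finite_measure set T2 -> \bar R}) :
  sigma_finite setT (m1 \x m2).
Proof.
have /sigma_finiteP[F [TF ndF Foo]] := sigma_finiteT m1.
have /sigma_finiteP[G [TG ndG Goo]] := sigma_finiteT m2.
exists (fun n => F n `*` G n).
  rewrite -setXTT TF TG predeqE => -[x y]; split.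
    move=> [/= [n _ Fnx] [k _ Gky]]; exists (maxn n k) => //; split.
    - by move: x Fnx; exact/subsetPset/ndF/leq_maxl.
    - by move: y Gky; exact/subsetPset/ndG/leq_maxr.
  by move=> [n _ []/= ? ?]; split; exists n.
move=> k; have [? ?] := Foo k; have [? ?] := Goo k.
split; first exact: measurableX.
by rewrite product_measure1E// lte_mul_pinfty// ge0_fin_numE.
Qed.

Section borel_measure.
Context {R : realType}.
Local Notation BR := (measurableTypeR R).

Definition consT n (u : BR * n.-tuple BR) : n.+1.-tuple BR :=
  [tuple of u.1 :: u.2].

Lemma measurable_consT n : measurable_fun [set: _] (@consT n).
Proof. exact: measurable_cons. Qed.

(* Lebesgue measure on R^n.+1 from that on R^n: the product measure transported
   along (x, t) |-> x :: t. *)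
Section borel_step.
Context n (m : {sigma_finite_measure set (n.-tuple BR) -> \bar R}).

Definition borel_step : set (n.+1.-tuple BR) -> \bar R :=
  pushforward (@lebesgue_measure R \x m) (@consT n).

Let borel_step0 : borel_step set0 = 0.
Proof. by rewrite /borel_step /pushforward preimage_set0 measure0. Qed.

Let borel_step_ge0 A : 0 <= borel_step A.
Proof. by rewrite /borel_step /pushforward; exact: measure_ge0. Qed.

Let borel_step_sigma_additive : semi_sigma_additive borel_step.
Proof.
exact: (@measure_semi_sigma_additive _ _ _
  (measure_function_pushforward__canonical__measure_function_Measure
    (@lebesgue_measure R \x m) (@measurable_consT n))).
Qed.

HB.instance Definition _ := isMeasure.Build _ _ _ borel_step
  borel_step0 borel_step_ge0 borel_step_sigma_additive.

Let borel_step_sigma_finite : sigma_finite setT borel_step.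
Proof.
have [F TF Foo] : sigma_finite setT (@lebesgue_measure R \x m).
  exact: product_measure_sigma_finite.
pose h (t : n.+1.-tuple BR) : BR * n.-tuple BR := (thead t, [tuple of behead t]).
have mh : measurable_fun setT h.
  apply/measurable_fun_pairP; split; last exact: measurable_behead.
  exact: measurable_tnth.
have hK : cancel (@consT n) h.
  by case=> x t; rewrite /h/consT theadE; congr pair; apply/val_inj.
exists (fun k => h @^-1` F k) => [|k].
  by rewrite -preimage_bigcup -TF preimage_setT.
have [mF Fk] := Foo k; split; first by rewrite -[X in measurable X]setTI; exact: mh.
rewrite /borel_step /pushforward -comp_preimage.
by rewrite (_ : h \o _ = id) //; apply/funext => u /=; rewrite hK.
Qed.

HB.instance Definition _ := @Measure_isSigmaFinite.Build _ _ _ borel_step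
  borel_step_sigma_finite.

End borel_step.

Fixpoint borel_lebesgue n : {sigma_finite_measure set (n.-tuple BR) -> \bar R} :=
  if n is m.+1 then borel_step (borel_lebesgue m) else dirac [tuple].

End borel_measure.


(* R^n with its Lebesgue measurable sets and Lebesgue measure: the completion of
   the Borel product measure. *)
Definition Rn (R : realType) (n : nat) : Type :=
  caratheodory_type (mu_ext (@borel_lebesgue R n)).

HB.instance Definition _ (R : realType) (n : nat) := Measurable.on (Rn R n).

Definition lebesgueRn (R : realType) (n : nat) :
    {measure set (Rn R n) -> \bar R} :=
  @completed_measure_extension _ _ _ (@borel_lebesgue R n).

Section weights.
Context {R : realType} {n : nat}.
Local Notation mu := (lebesgueRn R n).
Implicit Types (w : Rn R n -> \bar R) (f : Rn R n -> R[i]%C) (Q : set (Rn R n)).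

Definition is_weight w :=
  measurable_fun setT w /\ {ae mu, forall x, 0 < w x < +oo}.

(* closed cubes with sides parallel to the axes, lower corner a and side l *)
Definition cube (a : Rn R n) (l : R) : set (Rn R n) :=
  [set x | forall i : 'I_n, (tnth a i <= tnth x i <= tnth a i + l)%R].

Definition cubes : set (set (Rn R n)) :=
  [set Q | exists a l, (0 < l)%R /\ Q = cube a l].

Definition average Q w : \bar R := (mu Q)^-1 * \int[mu]_(x in Q) w x.

(* The conjugate exponent as a real number; only meaningful for 1 < s < +oo. The
   endpoint 1' = +oo is covered by hoelder_conjugate itself. *)
Definition conjR (s : R) : R := fine (hoelder_conjugate s%:E).

(* the A_s characteristic, for 1 < s < +oo *)
Definition Achar (s : R) w : \bar R :=
  ereal_sup [set average Q w *
                 average Q (fun x => w x `^ (1 - conjR s)%R) `^ (s - 1)%R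
            | Q in cubes].

Definition Aclass (s : R) w := is_weight w /\ Achar s w < +oo.

Definition cmod f (x : Rn R n) : \bar R := (Normc.normc (f x))%:E.

Definition cmeasurable f :=
  measurable_fun setT (fun x => complex.Re (f x)) /\
  measurable_fun setT (fun x => complex.Im (f x)).

Definition weighted_norm (p : R) w f : \bar R :=
  (\int[mu]_x (cmod f x `^ p * w x)) `^ p^-1.

Definition in_weighted_Lp (p : R) w f :=
  cmeasurable f /\ weighted_norm p w f < +oo.

End weights.

Lemma lebesgueRn_cube (R : realType) n (a : Rn R n) (l : R) :
  (0 <= l)%R -> lebesgueRn R n (cube a l) = (l ^+ n)%:E.
Proof.
move=> l0.
pose box m (b : m.-tuple (measurableTypeR R)) : set (m.-tuple (measurableTypeR R)) :=
  [set x | forall i, (tnth b i <= tnth x i <= tnth b i + l)%R].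
have mbox m b : measurable (box m b).
  rewrite (_ : box m b = \big[setI/setT]_(i < m)
      ((fun x : m.-tuple (measurableTypeR R) => tnth x i) @^-1`
       `[tnth b i, (tnth b i + l)%R])).
    apply: bigsetI_measurable => i _; rewrite -[X in measurable X]setTI.
    by apply: measurable_tnth => //; exact: measurable_itv.
  rewrite -bigcap_seq; apply/seteqP; split=> x bx i.
    by move=> _ /=; rewrite in_itv /=; exact: bx.
  by have := bx i; rewrite /= in_itv; apply; rewrite mem_index_enum.
have boxE m b : borel_lebesgue m (box m b) = (l ^+ m)%:E.
  elim: m b => [|m IH] b.
    by rewrite expr0 /= diracE mem_set // => -[].
  case/tupleP: b => b0 b; rewrite [LHS]/= /borel_step /pushforward.
  rewrite (_ : _ @^-1` _ = `[b0, (b0 + l)%R] `*` box m b); last first.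
    apply/seteqP; split=> -[x t] /=.
      move=> bxt; split; first by have := bxt ord0; rewrite in_itv.
      by move=> i; have := bxt (lift ord0 i); rewrite !tnthS.
    case; rewrite in_itv /= => bx bt i.
    by case: (unliftP ord0 i) => [j|] ->; [rewrite !tnthS|].
  have mI : measurable (`[b0, (b0 + l)%R]%classic : set (measurableTypeR R)).
    exact: measurable_itv.
  rewrite (product_measure1E _ _ mI (mbox _ _)).
  rewrite IH exprS EFinM; congr (_ * _).
  apply: eq_trans (lebesgue_measure_itv `[b0, (b0 + l)%R]) _.
  rewrite /= lte_fin ltrDl.
  case: ltP => [_|l_le0]; first by rewrite -EFinD addrAC subrr add0r.
  by rewrite (le_anti (introT andP (conj l_le0 l0))).
rewrite /lebesgueRn /= /completed_measure_extension.
by apply: eq_trans (measurable_mu_extE _ _) (boxE _ _); exact: mbox.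
Qed.

(* Main.v *)
(* Write [u = w ^ r], [s = r beta], [t = r0 beta]. If [s < t], an off-diagonal
   Rubio de Francia argument gives an [A_1] function [h] majorizing
   [(|f w| ^ p / u) ^ (1/s)] with [||h||_{L^s(u)}] at most twice that of the
   function it majorizes; then [v ^ r0 = u h ^ (s - t)] is in [A_t], and with
   [F = (h ^ s u) ^ (1/p)] one has [v = w F ^ (- p (1/r - 1/r0))], so that the
   gain in the norm of [f v] is exactly the loss which Hoelder's inequality
   produces in the norm of [g / v]. If [t < s], the same argument is applied to
   the dual weight [u ^ (1 - s')] with the roles of [f] and [g] exchanged.

   The linear dependence of the [A_1] constant on [[u]_{A_s} ^ (1 / (s - 1))] is
   Buckley's bound for the maximal operator, obtained by Lerner's argument: for a
   finite laminar family of cubes, two weighted Doob inequalities with constants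
   independent of the weights. Dyadic grids shifted by one third of the mesh then
   capture all cubes. *)
Require Import Defs.
From mathcomp Require Import all_boot all_order all_algebra.
From mathcomp Require Import all_classical all_reals all_analysis.
From mathcomp Require Import measurable_realfun ess_sup_inf complex ring lra.

Set Implicit Arguments.
Unset Strict Implicit.
Unset Printing Implicit Defensive.

Import Order.TTheory GRing.Theory Num.Theory.
Local Open Scope classical_set_scope.
Local Open Scope ring_scope.

(** Powers of the characteristic $A$ of $u$: the $A_1$ constant of [h] is of order $A^{1/(s-1)}$;
    passing to $A_t$ raises it to the power $t-s$ and multiplies by $A$, and
    $1+(t-s)/(s-1)=(t-1)/(s-1)$. On the dual side the same count gives $A^{1/(t-1)}$, and dualizing
    back raises this to the power $t-1$, hence the exponent 1. The factor 2: [h] is the increasing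
    limit of $h_{k+1}=h_0+M_kh_k/(2N)$, where $N$ bounds the norms of the maximal operators $M_k$.
    All iterates have norm at most $2\|h_0\|$, which becomes $2^{s/p}$ for $F$. Finite families:
    Doob's inequality is proved by absorbing half of its left side, which must be finite beforehand.
    A finite list of cells ensures this, and since the constants do not depend on the list, monotone
    limits do the rest. Degenerate data: negative powers of [h] are taken, so it must be positive
    everywhere. If the function to be majorized is null, the algorithm is run on the indicator of a
    unit cube instead. *)

Section real_inequalities.
Context {R : realType}.
Implicit Types a b x y p s t : R.

Lemma weighted_AMGM t x y : 0 < t < 1 -> 0 <= x -> 0 <= y ->
  x `^ t * y `^ (1 - t) <= t * x + (1 - t) * y.
Proof.
move=> /andP[t0 t1] x0 y0.
have t1' : 0 < 1 - t by rewrite subr_gt0.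
have := @conjugate_powR R (x `^ t) (y `^ (1 - t)) t^-1 (1 - t)^-1
  (powR_ge0 _ _) (powR_ge0 _ _).
rewrite !invr_gt0 !invrK => /(_ t0 t1'); rewrite subrKC => /(_ erefl).
rewrite -!powRrM !divff ?gt_eqF// !powRr1//.
by rewrite (mulrC x) (mulrC y).
Qed.

(** Young's inequality for $b\,a^{p-1}$. It turns an increment of $p$-th powers between two levels
    into [b] times an increment of $(p-1)$-th powers; the factor [b] is what the weak-type bound
    consumes. *)
Lemma powR_layer_le p a b : 1 < p -> 0 <= a -> a <= b ->
  b `^ p - a `^ p <= p / (p - 1) * (b * (b `^ (p - 1) - a `^ (p - 1))).
Proof.
move=> p1 a0 ab; have b0 := le_trans a0 ab.
have p0 : 0 < p by exact: lt_trans p1.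
have q0 : 0 < p - 1 by rewrite subr_gt0.
have /= := @weighted_AMGM p^-1 (b `^ p) (a `^ p) _ (powR_ge0 _ _) (powR_ge0 _ _).
rewrite invr_gt0 p0 invf_lt1// p1 => /(_ isT).
rewrite -!powRrM divff ?gt_eqF// powRr1//.
have -> : p * (1 - p^-1) = p - 1 by field; lra.
have c0 : 0 <= p / (p - 1) by rewrite divr_ge0// ltW.
move=> /(ler_wpM2l c0).
have -> : p / (p - 1) * (p^-1 * b `^ p + (1 - p^-1) * a `^ p) =
  b `^ p / (p - 1) + a `^ p by field; lra.
have -> : p / (p - 1) * (b * (b `^ (p - 1) - a `^ (p - 1))) =
    b `^ p + b `^ p / (p - 1) - p / (p - 1) * (b * a `^ (p - 1)).
  by rewrite -(mulr_powRB1 b0 p0); field; lra.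
lra.
Qed.

(** Half of it is the constant of Young's inequality in [powR_absorb]; the other factor 2 comes from
    absorbing half of the left side in [doob_laminar]. *)
Definition doob_cst p : R := 2 * ((2 * (p / (p - 1))) `^ p / p).

Lemma doob_cst_gt0 p : 1 < p -> 0 < doob_cst p.
Proof.
move=> p1; have p0 : 0 < p by lra.
have q0 : 0 < p - 1 by lra.
by rewrite mulr_gt0// divr_gt0// powR_gt0// !mulr_gt0// invr_gt0.
Qed.

(** Young's inequality with $x$ scaled by $2p'$ and $y^{p-1}$ by $1/2$, where $p'=p/(p-1)$: this
    makes the coefficient of $y^p$ small enough to be absorbed. *)
Lemma powR_absorb p x y : 1 < p -> 0 <= x -> 0 <= y ->
  p / (p - 1) * (x * y `^ (p - 1)) <= doob_cst p / 2 * x `^ p + 2^-1 * y `^ p.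
Proof.
move=> p1 x0 y0.
have p0 : 0 < p by lra.
have q0 : 0 < p - 1 by lra.
have c0 : 0 <= 2 * (p / (p - 1)) by rewrite mulr_ge0// divr_ge0// ltW.
have /= := @conjugate_powR R (2 * (p / (p - 1)) * x) (2^-1 * y `^ (p - 1)) p (p / (p - 1)).
rewrite !mulr_ge0 ?powR_ge0 ?invr_ge0 ?divr_ge0 ?divr_gt0 ?(ltW p0) ?(ltW q0)//.
have -> : p^-1 + (p / (p - 1))^-1 = 1 by field; lra.
move=> /(_ isT isT p0 isT erefl).
rewrite powRM// [X in _ <= _ + X / _]powRM ?powR_ge0// -powRrM.
have -> : (p - 1) * (p / (p - 1)) = p by field; lra.
rewrite /doob_cst; set A := (_ `^ p) => H.
(* $(1/2)^{p'}\le1/2$ and $1/p'\le1$, since $p'\ge1$. *)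
have B1 : (2^-1 : R) `^ (p / (p - 1)) / (p / (p - 1)) <= 2^-1.
  have pq1 : 1 <= p / (p - 1) by rewrite ler_pdivlMr//; lra.
  rewrite ler_pdivrMr; last by lra.
  apply: (@le_trans _ _ 2^-1); last by rewrite ler_peMr.
  have h2 : 0 < (2^-1 : R) <= 1 by apply/andP; split; lra.
  exact: ge1r_powR.
have := ler_wpM2r (powR_ge0 y p) B1.
move: H; set B := _ `^ (p / (p - 1)); set Y := y `^ p.
have -> : 2 * (p / (p - 1)) * x * (2^-1 * y `^ (p - 1)) =
   p / (p - 1) * (x * y `^ (p - 1)) by field; lra.
have -> : 2 * (A / p) / 2 * x `^ p = A * x `^ p / p by field; lra.
have -> : B * Y / (p / (p - 1)) = B / (p / (p - 1)) * Y by field; lra.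
by lra.
Qed.

Lemma powR_midpoint_le s x y : 1 <= s -> 0 <= x -> 0 <= y ->
  (2^-1 * (x + y)) `^ s <= 2^-1 * (x `^ s + y `^ s).
Proof.
move=> s1 x0 y0; rewrite !mulrDr.
have h : 0 <= (2^-1 : R) <= 1 by apply/andP; split; lra.
case/andP: h => h0 h1.
have := @convex_powR R s s1 (Itv01 h0 h1) x y.
rewrite !inE /= !in_itv /= x0 y0 => /(_ isT isT).
rewrite convRE [X in X `^ _ <= _ -> _]convRE /= /unstable.onem.
rewrite (_ : 1 - 2^-1 = 2^-1 :> R); last by lra.
exact.
Qed.

End real_inequalities.

(** * Doob inequality for laminar families *)

Section laminar.
Local Open Scope ereal_scope.
Context d (T : measurableType d) (R : realType).
Variable mu : {measure set T -> \bar R}.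

Lemma integralZ_indic (A : set T) (k : R) (g : T -> \bar R) :
  measurable A -> (0 <= k)%R -> measurable_fun setT g -> (forall x, 0 <= g x) ->
  \int[mu]_x ((k * \1_A x)%:E * g x) = k%:E * \int[mu]_(x in A) g x.
Proof.
move=> mA k0 mg g0.
rewrite [in RHS]integral_mkcond -ge0_integralZl//; last 2 first.
- by apply/(measurable_restrictT _ mA); exact: measurable_funTS.
- by move=> x _; exact: erestrict_ge0.
apply: eq_integral => x _; rewrite epatch_indic /= EFinM indicE.
by case: (x \in A); rewrite !(mule1, mule0, mul0e).
Qed.

Variables (I : choiceType) (Q : I -> set T).
Hypothesis mQ : forall i, measurable (Q i).

Definition laminar (S : seq I) := forall i j, i \in S -> j \in S ->
  [\/ Q i `<=` Q j, Q j `<=` Q i | Q i `&` Q j = set0].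

Definition cover_seq (S : seq I) := \bigcup_(j in [set` S]) Q j.

Lemma measurable_cover_seq S : measurable (cover_seq S).
Proof. by rewrite /cover_seq bigcup_seq; exact: bigsetU_measurable. Qed.

Lemma cover_seq_cons i S : cover_seq (i :: S) = Q i `|` cover_seq S.
Proof. by rewrite /cover_seq !bigcup_seq big_cons. Qed.

Lemma cover_seq_nil : cover_seq [::] = set0.
Proof. by rewrite /cover_seq bigcup_seq big_nil. Qed.

(** Only the maximal sets of the list matter. A set contained in a later one is dropped; otherwise
    it swallows every later set that it meets, and the rest of the list is disjoint from it. That
    rest is a filtered tail, so the induction is on the length. *)
Lemma laminar_weak (S : seq I) (c : \bar R) (u f : T -> \bar R) :
  measurable_fun setT u -> measurable_fun setT f ->
  (forall x, 0 <= u x) -> (forall x, 0 <= f x) -> 0 <= c -> laminar S ->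
  (forall i, i \in S -> c * \int[mu]_(x in Q i) u x <= \int[mu]_(x in Q i) f x) ->
  c * \int[mu]_(x in cover_seq S) u x <= \int[mu]_(x in cover_seq S) f x.
Proof.
move=> mu_ mf u0 f0 c0.
elim: {S}(size S).+1 {-2}S (ltnSn (size S)) => // n IH [|i S].
  by move=> _ _ _; rewrite cover_seq_nil !integral_set0 mule0.
rewrite /= ltnS => sz lam H.
have sub (S1 : seq I) : {subset S1 <= S} -> (size S1 <= size S)%N ->
    c * \int[mu]_(x in cover_seq S1) u x <= \int[mu]_(x in cover_seq S1) f x.
  move=> S1S sz1; apply: IH; first exact: leq_ltn_trans sz1 sz.
    by move=> j k jS kS; apply: lam; rewrite in_cons S1S ?orbT.
  by move=> j jS; apply: H; rewrite in_cons S1S ?orbT.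
have [[j jS ij]|max_i] := pselect (exists2 j, j \in S & Q i `<=` Q j).
  rewrite cover_seq_cons (_ : _ `|` _ = cover_seq S); first exact: sub.
  by apply/setUidPr => x /ij Qjx; exists j.
set S1 := [seq j <- S | `[< Q i `&` Q j = set0 >]].
have -> : cover_seq (i :: S) = Q i `|` cover_seq S1.
  rewrite cover_seq_cons; apply/seteqP; split=> x [|[j /= jS jx]]; [by left| |by left|].
    have [||ij|ji|ij] := lam i j; rewrite ?in_cons ?eqxx ?jS ?orbT//.
    - by case: max_i; exists j.
    - by left; exact: ji.
    - by right; exists j => //=; rewrite mem_filter jS andbT; exact/asboolP.
  by right; exists j => //=; move: jS; rewrite mem_filter => /andP[].
have dis : [disjoint Q i & cover_seq S1].
  apply/disj_setPS => x [Qix [j /= jS1 Qjx]].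
  move: jS1; rewrite mem_filter => /andP[/asboolP + _].
  by move=> /seteqP[/(_ x) + _]; apply.
rewrite !ge0_integral_setU//; last 4 first.
- exact: measurable_cover_seq.
- exact: measurable_funTS.
- exact: measurable_cover_seq.
- exact: measurable_funTS.
rewrite ge0_muleDr ?integral_ge0//; apply: leeD; first by apply: H; rewrite mem_head.
apply: sub => [j|]; first by rewrite mem_filter => /andP[].
by rewrite size_filter count_size.
Qed.

Variable c : I -> R.
Hypothesis c0 : forall i, (0 <= c i)%R.

Definition max_seq (S : seq I) (x : T) : R :=
  (\big[Num.max/0]_(i <- S) (c i * \1_(Q i) x))%R.

Lemma max_seq_ge0 S x : (0 <= max_seq S x)%R.
Proof.
rewrite /max_seq; elim: S => [|i S IH]; first by rewrite big_nil.
by rewrite big_cons le_max IH orbT.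
Qed.

Lemma measurable_max_seq S : measurable_fun setT (max_seq S).
Proof.
rewrite /max_seq; elim: S => [|i S IH].
  by under eq_fun do rewrite big_nil; exact: measurable_cst.
under eq_fun do rewrite big_cons; apply: measurable_maxr => //.
by apply: measurable_funM => //; exact: measurable_indic.
Qed.

Lemma le_max_seq S i x : i \in S -> Q i x -> (c i <= max_seq S x)%R.
Proof.
rewrite /max_seq; elim: S => // j S IH; rewrite in_cons big_cons le_max.
move=> /predU1P[->|iS] Qx; first by rewrite indicE mem_set// mulr1 lexx.
by rewrite IH ?orbT.
Qed.

Lemma max_seq_eq0 S x : ~ cover_seq S x -> max_seq S x = 0%R.
Proof.
rewrite /max_seq; elim: S => [|j S IH]; first by rewrite big_nil.
rewrite cover_seq_cons big_cons => /not_orP[jx Sx]; rewrite IH//.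
by rewrite indicE memNset// mulr0 maxxx.
Qed.

(* Layer-cake decomposition of [max_seq S ^ e - a ^ e] over the levels [c i]
   of a list [S] sorted by [c]. *)
Fixpoint layers (e : R) (S : seq I) (a : R) (x : T) : R :=
  if S is i :: S' then
    ((c i `^ e - a `^ e) * \1_(cover_seq S) x + layers e S' (c i) x)%R
  else 0%R.

Local Notation sorted_above a S := (path <=%R a [seq c i | i <- S]).

Lemma sorted_above_le a S i : sorted_above a S -> i \in S -> (a <= c i)%R.
Proof.
move=> pS iS; have /allP := order_path_min le_trans pS.
by apply; exact: map_f.
Qed.

Lemma layers_ge0 e S a x : (0 <= e)%R -> (0 <= a)%R -> sorted_above a S ->
  (0 <= layers e S a x)%R.
Proof.
move=> e0; elim: S a => //= i S IH a a0 /andP[ai pS].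
rewrite addr_ge0 ?IH// mulr_ge0// subr_ge0.
by apply: ge0_ler_powR; rewrite ?nnegrE.
Qed.

Lemma measurable_layers e S a : measurable_fun setT (layers e S a).
Proof.
elim: S a => [|i S IH] a /=; first exact: measurable_cst.
apply: measurable_funD => //; apply: measurable_funM => //.
by apply: measurable_indic; exact: measurable_cover_seq.
Qed.

(** The covers of the tails decrease, so at [x] the increments telescope up to the last index of the
    sorted list whose set contains [x]; its coefficient is the maximum. *)
Lemma layersE e S a x : (0 <= a)%R -> sorted_above a S ->
  layers e S a x = ((max_seq S x `^ e - a `^ e) * \1_(cover_seq S) x)%R.
Proof.
elim: S a => [|i S IH] a a0 /=.
  by move=> _; rewrite cover_seq_nil indicE in_set0 mulr0.
move=> /andP[ai pS]; rewrite IH// !indicE.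
have maxE : max_seq (i :: S) x = Num.max (c i * \1_(Q i) x)%R (max_seq S x).
  by rewrite /max_seq big_cons.
have [Sx|nSx] := pselect (cover_seq S x).
  have iSx : cover_seq (i :: S) x by rewrite cover_seq_cons; right.
  rewrite (mem_set Sx) (mem_set iSx) !mulr1 maxE.
  have ci : (c i <= max_seq S x)%R.
    case: Sx => j /= jS jx; apply: le_trans (le_max_seq jS jx).
    exact: sorted_above_le pS jS.
  rewrite (max_r (le_trans _ ci)) 1?addrC ?subrKA//.
  by rewrite indicE; case: (_ \in _); rewrite ?mulr1 ?mulr0.
rewrite (memNset nSx) mulr0 addr0.
have [Qx|nQx] := pselect (Q i x).
  rewrite mem_set; last by rewrite cover_seq_cons; left.
  by rewrite maxE indicE mem_set// max_seq_eq0// !mulr1 max_l.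
by rewrite memNset ?mulr0// cover_seq_cons => -[].
Qed.

Section doob.
Variables (sigma : T -> R) (f : T -> \bar R) (p : R).
Hypotheses (msigma : measurable_fun setT sigma) (sigma0 : forall x, (0 <= sigma x)%R).
Hypotheses (mf : measurable_fun setT f) (f0 : forall x, 0 <= f x).
Hypothesis p1 : (1 < p)%R.

Let mES : measurable_fun setT (fun x => (sigma x)%:E).
Proof. exact/measurable_EFinP. Qed.

Let mF : measurable_fun setT (fun x => f x * (sigma x)%:E).
Proof. exact: emeasurable_funM. Qed.

Let F0 x : 0 <= f x * (sigma x)%:E.
Proof. by rewrite mule_ge0// lee_fin. Qed.

(** Layer by layer: [powR_layer_le] treats the increment from [a] to [c i], and the factor [c i]
    that it produces is paid for by the weak-type bound on the cover of [i :: S], all of whose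
    coefficients are at least [c i] because the list is sorted. *)
Lemma layers_doob S a : (0 <= a)%R -> sorted_above a S -> laminar S ->
  (forall i, i \in S -> (c i)%:E * \int[mu]_(x in Q i) (sigma x)%:E <=
    \int[mu]_(x in Q i) (f x * (sigma x)%:E)) ->
  \int[mu]_x ((layers p S a x)%:E * (sigma x)%:E) <=
  (p / (p - 1))%:E *
    \int[mu]_x ((layers (p - 1) S a x)%:E * (f x * (sigma x)%:E)).
Proof.
have p0 : (0 <= p)%R by rewrite ltW// (lt_trans ltr01 p1).
have q0 : (0 <= p - 1)%R by rewrite subr_ge0 ltW.
have pq0 : (0 <= p / (p - 1))%R by rewrite divr_ge0.
elim: S a => [|i S IH] a a0.
  move=> _ _ _ /=; under eq_integral do rewrite mul0e.
  by rewrite integral0; under eq_integral do rewrite mul0e; rewrite integral0 mule0.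
move=> /= /andP[ai pS] lam H.
have split_layers (e : R) (g : T -> \bar R) : (0 <= e)%R -> measurable_fun setT g ->
    (forall x, 0 <= g x) ->
    \int[mu]_x (((c i `^ e - a `^ e) * \1_(cover_seq (i :: S)) x +
      layers e S (c i) x)%:E * g x) =
    (c i `^ e - a `^ e)%:E * \int[mu]_(x in cover_seq (i :: S)) g x +
    \int[mu]_x ((layers e S (c i) x)%:E * g x).
  move=> e0 mg g0.
  have k0 : (0 <= c i `^ e - a `^ e)%R.
    by rewrite subr_ge0; apply: ge0_ler_powR; rewrite ?nnegrE.
  rewrite -integralZ_indic//; last exact: measurable_cover_seq.
  rewrite -ge0_integralD//.
  - apply: eq_integral => x _.
    by rewrite EFinD ge0_muleDl// lee_fin ?layers_ge0// mulr_ge0.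
  - by move=> x _; rewrite mule_ge0// lee_fin mulr_ge0.
  - apply: emeasurable_funM => //; apply/measurable_EFinP.
    apply: measurable_funM => //.
    by apply: measurable_indic; exact: measurable_cover_seq.
  - by move=> x _; rewrite mule_ge0// lee_fin layers_ge0.
  - by apply: emeasurable_funM => //; apply/measurable_EFinP; exact: measurable_layers.
rewrite !split_layers// [leRHS]ge0_muleDr; last 2 first.
- rewrite mule_ge0//; last by apply: integral_ge0 => x _; exact: F0.
  by rewrite lee_fin subr_ge0; apply: ge0_ler_powR; rewrite ?nnegrE.
- apply: integral_ge0 => x _; rewrite mule_ge0// ?F0// lee_fin.
  exact: layers_ge0.
apply: leeD; last first.
  apply: IH => //; first by move=> j k jS kS; apply: lam; rewrite in_cons ?jS ?kS orbT.
  by move=> j jS; apply: H; rewrite in_cons jS orbT.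
have kE := powR_layer_le p1 a0 ai.
have k'0 : (0 <= c i `^ (p - 1) - a `^ (p - 1))%R.
  by rewrite subr_ge0; apply: ge0_ler_powR; rewrite ?nnegrE.
have I0 : 0 <= \int[mu]_(x in cover_seq (i :: S)) (sigma x)%:E.
  by apply: integral_ge0 => x _; rewrite lee_fin.
apply: (@le_trans _ _ ((p / (p - 1) * (c i * (c i `^ (p - 1) - a `^ (p - 1))))%:E *
    \int[mu]_(x in cover_seq (i :: S)) (sigma x)%:E)).
  by apply: lee_wpmul2r => //; rewrite lee_fin.
rewrite (mulrC (c i)) EFinM (EFinM _ (c i)) -!muleA.
apply: lee_wpmul2l; first by rewrite lee_fin.
apply: lee_wpmul2l; first by rewrite lee_fin.
apply: laminar_weak => //; first by rewrite lee_fin.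
move=> j jiS; apply: le_trans (H _ jiS).
apply: lee_wpmul2r; first by apply: integral_ge0 => x _; rewrite lee_fin.
rewrite lee_fin; move: jiS; rewrite in_cons => /predU1P[->//|].
exact: sorted_above_le.
Qed.

(** The a priori finiteness that makes the absorption in [doob_laminar] legitimate; the maximum is
    dominated by a finite sum. *)
Lemma max_seq_fin S :
  (forall i, i \in S -> \int[mu]_(x in Q i) (sigma x)%:E < +oo) ->
  \int[mu]_x (max_seq S x `^ p * sigma x)%:E < +oo.
Proof.
move=> H.
have p0 : (0 < p)%R by exact: lt_trans ltr01 p1.
apply: (@le_lt_trans _ _ (\int[mu]_x \sum_(i <- S)
    ((c i `^ p * \1_(Q i) x)%:E * (sigma x)%:E))).
  apply: ge0_le_integral => //.
  - by move=> x _; rewrite lee_fin mulr_ge0// powR_ge0.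
  - apply/measurable_EFinP; apply: measurable_funM => //.
    apply: (@measurableT_comp _ _ _ _ _ _ (@powR R ^~ p)) => //.
    exact: measurable_max_seq.
  - apply: emeasurable_sum => i; apply: emeasurable_funM => //.
    by apply/measurable_EFinP; apply: measurable_funM.
  move=> x _; elim: S {H} => [|i S IH].
    by rewrite /max_seq !big_nil powR0 ?gt_eqF// mul0r.
  rewrite big_cons; have -> : max_seq (i :: S) x = Num.max (c i * \1_(Q i) x)%R (max_seq S x).
    by rewrite /max_seq big_cons.
  rewrite maxEle; case: ifPn => _.
    by apply: le_trans IH _; rewrite leeDr// mule_ge0// lee_fin// mulr_ge0// powR_ge0.
  rewrite powRM// -EFinM.
  have -> : (\1_(Q i) x `^ p = \1_(Q i) x :> R)%R.
    by rewrite indicE; case: (_ \in _); rewrite ?powR1// powR0 ?gt_eqF.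
  rewrite leeDl// sume_ge0// => j _; rewrite mule_ge0// lee_fin// mulr_ge0//.
  exact: powR_ge0.
rewrite ge0_integral_sum//; last 2 first.
- move=> i; apply: emeasurable_funM => //.
  by apply/measurable_EFinP; apply: measurable_funM => //; exact: measurable_indic.
- by move=> i x _; rewrite mule_ge0// lee_fin// mulr_ge0// powR_ge0.
rewrite big_seq; apply: lte_sum_pinfty => i iS.
rewrite integralZ_indic// ?powR_ge0// lte_mul_pinfty ?lee_fin ?powR_ge0//.
exact: H.
Qed.

(** Started at level 0, the layers are full powers; [powR_absorb] splits the right side of
    [layers_doob], and half of the left side is absorbed. The last hypothesis says in effect that
    [c i] is at most the [sigma]-average of [f], so this is Doob's inequality for the measure with
    density [sigma], with a constant that does not see [sigma]. *)
Lemma doob_laminar S : laminar S ->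
  (forall i, i \in S -> \int[mu]_(x in Q i) (sigma x)%:E < +oo) ->
  (forall i, i \in S -> (c i)%:E * \int[mu]_(x in Q i) (sigma x)%:E <=
    \int[mu]_(x in Q i) (f x * (sigma x)%:E)) ->
  \int[mu]_x (max_seq S x `^ p * sigma x)%:E <=
  (doob_cst p)%:E * \int[mu]_x (f x `^ p * (sigma x)%:E).
Proof.
move=> lam fin H.
have p0 : (0 < p)%R by exact: lt_trans ltr01 p1.
have q0 : (0 < p - 1)%R by rewrite subr_gt0.
pose S' := sort (fun i j => (c i <= c j)%R) S.
have S'S : S' =i S by move=> i; rewrite mem_sort.
have mx x : max_seq S x = max_seq S' x.
  by rewrite /max_seq; apply: perm_big; rewrite perm_sym perm_sort.
have pS' : sorted_above 0%R S'.
  rewrite path_min_sorted.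
    by rewrite sorted_map; apply: sort_sorted => i j; exact: le_total.
  by apply/allP => _ /mapP[i _ ->].
have layE (e : R) x : (0 < e)%R -> layers e S' 0%R x = (max_seq S x `^ e)%R.
  move=> e0; rewrite layersE// -mx powR0 ?gt_eqF// subr0 indicE.
  have [xS|xS] := pselect (cover_seq S' x); first by rewrite mem_set// mulr1.
  by rewrite memNset// mx max_seq_eq0// powR0 ?gt_eqF// mulr0.
have lam' : laminar S' by move=> i j; rewrite !S'S; exact: lam.
have := layers_doob (lexx _) pS' lam' (fun i iS => H i (etrans (esym (S'S i)) iS)).
under eq_integral do rewrite layE//.
under [X in _ <= _ * X -> _]eq_integral do rewrite layE//.
move=> D1.
set D := \int[mu]_x (max_seq S x `^ p * sigma x)%:E.
have Dfin : D \is a fin_num.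
  rewrite ge0_fin_numE; first exact: max_seq_fin.
  by apply: integral_ge0 => x _; rewrite lee_fin mulr_ge0// powR_ge0.
have mpow : measurable_fun setT (fun x => (max_seq S x `^ p * sigma x)%:E).
  apply/measurable_EFinP; apply: measurable_funM => //.
  apply: (@measurableT_comp _ _ _ _ _ _ (@powR R ^~ p)) => //.
  exact: measurable_max_seq.
have mfp : measurable_fun setT (fun x => f x `^ p * (sigma x)%:E).
  apply: emeasurable_funM => //.
  by apply: (@measurableT_comp _ _ _ _ _ _ (@poweR R ^~ p)) => //; exact: measurable_poweR.
have A0 := doob_cst_gt0 p1.
have D2 : D <= (doob_cst p / 2)%:E * \int[mu]_x (f x `^ p * (sigma x)%:E) +
    (2^-1)%:E * D.
  have {}D1 : D <= \int[mu]_x ((p / (p - 1))%:E * ((max_seq S x `^ (p - 1))%:E *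
      (f x * (sigma x)%:E))).
    rewrite ge0_integralZl//.
    - apply: emeasurable_funM => //; apply/measurable_EFinP.
      apply: (@measurableT_comp _ _ _ _ _ _ (@powR R ^~ (p - 1)%R)) => //.
      exact: measurable_max_seq.
    - by move=> x _; rewrite mule_ge0// lee_fin powR_ge0.
    - by rewrite lee_fin divr_ge0// ltW.
  apply: (le_trans D1).
  rewrite /D -ge0_integralZl//; last 2 first.
  - by move=> x _; rewrite mule_ge0// ?lee_fin// poweR_ge0.
  - by rewrite lee_fin divr_ge0// ltW.
  rewrite -ge0_integralZl//; last first.
    by move=> x _; rewrite lee_fin mulr_ge0// powR_ge0.
  rewrite -ge0_integralD//; last 4 first.
  - by move=> x _; rewrite !mule_ge0// ?lee_fin ?poweR_ge0// divr_ge0// ltW.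
  - exact: measurable_funeM.
  - by move=> x _; rewrite mule_ge0// lee_fin mulr_ge0// powR_ge0.
  - exact: measurable_funeM.
  apply: ge0_le_integral => //.
  - move=> x _; rewrite !mule_ge0// lee_fin ?powR_ge0// divr_ge0// ltW//.
  - apply: measurable_funeM; apply: emeasurable_funM => //; apply/measurable_EFinP.
    apply: (@measurableT_comp _ _ _ _ _ _ (@powR R ^~ (p - 1)%R)) => //.
    exact: measurable_max_seq.
  - by apply: emeasurable_funD; exact: measurable_funeM.
  move=> x _; have := f0 x; case: (f x) => [y||//].
    rewrite lee_fin => y0.
    rewrite poweR_EFin -!EFinM -EFinD lee_fin.
    have := ler_wpM2r (sigma0 x) (powR_absorb p1 y0 (max_seq_ge0 S x)).
    set A := (doob_cst p / 2)%R; set B := (p / (p - 1))%R; set X := (y `^ p)%R.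
    set Y := (max_seq S x `^ p)%R; set Z := (max_seq S x `^ (p - 1))%R.
    have -> : (B * (Z * (y * sigma x)) = B * (y * Z) * sigma x)%R by ring.
    by have -> : (A * (X * sigma x) + 2^-1 * (Y * sigma x) =
      (A * X + 2^-1 * Y) * sigma x)%R by ring.
  (* Where [f x] is infinite, either [sigma x] is 0 and both sides vanish, or the right side is
     infinite. *)
  move=> _; rewrite poweRyr ?gt_eqF//.
  move: (sigma0 x); rewrite le_eqVlt => /predU1P[<-|s0].
    by rewrite !mule0 mulr0 !mule0 adde0.
  apply: (@le_trans _ _ +oo); first exact: leey.
  by rewrite gt0_mulye ?lte_fin// gt0_muley ?lte_fin ?divr_gt0// addye.
have : D - (2^-1)%:E * D <= (doob_cst p / 2)%:E * \int[mu]_x (f x `^ p * (sigma x)%:E).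
  by rewrite leeBlDr// fin_numM.
have -> : D - (2^-1)%:E * D = (2^-1)%:E * D.
  by rewrite -(fineK Dfin) -EFinM -EFinB; congr EFin; lra.
move=> D3.
have two0 : 0 <= 2%:E :> \bar R by rewrite lee_fin.
have := lee_wpmul2l two0 D3.
by rewrite !muleA -!EFinM divff// mul1e mulrCA divff// mulr1.
Qed.

End doob.
End laminar.

(** * Buckley's bound on a laminar family *)

Section mean.
Local Open Scope ereal_scope.
Context d (T : measurableType d) (R : realType).
Variable mu : {measure set T -> \bar R}.

Lemma integral_gt0 (A : set T) (u : T -> R) : measurable A ->
  measurable_fun setT u -> (forall x, (0 < u x)%R) -> 0 < mu A ->
  0 < \int[mu]_(x in A) (u x)%:E.
Proof.
move=> mA mu_ u0 A0; rewrite lt0e; apply/andP; split; last first.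
  by apply: integral_ge0 => x _; rewrite lee_fin ltW.
apply/eqP => I0.
have mE : measurable_fun A (fun x => (u x)%:E).
  by apply/measurable_EFinP; exact: measurable_funTS.
have : \int[mu]_(x in A) `|(u x)%:E| = 0.
  by rewrite -I0; apply: eq_integral => x _; rewrite gee0_abs// lee_fin ltW.
move=> /(ae_eq_integral_abs mu mA mE) => -[N [mN N0 sub]].
suff A00 : mu A = 0 by rewrite A00 ltxx in A0.
apply: (subset_measure0 mA mN _ N0) => x Ax; apply: sub => /= /(_ Ax) [] /eqP.
by rewrite gt_eqF.
Qed.

Definition mean (A : set T) (f : T -> \bar R) := (mu A)^-1 * \int[mu]_(x in A) f x.

Lemma mean_ge0 A f : (forall x, 0 <= f x) -> 0 <= mean A f.
Proof. by move=> f0; rewrite mule_ge0 ?inve_ge0// integral_ge0. Qed.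

Variables (I : choiceType) (Q : I -> set T).

(** For nonnegative [f], the Hardy-Littlewood maximal operator restricted to finitely many sets. *)
Definition max_mean (S : seq I) (f : T -> \bar R) (x : T) : \bar R :=
  \big[maxe/0]_(i <- S) (mean (Q i) f * (\1_(Q i) x)%:E).

Lemma max_mean_ge0 S f x : 0 <= max_mean S f x.
Proof.
rewrite /max_mean; elim: S => [|i S IH]; first by rewrite big_nil.
by rewrite big_cons le_max IH orbT.
Qed.

Lemma le_max_mean S f i x : i \in S -> Q i x -> mean (Q i) f <= max_mean S f x.
Proof.
rewrite /max_mean; elim: S => // j S IH; rewrite in_cons big_cons le_max.
move=> /predU1P[->|iS] Qx; first by rewrite indicE mem_set// mule1 lexx.
by rewrite IH ?orbT.
Qed.

Lemma max_mean_le S f x y : 0 <= y ->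
  (forall i, i \in S -> Q i x -> mean (Q i) f <= y) -> max_mean S f x <= y.
Proof.
rewrite /max_mean; elim: S => [|i S IH] y0 H; first by rewrite big_nil.
rewrite big_cons ge_max IH// ?andbT; last first.
  by move=> j jS; apply: H; rewrite in_cons jS orbT.
rewrite indicE; have [Qx|nQx] := pselect (Q i x).
  by rewrite mem_set// mule1 H// mem_head.
by rewrite memNset// mule0.
Qed.

Hypothesis mQ : forall i, measurable (Q i).

Lemma measurable_max_mean S f : measurable_fun setT (max_mean S f).
Proof.
rewrite /max_mean; elim: S => [|i S IH].
  by under eq_fun do rewrite big_nil; exact: measurable_cst.
under eq_fun do rewrite big_cons; apply: measurable_maxe => //.
by apply: measurable_funeM; apply/measurable_EFinP.
Qed.

End mean.

Section buckley.
Local Open Scope ereal_scope.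
Context d (T : measurableType d) (R : realType).
Variable mu : {measure set T -> \bar R}.
Variables (I : choiceType) (Q : I -> set T).
Hypothesis mQ : forall i, measurable (Q i).
Variables (u : T -> R) (s K : R).
Hypotheses (mu_ : measurable_fun setT u) (u0 : forall x, (0 < u x)%R).
Hypotheses (s1 : (1 < s)%R) (K0 : (0 < K)%R).

(** The exponent is $1-s'$, so this is the $A_{s'}$ weight dual to [u]. *)
Definition dual_weight (x : T) : R := (u x `^ (- (s - 1)^-1))%R.
Local Notation sigma := dual_weight.

Let s0 : (0 < s)%R. Proof. exact: lt_trans ltr01 s1. Qed.
Let q0 : (0 < s - 1)%R. Proof. by rewrite subr_gt0. Qed.

Lemma dual_weight_gt0 x : (0 < sigma x)%R. Proof. by rewrite powR_gt0. Qed.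

Lemma measurable_dual_weight : measurable_fun setT sigma.
Proof.
by apply: (@measurableT_comp _ _ _ _ _ _ (@powR R ^~ (- (s - 1)^-1)%R)).
Qed.

Lemma dual_weight_powR x : (sigma x `^ (1 - s) = u x)%R.
Proof.
rewrite /dual_weight -powRrM (_ : (_ * _ = 1)%R) ?powRr1 ?ltW//.
by rewrite mulNr -mulrN opprB mulVf// gt_eqF.
Qed.

(** One Doob inequality in $L^{s'}(u)$ and one in $L^s(\sigma)$. *)
Definition buckley_cst : R :=
  (doob_cst (s / (s - 1)) * doob_cst s)%R.

Let s'1 : (1 < s / (s - 1))%R.
Proof. by rewrite ltr_pdivlMr// mul1r gtrBl. Qed.

Lemma buckley_cst_gt0 : (0 < buckley_cst)%R.
Proof. by rewrite mulr_gt0// doob_cst_gt0. Qed.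

(** The $A_s$ condition with constant [K] on the single set [Q i], multiplied by $\mu(Q_i)^s$ so
    that no average occurs. *)
Definition Aweight_on (i : I) := [/\ 0 < mu (Q i), mu (Q i) < +oo &
  \int[mu]_(x in Q i) (u x)%:E * (\int[mu]_(x in Q i) (sigma x)%:E) `^ (s - 1)
  <= K%:E * mu (Q i) `^ s].

(** With $c_i$ the $\sigma$-average of $f/\sigma$ over $Q_i$, the plain average of $f$ is
    $c_i\,\sigma(Q_i)/\mu(Q_i)$, and the $A_s$ condition bounds its power $s-1$ by $K$ times
    $c_i^{s-1}\mu(Q_i)/u(Q_i)$. Let $M$ be the maximum of the $c_j$ over the sets containing a
    point. As $c_i\le M$ on $Q_i$, the quantity multiplying $K$ is at most the $u$-average of
    $M^{s-1}/u$. Doob's inequality in $L^{s'}(u)$, then in $L^s(\sigma)$, concludes, since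
    $(M^{s-1}/u)^{s'}u=M^s\sigma$. *)
Lemma buckley_laminar (S : seq I) (f : T -> \bar R) :
  measurable_fun setT f -> (forall x, 0 <= f x) -> laminar Q S ->
  (forall i, i \in S -> Aweight_on i) ->
  \int[mu]_x (max_mean mu Q S f x `^ s * (u x)%:E) <=
  (buckley_cst * K `^ (s / (s - 1)))%:E * \int[mu]_x (f x `^ s * (u x)%:E).
Proof.
move=> mf f0 lam HA.
have mS := measurable_dual_weight.
have muE : measurable_fun setT (fun x => (u x)%:E) by exact/measurable_EFinP.
have mSE : measurable_fun setT (fun x => (sigma x)%:E) by exact/measurable_EFinP.
have mfs : measurable_fun setT (fun x => f x `^ s * (u x)%:E).
  apply: emeasurable_funM => //.
  by apply: (@measurableT_comp _ _ _ _ _ _ (@poweR R ^~ s)) => //; exact: measurable_poweR.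
set N := \int[mu]_x (f x `^ s * (u x)%:E).
have N0 : 0 <= N.
  by apply: integral_ge0 => x _; rewrite mule_ge0 ?poweR_ge0// lee_fin ltW.
have cst0 : (0 < buckley_cst * K `^ (s / (s - 1)))%R.
  by rewrite mulr_gt0 ?buckley_cst_gt0// powR_gt0.
have [Noo|Nfin] := eqVneq N +oo; first by rewrite Noo gt0_muley ?lte_fin// leey.
have {Nfin}Noo : N < +oo by rewrite ltey.
pose m i := fine (mu (Q i)).
pose U i := fine (\int[mu]_(x in Q i) (u x)%:E).
pose G i := fine (\int[mu]_(x in Q i) (sigma x)%:E).
pose F i := fine (\int[mu]_(x in Q i) f x).
have U_gt0 i : i \in S -> 0 < \int[mu]_(x in Q i) (u x)%:E.
  by move=> /HA[Q0 _ _]; exact: integral_gt0.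
have G_gt0 i : i \in S -> 0 < \int[mu]_(x in Q i) (sigma x)%:E.
  by move=> /HA[Q0 _ _]; apply: integral_gt0 => // x; exact: dual_weight_gt0.
have mE i : i \in S -> mu (Q i) = (m i)%:E.
  by move=> /HA[Q0 Qoo _]; rewrite fineK// ge0_fin_numE.
have m0 i : i \in S -> (0 < m i)%R.
  by move=> iS; rewrite -lte_fin -mE//; case: (HA _ iS).
have UGoo i : i \in S -> \int[mu]_(x in Q i) (u x)%:E *
    (\int[mu]_(x in Q i) (sigma x)%:E) `^ (s - 1) < +oo.
  move=> iS; case: (HA _ iS) => _ _ H; apply: le_lt_trans H _.
  by rewrite mE// poweR_EFin -EFinM ltry.
have UE i : i \in S -> \int[mu]_(x in Q i) (u x)%:E = (U i)%:E.
  move=> iS; rewrite fineK// ge0_fin_numE ?ltW ?U_gt0// ltey; apply/eqP => Uoo.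
  by have := UGoo _ iS; rewrite Uoo gt0_mulye ?ltxx// poweR_gt0// G_gt0.
have GE i : i \in S -> \int[mu]_(x in Q i) (sigma x)%:E = (G i)%:E.
  move=> iS; rewrite fineK// ge0_fin_numE ?ltW ?G_gt0// ltey; apply/eqP => Goo.
  have := UGoo _ iS; rewrite Goo poweRyr ?gt_eqF//.
  by rewrite gt0_muley ?ltxx// U_gt0.
have U0 i : i \in S -> (0 < U i)%R by move=> iS; rewrite -lte_fin -UE// U_gt0.
have G0 i : i \in S -> (0 < G i)%R by move=> iS; rewrite -lte_fin -GE// G_gt0.
(* Local integrability of $f$: pointwise $f=(f^su)^{1/s}\sigma^{1-1/s}\le f^su+\sigma$, and both
   terms have a finite integral over [Q i]. *)
have FE i : i \in S -> \int[mu]_(x in Q i) f x = (F i)%:E.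
  move=> iS; rewrite fineK// ge0_fin_numE ?integral_ge0//.
  apply: (@le_lt_trans _ _ (\int[mu]_(x in Q i) (f x `^ s * (u x)%:E + (sigma x)%:E))).
    apply: ge0_le_integral => //.
    - exact: measurable_funTS.
    - by apply: emeasurable_funD; exact: measurable_funTS.
    move=> x _; have := f0 x; case: (f x) => [y||//]; last first.
      move=> _; rewrite poweRyr ?gt_eqF// gt0_mulye ?lte_fin// addye//.
    rewrite lee_fin => y0; rewrite poweR_EFin -EFinM -EFinD lee_fin.
    have := @weighted_AMGM R s^-1 (y `^ s * u x) (sigma x).
    rewrite invr_gt0 s0 invf_lt1// s1 mulr_ge0 ?powR_ge0 ?(ltW (u0 x))//.
    move=> /(_ isT isT isT).
    rewrite powRM ?powR_ge0 ?(ltW (u0 x))// -powRrM divff ?gt_eqF// powRr1//.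
    rewrite -[in X in (X `^ s^-1)%R](dual_weight_powR x) -powRrM -mulrA -powRD; last first.
      by rewrite (gt_eqF (dual_weight_gt0 _)) implybT.
    have -> : ((1 - s) / s + (1 - s^-1) = 0)%R by field; rewrite gt_eqF.
    rewrite powRr0 mulr1 => /le_trans; apply.
    have si1 : (s^-1 <= 1)%R by rewrite invf_le1// ltW.
    have si0 : (0 <= s^-1)%R by rewrite invr_ge0 ltW.
    apply: lerD; first by rewrite ler_piMl// mulr_ge0// ?powR_ge0// ltW.
    by rewrite ler_piMl ?gerBl// ltW// dual_weight_gt0.
  rewrite ge0_integralD//; last 4 first.
  - by move=> x _; rewrite mule_ge0 ?poweR_ge0// lee_fin ltW.
  - exact: measurable_funTS.
  - by move=> x _; rewrite lee_fin ltW// dual_weight_gt0.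
  - exact: measurable_funTS.
  rewrite GE//; apply: lte_add_pinfty; last exact: ltry.
  apply: le_lt_trans Noo; apply: ge0_subset_integral => //.
  by move=> x _; rewrite mule_ge0 ?poweR_ge0// lee_fin ltW.
pose c i := (F i / G i)%R.
have c0 i : (0 <= c i)%R.
  rewrite divr_ge0// fine_ge0// integral_ge0// => x _.
  by rewrite lee_fin ltW// dual_weight_gt0.
pose phi x := f x * ((sigma x)^-1)%:E.
have phi0 x : 0 <= phi x by rewrite mule_ge0// lee_fin invr_ge0 ltW// dual_weight_gt0.
have mphi : measurable_fun setT phi.
  apply: emeasurable_funM => //; apply/measurable_EFinP.
  rewrite (_ : (fun x => _) = (fun x => u x `^ ((s - 1)^-1))%R).
    by apply: (@measurableT_comp _ _ _ _ _ _ (@powR R ^~ ((s - 1)^-1)%R)).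
  by apply/funext => x; rewrite /dual_weight powRN invrK.
have phiE x : phi x * (sigma x)%:E = f x.
  by rewrite /phi -muleA -EFinM mulVf ?mule1// gt_eqF// dual_weight_gt0.
(* Doob's inequality in $L^s(\sigma)$ for $f/\sigma$, whose norm there is that of $f$ in
   $L^s(u)$. *)
have M1 : \int[mu]_x (max_seq Q c S x `^ s * sigma x)%:E <= (doob_cst s)%:E * N.
  have -> : N = \int[mu]_x (phi x `^ s * (sigma x)%:E).
    apply: eq_integral => x _.
    rewrite /phi poweRM//; last by rewrite lee_fin invr_ge0 ltW// dual_weight_gt0.
    rewrite poweR_EFin -muleA -EFinM -(powR_inv1 (ltW (dual_weight_gt0 x))) -powRrM.
    rewrite mulN1r -[X in (_ * (_ * X)%:E)%E](powRr1 (ltW (dual_weight_gt0 x))).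
    rewrite -powRD; last by rewrite (gt_eqF (dual_weight_gt0 _)) implybT.
    by rewrite addrC dual_weight_powR.
  apply: (doob_laminar mQ c0 mS _ mphi phi0 s1 lam) => [x|i iS|i iS].
  - by rewrite ltW// dual_weight_gt0.
  - by rewrite GE// ltry.
  under [leRHS]eq_integral do rewrite phiE.
  by rewrite GE// FE// -EFinM lee_fin /c divfK// gt_eqF// G0.
pose e i := (c i `^ (s - 1) * (m i / U i))%R.
have e0 i : (0 <= e i)%R.
  rewrite mulr_ge0 ?powR_ge0// divr_ge0// fine_ge0// integral_ge0// => x _.
  by rewrite lee_fin ltW.
have mM1 := measurable_max_seq mQ c S.
pose psi x := (max_seq Q c S x `^ (s - 1) / u x)%R%:E.
have psiE x : psi x * (u x)%:E = (max_seq Q c S x `^ (s - 1))%R%:E.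
  by rewrite /psi -EFinM divfK// gt_eqF.
have mpow : measurable_fun setT (fun x => max_seq Q c S x `^ (s - 1))%R.
  by apply: (@measurableT_comp _ _ _ _ _ _ (@powR R ^~ (s - 1)%R)).
have M2 : \int[mu]_x (max_seq Q e S x `^ (s / (s - 1)) * u x)%:E <=
    (doob_cst (s / (s - 1)))%:E * \int[mu]_x (max_seq Q c S x `^ s * sigma x)%:E.
  have mpsi : measurable_fun setT psi.
    apply/measurable_EFinP; apply: measurable_funM => //.
    rewrite (_ : (fun x => _) = (fun x => u x `^ (-1))%R).
      by apply: (@measurableT_comp _ _ _ _ _ _ (@powR R ^~ (-1)%R)).
    by apply/funext => x; rewrite powR_inv1// ltW.
  have psi0 x : 0 <= psi x by rewrite lee_fin divr_ge0 ?powR_ge0// ltW.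
  rewrite [X in _ <= _ * X](_ : _ = \int[mu]_x (psi x `^ (s / (s - 1)) * (u x)%:E)).
    apply: (doob_laminar mQ e0 mu_ _ mpsi psi0 s'1 lam) => [x|i iS|i iS].
    - exact: ltW.
    - by rewrite UE// ltry.
    under [leRHS]eq_integral do rewrite psiE.
    rewrite UE// -EFinM.
    have -> : (e i * U i = c i `^ (s - 1) * m i)%R.
      by rewrite /e -mulrA divfK// gt_eqF// U0.
    rewrite EFinM -mE// -integral_cst//.
    apply: ge0_le_integral => //.
    - by move=> x _; rewrite lee_fin powR_ge0.
    - by apply/measurable_EFinP; exact: measurable_funTS.
    move=> x Qx; rewrite lee_fin; apply: ge0_ler_powR; rewrite ?nnegrE ?c0 ?max_seq_ge0 ?(ltW q0)//.
    exact: le_max_seq.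
  apply: eq_integral => x _.
  rewrite /psi poweR_EFin -EFinM powRM ?powR_ge0 ?invr_ge0 ?(ltW (u0 x))//.
  rewrite -powRrM mulrCA divff ?gt_eqF// mulr1.
  rewrite -(powR_inv1 (ltW (u0 x))) -powRrM -mulrA.
  congr (_ * _)%:E; rewrite -[X in (_ = _ * X)%R](powRr1 (ltW (u0 x))).
  rewrite -powRD; last by rewrite (gt_eqF (u0 _)) implybT.
  by have -> : (-1 * (s / (s - 1)) + 1 = - (s - 1)^-1)%R by field; rewrite gt_eqF.
have pt x : max_mean mu Q S f x `^ s <= (K `^ (s / (s - 1)) *
    max_seq Q e S x `^ (s / (s - 1)))%R%:E.
  have M0 : (0 <= max_seq Q e S x)%R by exact: max_seq_ge0.
  have : max_mean mu Q S f x <= ((K * max_seq Q e S x) `^ ((s - 1)^-1))%R%:E.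
    apply: max_mean_le => [|i iS Qx]; first by rewrite lee_fin powR_ge0.
    rewrite /mean FE// mE// inver gt_eqF ?m0// -EFinM lee_fin.
    have F0 : (0 <= F i)%R by rewrite fine_ge0// integral_ge0.
    have t0 : (0 <= (m i)^-1 * F i)%R by rewrite mulr_ge0// invr_ge0 ltW// m0.
    rewrite [leLHS](_ : _ = (((m i)^-1 * F i) `^ (s - 1)) `^ (s - 1)^-1)%R; last first.
      by rewrite -powRrM divff ?powRr1// gt_eqF.
    apply: ge0_ler_powR; rewrite ?nnegrE ?powR_ge0 ?invr_ge0 ?(ltW q0)//.
      by rewrite mulr_ge0// ltW.
    apply: (@le_trans _ _ (K * e i)%R); last first.
      by rewrite ler_wpM2l ?(ltW K0)//; exact: le_max_seq.
    have -> : ((m i)^-1 * F i = c i * (G i / m i))%R.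
      by rewrite /c; field; rewrite !gt_eqF ?m0 ?G0.
    rewrite /e powRM//; last by rewrite divr_ge0 ?ltW ?m0 ?G0.
    rewrite mulrCA ler_wpM2l ?powR_ge0//.
    case: (HA _ iS) => _ _; rewrite UE// GE// mE// !poweR_EFin -!EFinM lee_fin => H.
    have m0' := m0 _ iS.
    rewrite powRM ?invr_ge0 ?(ltW m0') ?(ltW (G0 _ iS))//.
    rewrite -(powR_inv1 (ltW m0')) -powRrM mulN1r powRN ler_pdivrMr ?powR_gt0//.
    have -> : (K * (m i / U i) * m i `^ (s - 1) = K * m i `^ s / U i)%R.
      by rewrite -(mulr_powRB1 (ltW m0') s0); field; rewrite gt_eqF// U0.
    by rewrite ler_pdivlMr ?U0// mulrC.
  move=> H; apply: (@le_trans _ _ (((K * max_seq Q e S x) `^ ((s - 1)^-1))%R%:E `^ s)).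
    by apply: gt0_ler_poweR; rewrite ?in_itv/= ?leey ?andbT ?(ltW s0)// ?max_mean_ge0// lee_fin powR_ge0.
  by rewrite poweR_EFin lee_fin -powRrM (mulrC _ s) powRM// ltW.
have mM2 : measurable_fun setT (fun x => max_seq Q e S x `^ (s / (s - 1)))%R.
  apply: (@measurableT_comp _ _ _ _ _ _ (@powR R ^~ (s / (s - 1))%R)) => //.
  exact: measurable_max_seq.
apply: (@le_trans _ _ (\int[mu]_x ((K `^ (s / (s - 1)))%:E *
    (max_seq Q e S x `^ (s / (s - 1)) * u x)%:E))).
  apply: ge0_le_integral => //.
  - by move=> x _; rewrite mule_ge0 ?poweR_ge0// lee_fin ltW.
  - apply: emeasurable_funM => //.
    apply: (@measurableT_comp _ _ _ _ _ _ (@poweR R ^~ s)) => //.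
      exact: measurable_poweR.
    exact: measurable_max_mean.
  - by apply: measurable_funeM; apply/measurable_EFinP; exact: measurable_funM.
  move=> x _; rewrite -EFinM mulrA EFinM; apply: lee_wpmul2r; last exact: pt.
  by rewrite lee_fin ltW.
rewrite ge0_integralZl//; last 3 first.
- by apply/measurable_EFinP; exact: measurable_funM.
- by move=> x _; rewrite lee_fin mulr_ge0 ?powR_ge0// ltW.
- by rewrite lee_fin powR_ge0.
rewrite (mulrC buckley_cst) EFinM -muleA; apply: lee_wpmul2l; first by rewrite lee_fin powR_ge0.
apply: (le_trans M2); rewrite /buckley_cst (EFinM (doob_cst _) (doob_cst s)) -muleA.
by apply: lee_wpmul2l; rewrite // lee_fin ltW// doob_cst_gt0.
Qed.

End buckley.

(** * The Rubio de Francia algorithm *)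

Section ereal_powers.
Local Open Scope ereal_scope.
Context {R : realType}.
Implicit Types (x y : \bar R) (r s : R).

Lemma lee_poweR r x y : (0 <= r)%R -> 0 <= x -> x <= y -> x `^ r <= y `^ r.
Proof.
move=> r0 x0 xy; apply: gt0_ler_poweR => //.
  by rewrite in_itv/= x0 leey.
by rewrite in_itv/= (le_trans x0 xy) leey.
Qed.

Lemma poweRK s x : s != 0%R -> 0 <= x -> (x `^ s) `^ s^-1 = x.
Proof. by move=> s0 x0; rewrite -poweRrM divff// poweRe1. Qed.

Lemma poweRVK s x : s != 0%R -> 0 <= x -> (x `^ s^-1) `^ s = x.
Proof. by move=> s0 x0; rewrite -poweRrM mulVf// poweRe1. Qed.

Lemma poweR_midpoint_le s x y : (1 <= s)%R -> 0 <= x -> 0 <= y ->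
  (x + y) `^ s <= (2 `^ s / 2)%:E * (x `^ s + y `^ s).
Proof.
move=> s1; have s0 : (0 < s)%R by rewrite (lt_le_trans ltr01).
have k0 : (0 < 2 `^ s / 2 :> R)%R by rewrite divr_gt0// powR_gt0.
have ky : (2 `^ s / 2)%:E * +oo = +oo :> \bar R by rewrite gt0_muley.
case: x => [x||//]; case: y => [y||//]; last 3 first.
- by move=> _ _; rewrite poweRyr ?gt_eqF// addey// ?ky ?leey// poweR_EFin.
- by move=> _ _; rewrite poweRyr ?gt_eqF// addye// ?ky ?leey// poweR_EFin.
- by move=> _ _; rewrite poweRyr ?gt_eqF// addye// ky leey.
rewrite !lee_fin => x0 y0.
rewrite [X in (X `^ _ <= _)%R](_ : _ = 2 * (2^-1 * (x + y)))%R; last by field.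
rewrite powRM//; last by rewrite mulr_ge0// addr_ge0.
rewrite -mulrA ler_wpM2l ?powR_ge0//.
exact: powR_midpoint_le.
Qed.

Context d (T : measurableType d).

Lemma measurable_poweR_comp s (f : T -> \bar R) :
  measurable_fun setT f -> measurable_fun setT (fun t => f t `^ s).
Proof.
move=> mf; apply: (@measurableT_comp _ _ _ _ _ _ (@poweR R ^~ s)) => //.
exact: measurable_poweR.
Qed.

Lemma measurable_powR_comp s (f : T -> R) :
  measurable_fun setT f -> measurable_fun setT (fun t => f t `^ s)%R.
Proof. exact: (@measurableT_comp _ _ _ _ _ _ (@powR R ^~ s)). Qed.

End ereal_powers.

Section rubio_de_francia.
Local Open Scope ereal_scope.
Context d (T : measurableType d) (R : realType).
Variable mu : {measure set T -> \bar R}.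
Variables (I : countType) (C : finType) (color : I -> C) (Q : I -> set T).
Hypothesis mQ : forall i, measurable (Q i).
Hypothesis laminarQ : forall i j, color i = color j ->
  [\/ Q i `<=` Q j, Q j `<=` Q i | Q i `&` Q j = set0].
Variables (u : T -> R) (s K : R).
Hypotheses (mu_ : measurable_fun setT u) (u0 : forall x, (0 < u x)%R).
Hypotheses (s1 : (1 < s)%R) (K0 : (0 < K)%R).
Hypothesis AQ : forall i, Aweight_on mu Q u s K i.

Let s0 : (0 < s)%R. Proof. exact: lt_trans ltr01 s1. Qed.

Local Notation norm_pow f := (\int[mu]_x (f x `^ s * (u x)%:E)).

Let muE : measurable_fun setT (fun x => (u x)%:E).
Proof. exact/measurable_EFinP. Qed.

Let mnorm (f : T -> \bar R) : measurable_fun setT f ->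
  measurable_fun setT (fun x => f x `^ s * (u x)%:E).
Proof. by move=> mf; apply: emeasurable_funM => //; exact: measurable_poweR_comp. Qed.

Let norm0 (f : T -> \bar R) x : 0 <= f x `^ s * (u x)%:E.
Proof. by rewrite mule_ge0 ?poweR_ge0// lee_fin ltW. Qed.

(** Laminarity holds only within a colour. The maximum over all cells is the largest of the [#|C|]
    one-colour maximal functions, and its $s$-th power is at most the sum of theirs. *)
Lemma max_mean_bound (S : seq I) (f : T -> \bar R) :
  measurable_fun setT f -> (forall x, 0 <= f x) ->
  norm_pow (max_mean mu Q S f) <=
  (#|C|%:R * (buckley_cst s * K `^ (s / (s - 1))))%:E * norm_pow f.
Proof.
move=> mf f0; pose Sc c := [seq i <- S | color i == c].
apply: (@le_trans _ _ (\int[mu]_x \sum_(c <- enum C)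
    (max_mean mu Q (Sc c) f x `^ s * (u x)%:E))).
  apply: ge0_le_integral => //.
  - by apply: mnorm; exact: measurable_max_mean.
  - by apply: emeasurable_sum => c; apply: mnorm; exact: measurable_max_mean.
  move=> x _; rewrite -ge0_sume_distrl; last by move=> c _; exact: poweR_ge0.
  apply: lee_wpmul2r; first by rewrite lee_fin ltW.
  set y := (X in _ <= X).
  have y0 : 0 <= y by apply: sume_ge0 => c _; exact: poweR_ge0.
  rewrite -(poweRVK (lt0r_neq0 s0) y0); apply: lee_poweR; rewrite ?(ltW s0) ?max_mean_ge0//.
  apply: max_mean_le; first exact: poweR_ge0.
  move=> i iS Qx; have m0 := max_mean_ge0 mu Q (Sc (color i)) f x.
  apply: (@le_trans _ _ (max_mean mu Q (Sc (color i)) f x)).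
    by apply: le_max_mean => //; rewrite mem_filter eqxx.
  rewrite -[leLHS](poweRK (lt0r_neq0 s0))//; apply: lee_poweR.
  - by rewrite invr_ge0 ltW.
  - exact: poweR_ge0.
  rewrite /y (bigD1_seq (color i)) ?mem_enum ?enum_uniq//=.
  by rewrite leeDl// sume_ge0// => c _; exact: poweR_ge0.
rewrite ge0_integral_sum//; last first.
  by move=> c; apply: mnorm; exact: measurable_max_mean.
rewrite (@le_trans _ _ (\sum_(c <- enum C)
  (buckley_cst s * K `^ (s / (s - 1)))%:E * norm_pow f))//.
  apply: lee_sum => c _; apply: buckley_laminar => // i j.
  by rewrite !mem_filter => /andP[/eqP <- _] /andP[/eqP ji _]; exact: laminarQ.
rewrite big_const_seq count_predT -cardE (EFinM #|C|%:R) -muleA.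
set X := _%:E * norm_pow f.
have X0 : 0 <= X.
  rewrite mule_ge0//; last by apply: integral_ge0 => x _.
  by rewrite lee_fin mulr_ge0 ?powR_ge0 ?(ltW (buckley_cst_gt0 s1)).
elim: #|C| => [|n IH]; first by rewrite mul0e.
by rewrite iterS -natr1 EFinD ge0_muleDl ?lee_fin// mul1e addeC leeD2r.
Qed.

(** A bound for the norm on $L^s(u)$ of the maximal operator over any finite list: the $s$-th root
    of the constant in [max_mean_bound]. *)
Definition rdf_cst : R :=
  ((#|C|%:R * (buckley_cst s * K `^ (s / (s - 1)))) `^ s^-1)%R.

Hypothesis C0 : (0 < #|C|)%N.

Let B0 : (0 < #|C|%:R * (buckley_cst s * K `^ (s / (s - 1))) :> R)%R.
Proof. by rewrite mulr_gt0 ?ltr0n// mulr_gt0 ?(buckley_cst_gt0 s1)// powR_gt0. Qed.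

Lemma rdf_cst_gt0 : (0 < rdf_cst)%R.
Proof. by rewrite powR_gt0. Qed.

(** Chosen so that [k] times the maximal operator has norm at most $1/2$. *)
Let k : R := (2 * rdf_cst)^-1.

Let k0 : (0 < k)%R.
Proof. by rewrite invr_gt0 mulr_gt0 ?rdf_cst_gt0. Qed.

(** Finite lists exhausting [I]: each iterate involves finitely many cells only, and the limit sees
    all of them. *)
Let first_cells n : seq I := pmap unpickle (iota 0 n).

Variable h0 : T -> \bar R.
Hypotheses (mh0 : measurable_fun setT h0) (h0_ge0 : forall x, 0 <= h0 x).

(* Replaces the series of iterated maximal functions of the usual algorithm. *)
Fixpoint rdf_iter n : T -> \bar R :=
  if n is m.+1 then
    fun x => h0 x + k%:E * max_mean mu Q (first_cells m) (rdf_iter m) x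
  else h0.

Let rdf_iter_ge0 n x : 0 <= rdf_iter n x.
Proof.
case: n => //= n; rewrite adde_ge0// mule_ge0 ?max_mean_ge0// lee_fin.
exact: ltW.
Qed.

Let measurable_rdf_iter n : measurable_fun setT (rdf_iter n).
Proof.
case: n => //= n; apply: emeasurable_funD => //; apply: measurable_funeM.
exact: measurable_max_mean.
Qed.

Let le_mean i (f g : T -> \bar R) : measurable_fun setT f -> measurable_fun setT g ->
  (forall x, 0 <= f x) -> (forall x, f x <= g x) ->
  mean mu (Q i) f <= mean mu (Q i) g.
Proof.
move=> mf mg f0 fg; apply: lee_wpmul2l; first by rewrite inve_ge0.
by apply: ge0_le_integral => //; exact: measurable_funTS.
Qed.

Let mem_first_cells i n : (pickle i < n)%N -> i \in first_cells n.
Proof.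
move=> ni; rewrite mem_pmap; apply/mapP; exists (pickle i); rewrite ?pickleK//.
by rewrite mem_iota.
Qed.

Let sub_first_cells n : {subset first_cells n <= first_cells n.+1}.
Proof.
move=> i; rewrite !mem_pmap => /mapP[m]; rewrite mem_iota add0n => /andP[_ mn] ->.
by apply: map_f; rewrite mem_iota add0n leq0n ltnS ltnW.
Qed.

Let rdf_iterS n x : rdf_iter n x <= rdf_iter n.+1 x.
Proof.
elim: n x => [|n IH] x.
  by rewrite /= leeDl// mule_ge0 ?max_mean_ge0// lee_fin ltW.
apply: leeD => //; apply: lee_wpmul2l; first by rewrite lee_fin ltW.
apply: max_mean_le; first exact: max_mean_ge0.
move=> i iS Qx; apply: le_trans (le_max_mean _ _ (sub_first_cells iS) Qx).
exact: (le_mean _ (measurable_rdf_iter n) (measurable_rdf_iter n.+1)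
  (rdf_iter_ge0 n) IH).
Qed.

Let rdf_nd x : nondecreasing_seq (rdf_iter ^~ x).
Proof. by apply/nondecreasing_seqP => n; exact: rdf_iterS. Qed.

(** The bound reproduces itself: if an iterate has norm at most $2\|h_0\|$, then [k] times its
    maximal function has norm at most $\|h_0\|$, and $(x+y)^s\le2^{s-1}(x^s+y^s)$ replaces
    Minkowski's inequality. *)
Let rdf_iter_norm n : norm_pow (rdf_iter n) <= (2 `^ s)%:E * norm_pow h0.
Proof.
have J0 : 0 <= norm_pow h0 by apply: integral_ge0 => x _.
elim: n => [|n IH].
  rewrite /= -[leLHS]mul1e; apply: lee_wpmul2r => //; rewrite lee_fin.
  have : (2 `^ 0 <= 2 `^ s :> R)%R by apply: ler_powR; rewrite ?ler1n// ltW.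
  by rewrite powRr0.
set M := max_mean mu Q (first_cells n) (rdf_iter n).
have mM : measurable_fun setT M by exact: measurable_max_mean.
have c0 : (0 <= 2 `^ s / 2 :> R)%R by rewrite divr_ge0 ?powR_ge0.
have kM x : 0 <= k%:E * M x by rewrite mule_ge0 ?max_mean_ge0// lee_fin ltW.
apply: (@le_trans _ _ (\int[mu]_x ((2 `^ s / 2)%:E *
    (h0 x `^ s * (u x)%:E + (k `^ s)%:E * (M x `^ s * (u x)%:E))))).
  apply: ge0_le_integral => //.
  - exact: mnorm.
  - apply: measurable_funeM; apply: emeasurable_funD; first exact: mnorm.
    by apply: measurable_funeM; exact: mnorm.
  move=> x _; rewrite [(k `^ s)%:E * _]muleA -poweR_EFin -poweRM; last 2 first.
  - by rewrite lee_fin ltW.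
  - exact: max_mean_ge0.
  rewrite -ge0_muleDl ?poweR_ge0// muleA.
  apply: lee_wpmul2r; first by rewrite lee_fin ltW.
  by apply: poweR_midpoint_le; rewrite ?(ltW s1).
rewrite ge0_integralZl//; last 2 first.
- by apply: emeasurable_funD; [exact: mnorm|apply: measurable_funeM; exact: mnorm].
- by move=> x _; rewrite adde_ge0// mule_ge0// lee_fin powR_ge0.
rewrite ge0_integralD//; last 3 first.
- exact: mnorm.
- by move=> x _; rewrite mule_ge0// lee_fin powR_ge0.
- by apply: measurable_funeM; exact: mnorm.
rewrite ge0_integralZl//; last 2 first.
- exact: mnorm.
- by rewrite lee_fin powR_ge0.
have H : (k `^ s)%:E * norm_pow M <= norm_pow h0.
  have := max_mean_bound (first_cells n) (measurable_rdf_iter n) (rdf_iter_ge0 n).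
  rewrite -/M => H1.
  apply: (@le_trans _ _ ((k `^ s)%:E *
     ((#|C|%:R * (buckley_cst s * K `^ (s / (s - 1))))%:E *
       ((2 `^ s)%:E * norm_pow h0)))).
    apply: lee_wpmul2l; first by rewrite lee_fin powR_ge0.
    apply: (le_trans H1); apply: lee_wpmul2l => //.
    by rewrite lee_fin ltW.
  rewrite !muleA -!EFinM /k.
  have r0 := rdf_cst_gt0.
  have -> : (#|C|%:R * (buckley_cst s * K `^ (s / (s - 1))) = rdf_cst `^ s)%R.
    by rewrite /rdf_cst -powRrM mulVf ?powRr1 ?ltW// gt_eqF.
  have k_ge0 : (0 <= (2 * rdf_cst)^-1)%R by rewrite invr_ge0 mulr_ge0// ltW.
  have r2_ge0 : (0 <= rdf_cst * 2)%R by rewrite mulr_ge0// ltW.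
  rewrite -mulrA -(powRM _ (ltW r0))// -(powRM _ k_ge0)// mulrC.
  by rewrite (mulrC rdf_cst) divff ?powR1 ?mul1e// gt_eqF// mulr_gt0.
apply: (@le_trans _ _ ((2 `^ s / 2)%:E * (norm_pow h0 + norm_pow h0))).
  by apply: lee_wpmul2l; rewrite ?lee_fin//; exact: leeD2l.
rewrite -mule2n -[in leLHS]mule_natl muleA -EFinM.
by rewrite divfK.
Qed.

(** In the limit $h\ge h_0+k\,Mh$ for the maximal operator $M$ over all cells, which contains the
    $A_1$ estimate $Mh\le k^{-1}h$. The comparison of the means of [h0] and [h] is recorded because
    it later forces [h] to be positive everywhere. *)
Lemma rubio_de_francia : exists h : T -> \bar R,
  [/\ measurable_fun setT h, forall x, h0 x <= h x,
    norm_pow h <= (2 `^ s)%:E * norm_pow h0,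
    forall i, mean mu (Q i) h0 <= mean mu (Q i) h &
    forall i x, Q i x -> mean mu (Q i) h <= (2 * rdf_cst)%:E * h x].
Proof.
pose h x := limn (rdf_iter ^~ x).
have cvg_h x : cvgn (rdf_iter ^~ x) by exact: ereal_nondecreasing_is_cvgn.
have le_h n x : rdf_iter n x <= h x.
  apply: lime_ge => //; near=> m; apply: rdf_nd.
  by near: m; exact: nbhs_infty_ge.
have h_le x y : (forall n, rdf_iter n x <= y) -> h x <= y.
  by move=> H; apply: lime_le => //; exact: nearW.
have mh : measurable_fun setT h.
  by apply: (emeasurable_fun_cvg rdf_iter _ measurable_rdf_iter) => x _; exact: cvg_h.
have h_ge0 x : 0 <= h x := le_trans (rdf_iter_ge0 0 x) (le_h 0%N x).
exists h; split=> //.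
- exact: (le_h 0%N).
- pose g n x := rdf_iter n x `^ s * (u x)%:E.
  have mg n : measurable_fun setT (g n) by exact: mnorm.
  have g0 n x : setT x -> 0 <= g n x by move=> _; exact: norm0.
  have ndg x : setT x -> nondecreasing_seq (g ^~ x).
    move=> _ m n mn; apply: lee_wpmul2r; first by rewrite lee_fin ltW.
    by apply: lee_poweR; rewrite ?(ltW s0)//; exact: rdf_nd.
  apply: (@le_trans _ _ (\int[mu]_x limn (g ^~ x))).
    apply: ge0_le_integral => //.
    - exact: mnorm.
    - apply: (emeasurable_fun_cvg g _ mg) => x _.
      by apply: ereal_nondecreasing_is_cvgn; exact: ndg.
    move=> x _; set L := limn _.
    have gL n : g n x <= L.
      apply: lime_ge; first by apply: ereal_nondecreasing_is_cvgn; exact: ndg.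
      by near=> m; apply: ndg => //; near: m; exact: nbhs_infty_ge.
    have L0 : 0 <= L := le_trans (g0 0%N x Logic.I) (gL 0%N).
    have Lu0 : 0 <= L * ((u x)^-1)%:E by rewrite mule_ge0// lee_fin invr_ge0 ltW.
    (* No limit is taken inside the power: at [x] each iterate is at most $(L/u)^{1/s}$, hence so is
       [h x]. *)
    have hx : h x <= (L * ((u x)^-1)%:E) `^ s^-1.
      apply: h_le => n; rewrite -[leLHS](poweRK (lt0r_neq0 s0))//.
      apply: lee_poweR; rewrite ?poweR_ge0 ?invr_ge0 ?(ltW s0)//.
      rewrite -[leLHS]mule1 -(@divff _ (u x)) ?gt_eqF// EFinM muleA.
      by apply: lee_wpmul2r; rewrite ?lee_fin ?invr_ge0 ?(ltW (u0 x))//; exact: gL.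
    apply: (@le_trans _ _ (((L * ((u x)^-1)%:E) `^ s^-1) `^ s * (u x)%:E)).
      by apply: lee_wpmul2r; [rewrite lee_fin ltW|apply: lee_poweR => //; exact: ltW].
    by rewrite poweRVK ?gt_eqF// -muleA -EFinM mulVf ?mule1// gt_eqF.
  rewrite monotone_convergence//; apply: lime_le.
    apply: ereal_nondecreasing_is_cvgn => m n mn.
    by apply: ge0_le_integral => // x _; [exact: g0|exact: ndg].
  by apply: nearW => n; exact: rdf_iter_norm.
- by move=> i; apply: le_mean => //; exact: (le_h 0%N).
move=> i x Qx; rewrite /mean.
have -> : \int[mu]_(y in Q i) h y =
    limn (fun n => \int[mu]_(y in Q i) rdf_iter n y).
  rewrite -monotone_convergence//.
  by move=> n; exact: measurable_funTS.
have [Q0 Qoo _] := AQ i.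
have QE : mu (Q i) = (fine (mu (Q i)))%:E by rewrite fineK// ge0_fin_numE.
have q0 : (0 < fine (mu (Q i)))%R by rewrite fine_gt0// Q0.
have cvgI : cvgn (fun n => \int[mu]_(y in Q i) rdf_iter n y).
  apply: ereal_nondecreasing_is_cvgn => m n mn.
  by apply: ge0_le_integral => //; [exact: measurable_funTS|exact: measurable_funTS
    |move=> y _; exact: rdf_nd].
rewrite QE inver gt_eqF// muleC lee_pdivrMr//.
(* Once [n] exceeds the code of [i], the cell [Q i] takes part in the step from [n] to [n.+1]. *)
apply: lime_le => //; near=> n.
rewrite -lee_pdivrMr//.
have : mean mu (Q i) (rdf_iter n) <= (2 * rdf_cst)%:E * h x.
  apply: (@le_trans _ _ ((2 * rdf_cst)%:E * rdf_iter n.+1 x)); last first.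
    by apply: lee_wpmul2l => //; rewrite lee_fin mulr_ge0// ltW// rdf_cst_gt0.
  apply: (@le_trans _ _ ((2 * rdf_cst)%:E *
     (k%:E * max_mean mu Q (first_cells n) (rdf_iter n) x))).
    rewrite muleA -EFinM /k divff ?mul1e; last by rewrite gt_eqF// mulr_gt0// rdf_cst_gt0.
    apply: le_max_mean => //; apply: mem_first_cells.
    by near: n; exact: nbhs_infty_gt.
  apply: lee_wpmul2l; first by rewrite lee_fin mulr_ge0// ltW// rdf_cst_gt0.
  by rewrite /= leeDr.
by rewrite /mean QE inver gt_eqF// muleC.
Unshelve. all: by end_near. Qed.

End rubio_de_francia.

Section positive_part.
Local Open Scope ereal_scope.
Context {R : realType}.

(** The default 1 keeps the value a positive real at every point, so that all real powers behave; a
    weight is changed only on a null set. *)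
Definition pos_fine (x : \bar R) : R := if (0 < x) && (x < +oo) then fine x else 1%R.

Lemma pos_fine_gt0 x : (0 < pos_fine x)%R.
Proof. by rewrite /pos_fine; case: ifPn => // xoo; exact: fine_gt0. Qed.

Lemma pos_fineK x : 0 < x < +oo -> (pos_fine x)%:E = x.
Proof.
by move=> /[dup] xoo /andP[x0 xy]; rewrite /pos_fine xoo fineK// gt0_fin_numE.
Qed.

Lemma measurable_pos_fine d (T : measurableType d) (f : T -> \bar R) :
  measurable_fun setT f -> measurable_fun setT (fun x => pos_fine (f x)).
Proof.
move=> mf; apply: measurable_fun_ifT.
- apply: measurable_and; apply: measurable_fun_lte => //.
- exact: measurableT_comp.
- exact: measurable_cst.
Qed.

End positive_part.

(** * Dyadic cells *)

Section dyadic_grids.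
Context {R : realType}.
Implicit Types (b : bool) (k : int) (t : R).

(* The grid of scale [2 ^ k], shifted by a third of the mesh when [b] is set; the
   alternating sign makes the shifted grids nested. *)
Definition grid_index b k t : int :=
  Num.floor (t / 2 ^ k - b%:R * (-1) ^ k / 3).

(** For an integer $z$, $z\le(x+m)/2$ means $2z-m\le x$, which only involves the floor of [x]. *)
Lemma floor_half_shift (m : int) (x y : R) : Num.floor x = Num.floor y ->
  Num.floor ((x + m%:~R) / 2) = Num.floor ((y + m%:~R) / 2).
Proof.
have le (x' y' : R) : Num.floor x' = Num.floor y' ->
    (Num.floor ((x' + m%:~R) / 2) <= Num.floor ((y' + m%:~R) / 2))%R.
  move=> xy; rewrite floor_ge_int ler_pdivlMr// -lerBlDr.
  rewrite -[X in _ * X]/(2%:~R) -intrM -intrB -floor_ge_int -xy floor_ge_int.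
  rewrite intrB intrM lerBlDr -ler_pdivlMr//.
  exact: ge_floor.
by move=> xy; apply/eqP; rewrite eq_le !le.
Qed.

(** With $d=b(-1)^k/3$, the shift at scale $k+1$ is $-d$, and $x/2^{k+1}+d=((x/2^k-d)+3d)/2$ where
    $3d$ is an integer. Hence the shift by one third and its alternating sign. *)
Lemma grid_index_step b k t t' : grid_index b k t = grid_index b k t' ->
  grid_index b (k + 1) t = grid_index b (k + 1) t'.
Proof.
pose m : int := b%:R * (-1) ^ k.
have mE : m%:~R = b%:R * (-1) ^ k :> R by rewrite intrM rmorphXz ?rmorphN1 ?rmorph_nat//= unitrN1.
have E x : x / 2 ^ (k + 1) - b%:R * (-1) ^ (k + 1) / 3 =
    (x / 2 ^ k - b%:R * (-1) ^ k / 3 + m%:~R) / 2 :> R.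
  rewrite mE !expfzDr ?oppr_eq0 ?oner_eq0// !expr1z.
  have : (2 : R) ^ k != 0 by rewrite expfz_neq0.
  by set p := (2 : R) ^ k; set q := (-1) ^ k => p0; field.
by rewrite /grid_index => /(floor_half_shift m); rewrite -!E.
Qed.

Lemma grid_index_coarser b k k' t t' : (k <= k')%R ->
  grid_index b k t = grid_index b k t' -> grid_index b k' t = grid_index b k' t'.
Proof.
move=> kk' H; have -> : k' = k + `|k' - k|%N%:Z by rewrite gez0_abs ?subr_ge0// subrKC.
elim: `|k' - k|%N => [|m IH]; first by rewrite addr0.
by rewrite intS (addrC 1) addrA; exact: grid_index_step.
Qed.

Lemma grid_indexP b k t z : grid_index b k t = z <->
  2 ^ k * (z%:~R + b%:R * (-1) ^ k / 3) <= t <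
  2 ^ k * (z%:~R + b%:R * (-1) ^ k / 3) + 2 ^ k.
Proof.
have k0 : (0 : R) < 2 ^ k by rewrite exprz_gt0.
rewrite -[X in _ < _ + X]mulr1 -mulrDr.
rewrite mulrC -ler_pdivlMr// (mulrC _ (_ + 1)) -ltr_pdivrMr//.
rewrite -lerBrDr addrAC -ltrBlDr.
rewrite -[z%:~R + 1](intrD _ z 1) /grid_index.
by split=> [<-|H]; [exact: floor_itv|exact: floor_def].
Qed.

(** If the unshifted grid has a division point in $(t,t+l]$, those of the shifted grid are at least
    a third of the mesh away from it; as $l$ is at most a third of the mesh, none of them falls in
    that interval. *)
Lemma one_third_trick (k : int) (t l : R) : 0 < l -> 3 * l <= 2 ^ k ->
  exists b, forall t', t <= t' <= t + l -> grid_index b k t' = grid_index b k t.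
Proof.
move=> l0 lk; have k0 : (0 : R) < 2 ^ k by rewrite exprz_gt0.
(* The index is monotone in the point, so comparing the two ends is enough. *)
suff [b bP] : exists b, grid_index b k (t + l) <= grid_index b k t.
  exists b => t' /andP[tt' t'l]; apply/eqP; rewrite eq_le.
  have mono x y : x <= y -> grid_index b k x <= grid_index b k y.
    by move=> xy; apply: le_floor; rewrite lerB// ler_pM2r// invr_gt0.
  by rewrite (le_trans (mono _ _ t'l))// mono.
have [le0|lt0] := leP (grid_index false k (t + l)) (grid_index false k t).
  by exists false.
exists true; move: lt0; rewrite /grid_index !mul0r !subr0 mul1r => lt0.
set y := t / 2 ^ k; set m := Num.floor y.
have yE : (t + l) / 2 ^ k = y + l / 2 ^ k by rewrite mulrDl.
set e := l / 2 ^ k in yE *.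
have e3 : e <= 3^-1 by rewrite ler_pdivrMr// ler_pdivlMl.
have ym : y < m%:~R + 1 by have := floorD1_gt y; rewrite intrD.
have my : m%:~R + 1 <= y + e.
  move: lt0; rewrite yE -/y -/m -lezD1 floor_ge_int intrD.
  by [].
have [->|->] : (-1 : R) ^ k = 1 \/ (-1 : R) ^ k = -1.
  have : ((-1 : R) ^ k) ^+ 2 == 1 by rewrite expr2 -expfzMl mulrNN mulr1 exp1rz.
  by rewrite sqrf_eq1 => /orP[/eqP ->|/eqP ->]; [left|right].
- apply: (@le_trans _ _ m).
    rewrite -ltzD1 floor_lt_int intrD yE; lra.
  rewrite floor_ge_int; lra.
apply: (@le_trans _ _ (m + 1)).
  rewrite -ltzD1 floor_lt_int !intrD yE; lra.
rewrite floor_ge_int intrD; lra.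
Qed.

Lemma dyadic_scale (l : R) : 0 < l -> exists k : int, l <= 2 ^ k < 2 * l.
Proof.
move=> l0; pose k := Num.ceil (ln l / ln 2); exists k.
have l2 : 0 < ln 2 :> R by rewrite ln_gt0// ltr1n.
have lE : l = 2 `^ (ln l / ln 2).
  by rewrite /powR pnatr_eq0/= divfK ?gt_eqF// lnK.
have kE : 2 ^ k = 2 `^ k%:~R :> R by rewrite powR_intmul.
rewrite kE; apply/andP; split.
  by rewrite [leLHS]lE; apply: ler_powR; rewrite ?ler1n// ceil_ge.
have -> : 2 * l = 2 `^ (1 + ln l / ln 2).
  by rewrite powRD ?pnatr_eq0 ?implybT// powRr1// -lE.
rewrite /powR pnatr_eq0/= ltr_expR ltr_pM2r// addrC -ltrBlDr.
by have := ceilB1_lt (ln l / ln 2); rewrite intrB.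
Qed.

End dyadic_grids.

Section cells.
Context {R : realType} {n : nat}.
Local Notation mu := (lebesgueRn R n).

Lemma measurable_Rn (A : set (n.-tuple (measurableTypeR R))) :
  measurable A -> measurable (A : set (Rn R n)).
Proof. by move=> mA; apply: sub_caratheodory; exact: sub_sigma_algebra. Qed.

Lemma measurable_box (I : 'I_n -> interval R) :
  measurable [set x : Rn R n | forall i, tnth x i \in I i].
Proof.
apply: measurable_Rn.
rewrite (_ : [set _ | _] = \big[setI/setT]_(i < n)
    ((fun x : n.-tuple (measurableTypeR R) => tnth x i) @^-1` [set` I i])).
  apply: bigsetI_measurable => i _; rewrite -[X in measurable X]setTI.
  by apply: measurable_tnth => //; exact: measurable_itv.
rewrite -bigcap_seq; apply/seteqP; split=> x bx i; first by move=> _; exact: bx.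
by apply: bx; rewrite /= mem_index_enum.
Qed.

Lemma measurable_cube (a : Rn R n) (l : R) : measurable (cube a l).
Proof.
rewrite (_ : cube a l = [set x : Rn R n | forall i,
  tnth x i \in `[tnth a i, (tnth a i + l)%R]]); first exact: measurable_box.
by apply/seteqP; split=> x bx i; have := bx i; rewrite in_itv.
Qed.

(** One shift bit per coordinate, the scale, and the integer position. The bit vector is the colour:
    cells that share it are laminar. *)
Definition cell_index : Type := n.-tuple bool * (int * n.-tuple int).

Definition cell (i : cell_index) : set (Rn R n) :=
  [set x | forall j, grid_index (tnth i.1 j) i.2.1 (tnth x j) = tnth i.2.2 j].

Definition cell_side (i : cell_index) : R := 2 ^ i.2.1.

Definition cell_corner (i : cell_index) : Rn R n :=
  [tuple cell_side i * ((tnth i.2.2 j)%:~R + (tnth i.1 j)%:R * (-1) ^ i.2.1 / 3)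
  | j < n].

Lemma cell_side_gt0 i : 0 < cell_side i.
Proof. by rewrite exprz_gt0. Qed.

Lemma cellE i : cell i = [set x : Rn R n | forall j,
  tnth x j \in `[tnth (cell_corner i) j, tnth (cell_corner i) j + cell_side i[].
Proof.
apply/seteqP; split=> x /= H j.
  by rewrite in_itv /= tnth_mktuple; apply/grid_indexP; exact: H.
by apply/grid_indexP; have := H j; rewrite in_itv /= tnth_mktuple.
Qed.

Lemma measurable_cell i : measurable (cell i).
Proof. by rewrite cellE; exact: measurable_box. Qed.

Lemma cell_sub_cube i : cell i `<=` cube (cell_corner i) (cell_side i).
Proof.
rewrite cellE => x /= H j; have := H j; rewrite in_itv /= => /andP[-> /ltW ->//].
Qed.

(** Cells are half open, whereas the measure is known for closed cubes. Halving the side avoids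
    computing the measure of a cell, at the price of a factor $2^n$. *)
Lemma cube_sub_cell i : cube (cell_corner i) (cell_side i / 2) `<=` cell i.
Proof.
rewrite cellE => x /= H j; have := H j; rewrite in_itv /= => /andP[-> /le_lt_trans ->//].
by rewrite ltrD2l; have := cell_side_gt0 i; lra.
Qed.

Lemma cell_laminar (i j : cell_index) : i.1 = j.1 ->
  [\/ cell i `<=` cell j, cell j `<=` cell i | cell i `&` cell j = set0].
Proof.
have sub (i' j' : cell_index) : i'.1 = j'.1 -> i'.2.1 <= j'.2.1 ->
    cell i' `&` cell j' !=set0 -> cell i' `<=` cell j'.
  move=> ij lij [x0 [xi xj]] x xi' m; rewrite -(xj m) -ij.
  by apply: (grid_index_coarser lij); rewrite xi' xi.
move=> ij; have [E|/set0P NE] := eqVneq (cell i `&` cell j) set0.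
  by apply: Or33.
have [lij|/ltW lji] := leP i.2.1 j.2.1; first by apply: Or31; exact: sub.
by apply: Or32; apply: sub => //; rewrite setIC.
Qed.

(** The one-third trick is applied to each coordinate separately, which is why the shift is a bit
    vector. The scale is chosen with $3l\le2^k<6l$. *)
Lemma cube_sub_some_cell (a : Rn R n) (l : R) : 0 < l ->
  exists2 i, cube a l `<=` cell i & cell_side i < 6 * l.
Proof.
move=> l0; have l3 : 0 < 3 * l by rewrite mulr_gt0.
have [k /andP[k1 k2]] := dyadic_scale l3.
have H (j : 'I_n) : exists b, forall t', tnth a j <= t' <= tnth a j + l ->
    grid_index b k t' = grid_index b k (tnth a j) by exact: one_third_trick.
have [b bP] := boolp.choice H.
exists ([tuple b j | j < n], (k, [tuple grid_index (b j) k (tnth a j) | j < n])).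
  by move=> x xa j /=; rewrite !tnth_mktuple; apply: bP; exact: xa.
by rewrite /cell_side/=; lra.
Qed.

Lemma measure_cell_le i : (mu (cell i) <= (cell_side i ^+ n)%:E)%E.
Proof.
rewrite -(lebesgueRn_cube (cell_corner i) (ltW (cell_side_gt0 i))).
apply: le_measure; rewrite ?inE; [exact: measurable_cell|exact: measurable_cube|].
exact: cell_sub_cube.
Qed.

Lemma measure_cell_ge i : (((cell_side i / 2) ^+ n)%:E <= mu (cell i))%E.
Proof.
have h0 : 0 <= cell_side i / 2 by rewrite divr_ge0// ltW// cell_side_gt0.
rewrite -(lebesgueRn_cube (cell_corner i) h0).
apply: le_measure; rewrite ?inE; [exact: measurable_cube|exact: measurable_cell|].
exact: cube_sub_cell.
Qed.

End cells.

(** * Products with A_1 weights *)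

(** The exponents on the right sum to 1: the $A_t$ dual of $a\,b^{s-t}$ is a geometric mean of $b$
    and the $A_s$ dual of $a$, ready for Hoelder's inequality. *)
Lemma powR_factor_dual {R : realType} (a b s t : R) : 0 < a -> 1 < s -> s < t ->
  (a * b `^ (s - t)) `^ (- (t - 1)^-1) =
  b `^ ((t - s) / (t - 1)) * (a `^ (- (s - 1)^-1)) `^ ((s - 1) / (t - 1)).
Proof.
move=> a0 s1 st; have t1 := lt_trans s1 st.
have t0 : t - 1 != 0 by rewrite subr_eq0 gt_eqF.
have s0 : s - 1 != 0 by rewrite subr_eq0 gt_eqF.
have e1 : (s - t) * - (t - 1)^-1 = (t - s) / (t - 1) by field.
have e2 : - (s - 1)^-1 * ((s - 1) / (t - 1)) = - (t - 1)^-1 by field; rewrite t0.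
rewrite (powRM _ (ltW a0) (powR_ge0 _ _)).
rewrite -(powRrM b (s - t)) -(powRrM a (- (s - 1)^-1)) e1 e2.
exact: mulrC.
Qed.

(** Hoelder's inequality before integration: if [X] and [Y] are the means of [x] and [y], the last
    factor has mean $t+(1-t)=1$. *)
Lemma weighted_AMGM_scaled {R : realType} (t x y X Y : R) :
  0 < t < 1 -> 0 <= x -> 0 <= y -> 0 < X -> 0 < Y ->
  x `^ t * y `^ (1 - t) <=
  (X `^ t * Y `^ (1 - t)) * (t / X * x + (1 - t) / Y * y).
Proof.
move=> t01 x0 y0 X0 Y0.
have xX : 0 <= x / X by rewrite divr_ge0// ltW.
have yY : 0 <= y / Y by rewrite divr_ge0// ltW.
have {1}-> : x = X * (x / X) by rewrite mulrC divfK// gt_eqF.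
have {1}-> : y = Y * (y / Y) by rewrite mulrC divfK// gt_eqF.
rewrite (powRM _ (ltW X0) xX) (powRM _ (ltW Y0) yY) mulrACA.
apply: ler_wpM2l; first by rewrite mulr_ge0 ?powR_ge0.
have -> : t / X * x + (1 - t) / Y * y = t * (x / X) + (1 - t) * (y / Y).
  by rewrite -!mulrA (mulrC X^-1) (mulrC Y^-1).
exact: weighted_AMGM.
Qed.

Section means.
Local Open Scope ereal_scope.
Context d (T : measurableType d) (R : realType).
Variables (mu : {measure set T -> \bar R}) (Q : set T).
Hypotheses (mQ : measurable Q) (Q0 : 0 < mu Q) (Qoo : mu Q < +oo).

Lemma mean_factor : exists2 m : R, (0 < m)%R & (mu Q)^-1 = m%:E /\ mu Q = (m^-1)%:E.
Proof.
have QE : mu Q = (fine (mu Q))%:E by rewrite fineK// ge0_fin_numE.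
have m0 : (0 < fine (mu Q))%R by rewrite fine_gt0// Q0.
exists (fine (mu Q))^-1%R; first by rewrite invr_gt0.
by rewrite {1}QE inver gt_eqF// invrK.
Qed.

Lemma mean_gt0 (u : T -> R) : measurable_fun setT u -> (forall x, (0 < u x)%R) ->
  0 < mean mu Q (fun x => (u x)%:E).
Proof.
move=> mu_ u0; rewrite /mean; have [m m0 [-> _]] := mean_factor.
by apply: mule_gt0; [rewrite lte_fin|exact: integral_gt0].
Qed.

Lemma le_mean (f g : T -> \bar R) :
  measurable_fun setT f -> measurable_fun setT g ->
  (forall x, 0 <= f x) -> (forall x, 0 <= g x) ->
  {ae mu, forall x, Q x -> f x <= g x} -> mean mu Q f <= mean mu Q g.
Proof.
move=> mf mg f0 g0 fg; apply: lee_wpmul2l; first by rewrite inve_ge0.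
by apply: ae_ge0_le_integral => //; exact: measurable_funTS.
Qed.

Lemma meanZ (k : R) (f : T -> \bar R) : measurable_fun setT f ->
  (forall x, 0 <= f x) -> (0 <= k)%R ->
  mean mu Q (fun x => k%:E * f x) = k%:E * mean mu Q f.
Proof.
move=> mf f0 k0; rewrite /mean ge0_integralZl//; last exact: measurable_funTS.
by rewrite muleCA.
Qed.

Lemma meanD (f g : T -> \bar R) :
  measurable_fun setT f -> measurable_fun setT g ->
  (forall x, 0 <= f x) -> (forall x, 0 <= g x) ->
  mean mu Q (fun x => f x + g x) = mean mu Q f + mean mu Q g.
Proof.
move=> mf mg f0 g0; rewrite /mean ge0_integralD//; last 2 first.
- exact: measurable_funTS.
- exact: measurable_funTS.
by rewrite ge0_muleDr ?integral_ge0.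
Qed.

Lemma exists_in_set (P : T -> Prop) :
  {ae mu, forall x, Q x -> P x} -> exists2 x, Q x & P x.
Proof.
move=> [N [mN N0 sub]]; apply: contrapT => H.
have QN : mu Q = 0.
  apply: (subset_measure0 mQ mN _ N0) => x Qx; apply: sub => /= /(_ Qx) Px.
  by apply: H; exists x.
by have := Q0; rewrite QN ltxx.
Qed.

(** With $H$ the mean of [h], the bound $h\ge H/K$ on [Q] controls the negative power $h^{s-t}$ in
    the first mean by $(K/H)^{t-s}$, and Hoelder's inequality bounds the dual mean by $H^\theta
    S^{1-\theta}$ with $\theta=(t-s)/(t-1)$. In its power $t-1$ the factor $H^{t-s}$ appears and
    cancels. *)
Lemma mean_mul_A1 (u h : T -> R) (s t K U S : R) :
  measurable_fun setT u -> (forall x, (0 < u x)%R) ->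
  measurable_fun setT h -> (forall x, (0 < h x)%R) ->
  (1 < s)%R -> (s < t)%R -> (0 < K)%R -> (0 < U)%R -> (0 < S)%R ->
  mean mu Q (fun x => (u x)%:E) = U%:E ->
  mean mu Q (fun x => (dual_weight u s x)%:E) = S%:E ->
  {ae mu, forall x, Q x -> mean mu Q (fun x => (h x)%:E) <= (K * h x)%:E} ->
  mean mu Q (fun x => (u x * h x `^ (s - t))%:E) *
  mean mu Q (fun x => (dual_weight (fun x => u x * h x `^ (s - t))%R t x)%:E) `^ (t - 1)
  <= (K `^ (t - s) * (U * S `^ (s - 1)))%:E.
Proof.
move=> mu_ u0 mh h0 s1 st K0 U0 S0 UE SE hA1.
have t1 : (1 < t)%R by exact: lt_trans st.
have Kp0 : (0 < K `^ (t - s))%R by rewrite powR_gt0.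
(* The mean of [h] is finite because the $A_1$ bound holds at some point of [Q], which has positive
   measure. *)
have [H H0 HE] : exists2 H : R, (0 < H)%R & mean mu Q (fun x => (h x)%:E) = H%:E.
  have [x0 _ Hx0] := exists_in_set hA1.
  have Hm0 := mean_gt0 mh h0.
  exists (fine (mean mu Q (fun x => (h x)%:E))).
    by rewrite fine_gt0// Hm0; exact: le_lt_trans Hx0 (ltry _).
  by rewrite fineK// gt0_fin_numE//; exact: le_lt_trans Hx0 (ltry _).
have [th thE] : exists th, th = ((t - s) / (t - 1))%R by eexists.
have q0 : (0 < t - 1)%R by rewrite subr_gt0.
have r0 : (0 < s - 1)%R by rewrite subr_gt0.
have st0 : (0 < t - s)%R by rewrite subr_gt0.
have th0 : (0 < th)%R by rewrite thE divr_gt0.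
have th1 : (1 - th = (s - 1) / (t - 1))%R by rewrite thE; field; rewrite gt_eqF.
have th2 : (th < 1)%R by rewrite -subr_gt0 th1 divr_gt0.
have mEu : measurable_fun setT (fun x => (u x)%:E) by exact/measurable_EFinP.
have mEh : measurable_fun setT (fun x => (h x)%:E) by exact/measurable_EFinP.
have mES : measurable_fun setT (fun x => (dual_weight u s x)%:E).
  by apply/measurable_EFinP; exact: measurable_dual_weight.
have mv' : measurable_fun setT (fun x => u x * h x `^ (s - t))%R.
  exact: (measurable_funM mu_ (measurable_powR_comp (s - t) mh)).
have mv : measurable_fun setT (fun x => (u x * h x `^ (s - t))%:E).
  exact/measurable_EFinP.
have u0' x : 0 <= (u x)%:E by rewrite lee_fin ltW.
have h0' x : 0 <= (h x)%:E by rewrite lee_fin ltW.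
have S0' x : 0 <= (dual_weight u s x)%:E by rewrite lee_fin ltW// dual_weight_gt0.
have v0 x : (0 < u x * h x `^ (s - t))%R by rewrite mulr_gt0 ?powR_gt0.
have v0' x : 0 <= (u x * h x `^ (s - t))%:E by rewrite lee_fin ltW.
have av1 : mean mu Q (fun x => (u x * h x `^ (s - t))%:E) <=
    ((K / H) `^ (t - s) * U)%:E.
  have <- : mean mu Q (fun x => ((K / H) `^ (t - s))%:E * (u x)%:E) =
      ((K / H) `^ (t - s) * U)%:E.
    by rewrite (meanZ mEu u0' (powR_ge0 _ _)) UE.
  apply: (le_mean mv (measurable_funeM _ mEu) v0').
    by move=> x; rewrite mule_ge0 ?lee_fin ?powR_ge0// ltW.
  apply: filterS hA1 => x + Qx => /(_ Qx); rewrite HE lee_fin => Hx.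
  rewrite -EFinM lee_fin mulrC ler_wpM2r ?(ltW (u0 x))//.
  rewrite -opprB powRN -powR_inv1 ?powR_ge0// -powRrM mulrC powRrM.
  rewrite powR_inv1 ?(ltW (h0 x))//; apply: ge0_ler_powR; rewrite ?nnegrE ?(ltW st0)//.
  - by rewrite invr_ge0 ltW.
  - by rewrite divr_ge0 ?ltW.
  by rewrite ler_pdivlMr// mulrC ler_pdivrMr.
have av2 : mean mu Q (fun x =>
      (dual_weight (fun x => u x * h x `^ (s - t))%R t x)%:E) <=
    (H `^ th * S `^ (1 - th))%:E.
  have -> : (fun x => (dual_weight (fun x => u x * h x `^ (s - t))%R t x)%:E) =
      (fun x => (h x `^ th * dual_weight u s x `^ (1 - th))%:E).
    apply/funext => x; rewrite th1 thE; congr EFin.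
    exact: powR_factor_dual.
  have [k kE] : exists k, k = (H `^ th * S `^ (1 - th))%R by eexists.
  have k0 : (0 < k)%R by rewrite kE mulr_gt0// powR_gt0.
  have c1 : (0 <= th / H)%R by rewrite divr_ge0// ltW.
  have c2 : (0 <= (1 - th) / S)%R by rewrite divr_ge0 ?subr_ge0// ltW.
  have ch0 x : 0 <= (th / H)%:E * (h x)%:E by rewrite mule_ge0// lee_fin.
  have cS0 x : 0 <= ((1 - th) / S)%:E * (dual_weight u s x)%:E.
    by rewrite mule_ge0// lee_fin.
  have mc := emeasurable_funD (measurable_funeM (th / H)%:E mEh)
    (measurable_funeM ((1 - th) / S)%:E mES).
  have <- : mean mu Q (fun x => k%:E *
      ((th / H)%:E * (h x)%:E + ((1 - th) / S)%:E * (dual_weight u s x)%:E)) =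
      (H `^ th * S `^ (1 - th))%:E.
    rewrite (meanZ mc _ (ltW k0)); last by move=> x; rewrite adde_ge0.
    rewrite (meanD (measurable_funeM _ mEh) (measurable_funeM _ mES))//.
    rewrite (meanZ mEh h0' c1) (meanZ mES S0' c2) HE SE.
    rewrite -(EFinM (th / H)) -(EFinM ((1 - th) / S)) -EFinD -EFinM.
    by rewrite !divfK ?(gt_eqF H0) ?(gt_eqF S0)// subrKC mulr1 kE.
  apply: le_mean.
  - apply/measurable_EFinP.
    exact: (measurable_funM (measurable_powR_comp th mh)
      (measurable_powR_comp (1 - th) (measurable_dual_weight s mu_))).
  - exact: (measurable_funeM _ mc).
  - by move=> x; rewrite lee_fin mulr_ge0 ?powR_ge0.
  - by move=> x; rewrite mule_ge0 ?adde_ge0// lee_fin ltW.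
  apply: aeW => x _.
  rewrite -(EFinM (th / H)) -(EFinM ((1 - th) / S)) -EFinD -EFinM lee_fin.
  have d0 := dual_weight_gt0 s u0 x.
  by rewrite kE; apply: weighted_AMGM_scaled; rewrite ?th0// ltW.
apply: (@le_trans _ _ (((K / H) `^ (t - s) * U)%:E *
    (H `^ th * S `^ (1 - th))%:E `^ (t - 1))).
  have vm0 := mean_gt0 mv' v0.
  have dm0 := mean_gt0 (measurable_dual_weight t mv') (dual_weight_gt0 t v0).
  apply: lee_pmul => //; [exact: ltW|exact: poweR_ge0|].
  by apply: lee_poweR => //; exact: ltW.
rewrite poweR_EFin -EFinM lee_fin (powRM _ (powR_ge0 H th) (powR_ge0 S _)) -!powRrM.
have -> : (th * (t - 1) = t - s)%R by rewrite thE divfK// gt_eqF.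
have -> : ((1 - th) * (t - 1) = s - 1)%R by rewrite th1 divfK// gt_eqF.
have KH0 : (0 <= K / H)%R by rewrite divr_ge0// ltW.
by rewrite mulrACA -(powRM _ KH0 (ltW H0)) divfK ?(gt_eqF H0).
Qed.

End means.

(** * Averages over cubes and the $A_s$ characteristic *)

Section cube_averages.
Local Open Scope ereal_scope.
Context {R : realType} {n : nat}.
Local Notation mu := (lebesgueRn R n).
Implicit Types (a : Rn R n) (l s : R).

Lemma conjRE s : (1 < s)%R -> conjR s = (s / (s - 1))%R.
Proof.
move=> s1; rewrite /conjR /hoelder_conjugate/= gt_eqF ?lte_fin ?(lt_trans ltr01 s1)//.
by rewrite inver subr_eq0 gt_eqF.
Qed.

Lemma one_sub_conjR s : (1 < s)%R -> (1 - conjR s = - (s - 1)^-1)%R.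
Proof. by move=> s1; rewrite conjRE//; field; rewrite subr_eq0 gt_eqF. Qed.

Lemma measure_cube_gt0 a l : (0 < l)%R -> 0 < mu (cube a l).
Proof. by move=> l0; rewrite lebesgueRn_cube ?(ltW l0)// lte_fin exprn_gt0. Qed.

Lemma measure_cube_lty a l : (0 < l)%R -> mu (cube a l) < +oo.
Proof. by move=> l0; rewrite lebesgueRn_cube ?(ltW l0)// ltry. Qed.

Lemma Achar_ubP s (u : Rn R n -> R) (A : \bar R) : (1 < s)%R ->
  (forall a l, (0 < l)%R ->
    mean mu (cube a l) (fun x => (u x)%:E) *
    mean mu (cube a l) (fun x => (dual_weight u s x)%:E) `^ (s - 1) <= A) <->
  Achar s (fun x => (u x)%:E) <= A.
Proof.
move=> s1.
have E : (fun x => (dual_weight u s x)%:E) = (fun x => (u x)%:E `^ (1 - conjR s)).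
  by apply/funext => x; rewrite (one_sub_conjR s1).
rewrite E; split=> H.
  by apply: ge_ereal_sup => _ [_ [a [l [l0 ->]]] <-]; exact: H.
move=> a l l0; apply: le_trans H; apply: ereal_sup_ubound.
by exists (cube a l) => //; exists a, l.
Qed.

Variables (u : Rn R n -> R) (s : R).
Hypotheses (mu_ : measurable_fun setT u) (u0 : forall x, (0 < u x)%R).
Hypothesis s1 : (1 < s)%R.

Lemma mean_cube_gt0 (v : Rn R n -> R) a l : (0 < l)%R -> measurable_fun setT v ->
  (forall x, (0 < v x)%R) -> 0 < mean mu (cube a l) (fun x => (v x)%:E).
Proof.
move=> l0; apply: mean_gt0.
- exact: measurable_cube.
- exact: measure_cube_gt0.
- exact: measure_cube_lty.
Qed.

(** Both means are positive, so if one of them were infinite, their product in the characteristic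
    would be infinite too. *)
Lemma Achar_means a l (A : R) : (0 < l)%R -> Achar s (fun x => (u x)%:E) <= A%:E ->
  exists U S : R, [/\ (0 < U)%R, (0 < S)%R,
    mean mu (cube a l) (fun x => (u x)%:E) = U%:E,
    mean mu (cube a l) (fun x => (dual_weight u s x)%:E) = S%:E &
    (U * S `^ (s - 1) <= A)%R].
Proof.
move=> l0 /(Achar_ubP _ _ s1) /(_ a l l0).
have U0 : 0 < mean mu (cube a l) (fun x => (u x)%:E).
  exact: (mean_cube_gt0 a l0 mu_ u0).
have S0 : 0 < mean mu (cube a l) (fun x => (dual_weight u s x)%:E).
  exact: (mean_cube_gt0 a l0 (measurable_dual_weight s mu_) (dual_weight_gt0 s u0)).
have q0 : (s - 1 != 0)%R by rewrite subr_eq0 gt_eqF.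
move: (mean _ _ _) U0 => [U||//] U0; move: (mean _ _ _) S0 => [S||//] S0.
- by rewrite poweR_EFin -EFinM lee_fin => H; exists U, S.
- by rewrite poweRyr// gt0_muley// leye_eq.
- by rewrite gt0_mulye ?poweR_gt0// leye_eq.
- by rewrite poweRyr// gt0_muley// leye_eq.
Qed.

Lemma Achar_gt0 : 0 < Achar s (fun x => (u x)%:E).
Proof.
have l1 : (0 < 1 :> R)%R by [].
have := (Achar_ubP u (Achar s (fun x => (u x)%:E)) s1).2 (lexx _) [tuple 0%R | _ < n] 1%R l1.
apply: lt_le_trans; apply: mule_gt0; first exact: (mean_cube_gt0 _ l1 mu_ u0).
apply: poweR_gt0.
exact: (mean_cube_gt0 _ l1 (measurable_dual_weight s mu_) (dual_weight_gt0 s u0)).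
Qed.

Lemma Achar_mul_A1 (h : Rn R n -> R) (t K A : R) :
  measurable_fun setT h -> (forall x, (0 < h x)%R) -> (s < t)%R -> (0 < K)%R ->
  (forall a l, (0 < l)%R -> {ae mu, forall x, cube a l x ->
    mean mu (cube a l) (fun x => (h x)%:E) <= (K * h x)%:E}) ->
  Achar s (fun x => (u x)%:E) <= A%:E ->
  Achar t (fun x => (u x * h x `^ (s - t))%:E) <= (K `^ (t - s) * A)%:E.
Proof.
move=> mh h0 st K0 hA1 HA.
apply/Achar_ubP => [|a l l0]; first exact: lt_trans st.
have [U [S [U0 S0 UE SE US]]] := Achar_means a l0 HA.
apply: (le_trans (mean_mul_A1 (measurable_cube a l) (measure_cube_gt0 a l0)
  (measure_cube_lty a l0) mu_ u0 mh h0 s1 st K0 U0 S0 UE SE (hA1 a l l0))).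
by rewrite lee_fin ler_wpM2l// powR_ge0.
Qed.

End cube_averages.

Section extrapolation_weight.
Local Open Scope ereal_scope.
Context {R : realType} {n : nat}.
Local Notation mu := (lebesgueRn R n).

Let I : countType := (n.-tuple bool * (int * n.-tuple int))%type.
Let Q : I -> set (Rn R n) := @cell R n.
Let side : I -> R := @cell_side R n.

(** Both integrals grow when the cell is enlarged to its closed cube, whose measure is at most $2^n$
    times that of the cell; the $s$-th power of this ratio is the loss. *)
Lemma cell_Aweight (u : Rn R n -> R) (s A : R) (i : I) :
  measurable_fun setT u -> (forall x, (0 < u x)%R) -> (1 < s)%R -> (0 < A)%R ->
  Achar s (fun x => (u x)%:E) <= A%:E ->
  Aweight_on mu Q u s (A * (2 ^+ n) `^ s) i.
Proof.
move=> mu_ u0 s1 A0 HA; have L0 : (0 < side i)%R := cell_side_gt0 i.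
have s0 : (0 < s)%R by exact: lt_trans s1.
have q0 : (0 < s - 1)%R by rewrite subr_gt0.
have half0 : (0 < (side i / 2) ^+ n)%R by rewrite exprn_gt0// divr_gt0.
have [U [S [U0 S0 UE SE US]]] := Achar_means mu_ u0 s1 (cell_corner i) L0 HA.
have m0 : (0 < side i ^+ n)%R by rewrite exprn_gt0.
split.
- by apply: lt_le_trans (measure_cell_ge i); rewrite lte_fin.
- by apply: le_lt_trans (measure_cell_le i) _; rewrite ltry.
have intE (g : Rn R n -> R) (V : R) : measurable_fun setT g -> (forall x, (0 < g x)%R) ->
    mean mu (cube (cell_corner i) (cell_side i)) (fun x => (g x)%:E) = V%:E ->
    \int[mu]_(x in Q i) (g x)%:E <= (side i ^+ n * V)%:E.
  move=> mg g0; rewrite /mean lebesgueRn_cube ?(ltW L0)// inver gt_eqF// => VE.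
  rewrite EFinM -VE muleA -EFinM divff ?gt_eqF// mul1e.
  apply: ge0_subset_integral.
  - exact: measurable_cell.
  - exact: measurable_cube.
  - by apply/measurable_EFinP; exact: measurable_funTS.
  - by move=> x _; rewrite lee_fin ltW.
  exact: cell_sub_cube.
have U1 := intE _ _ mu_ u0 UE.
have S1 := intE _ _ (measurable_dual_weight s mu_) (fun x => dual_weight_gt0 s u0 x) SE.
have I0 (g : Rn R n -> R) : (forall x, (0 < g x)%R) -> 0 <= \int[mu]_(x in Q i) (g x)%:E.
  by move=> g0; apply: integral_ge0 => x _; rewrite lee_fin ltW.
apply: (@le_trans _ _ ((side i ^+ n * U)%:E * (side i ^+ n * S)%:E `^ (s - 1))).
  apply: lee_pmul => //; rewrite ?poweR_ge0 ?I0//.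
  apply: lee_poweR => //; rewrite ?(ltW q0) ?I0// => x; exact: dual_weight_gt0.
apply: (@le_trans _ _ ((A * (2 ^+ n) `^ s)%:E * ((side i / 2) ^+ n)%:E `^ s)); last first.
  apply: lee_wpmul2l; first by rewrite lee_fin mulr_ge0 ?powR_ge0// ltW.
  apply: lee_poweR; [exact: ltW|by rewrite lee_fin ltW|exact: measure_cell_ge].
rewrite !poweR_EFin -!EFinM lee_fin.
have ME : ((2 ^+ n) `^ s * ((side i / 2) ^+ n) `^ s = (side i ^+ n) `^ s)%R.
  have two_n : (0 <= 2 ^+ n :> R)%R by rewrite exprn_ge0.
  by rewrite -(powRM s two_n (ltW half0)) -exprMn (mulrC 2%R) divfK.
rewrite -(mulrA A) ME (powRM _ (ltW m0) (ltW S0)) -(mulr_powRB1 (ltW m0) s0).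
move: (side i ^+ n)%R m0 {U1 S1 intE ME half0} => M m0.
rewrite (_ : M * U * _ = (U * S `^ (s - 1)) * (M * M `^ (s - 1)))%R; last by ring.
by rewrite ler_wpM2r// mulr_ge0 ?powR_ge0// ltW.
Qed.

End extrapolation_weight.

(** * A_1 majorants *)

Section majorant.
Local Open Scope ereal_scope.
Context {R : realType} {n : nat}.
Local Notation mu := (lebesgueRn R n).

Let I : countType := (n.-tuple bool * (int * n.-tuple int))%type.
Let Q : I -> set (Rn R n) := @cell R n.

(** Countably many cells cover the space, so a nonnegative function with zero integral over each of
    them is null. *)
Lemma cell_integral_gt0 (f : Rn R n -> \bar R) :
  measurable_fun setT f -> (forall x, 0 <= f x) ->
  ~ {ae mu, forall x, f x = 0} -> exists i, 0 < \int[mu]_(x in Q i) f x.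
Proof.
move=> mf f0 nz; apply: contrapT => /forallNP Hn; apply: nz.
have ae0 i : mu.-negligible (Q i `&` [set x | f x != 0]).
  have mfQ : measurable_fun (Q i) f by exact: measurable_funTS.
  have z : \int[mu]_(x in Q i) `|f x| = 0.
    apply/eqP; rewrite eq_le integral_ge0// andbT.
    under eq_integral do rewrite gee0_abs//.
    by rewrite leNgt; apply/negP/Hn.
  have /(ae_eq_integral_abs mu (measurable_cell i) mfQ) := z.
  by apply: negligibleS => x [/= Qx /eqP fx] /(_ Qx).
pose F k := if @unpickle I k is Some i then Q i `&` [set x | f x != 0] else set0.
apply: (negligibleS _ (negligible_bigcup (F := F) _)) => [x /= /eqP fx|k].
  (* The unshifted cells of side 1 already cover the space. *)
  pose i : I := ([tuple false | _ < n], (0%R : int, [tuple grid_index false 0 (tnth x j) | j < n])).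
  exists (pickle i) => //; rewrite /F pickleK; split=> //= j.
  by rewrite !tnth_mktuple.
rewrite /F; case: unpickle => [i|]; [exact: ae0|exact: negligible_set0].
Qed.

(** A cube containing both the cell and the point lies in some cell. Through the $A_1$ bound on that
    cell, positivity travels from one cell to every point. *)
Lemma cell_through (i : I) (x : Rn R n) : exists2 j, Q i `<=` Q j & Q j x.
Proof.
pose c : Rn R n := cell_corner i; pose L := cell_side i : R.
have L0 : (0 < L)%R := cell_side_gt0 i.
(* The sum bounds every coordinate difference, so the cube of side [L + e] at the corner [a] below
   contains [x] and the whole cell. *)
pose e := (\sum_(j < n) `|tnth x j - tnth c j|)%R.
have e_ge j : (`|tnth x j - tnth c j| <= e)%R.
  by rewrite /e (bigD1 j)//= lerDl sumr_ge0.
have e0 : (0 <= e)%R by apply: sumr_ge0.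
pose a : Rn R n := [tuple Num.min (tnth c j) (tnth x j) | j < n].
have Le0 : (0 < L + e)%R by rewrite ltr_wpDr.
have [j aj _] := cube_sub_some_cell a Le0.
have aE k : tnth a k = Num.min (tnth c k) (tnth x k) by rewrite tnth_mktuple.
have ak k : (tnth c k <= tnth a k + e)%R /\ (tnth x k <= tnth a k + e)%R.
  have := e_ge k; rewrite aE ler_norml => /andP[].
  by case: (leP (tnth c k) (tnth x k)) => ? ? ?; split; lra.
exists j; last first.
  apply: aj => k; rewrite aE ge_min lexx orbT /= -aE.
  by have [_] := ak k; lra.
move=> y /cell_sub_cube yc; apply: aj => k; have /andP[y1 y2] := yc k.
have [c1 _] := ak k; apply/andP; split.
  by rewrite aE (le_trans _ y1)// ge_min lexx.
by apply: (le_trans y2); rewrite -/L -/c; lra.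
Qed.

(** The constant [2 * rdf_cst] with the power of the characteristic split off; $6^n$ is the loss in
    passing from a cube to the cell around it. *)
Definition rdf_A1_cst (s : R) : R :=
  6 ^+ n * (2 * ((#|{: n.-tuple bool}|%:R * buckley_cst s) `^ s^-1 *
    ((2 ^+ n) `^ s) `^ (s - 1)^-1)).

Lemma rdf_A1_cst_gt0 s : (1 < s)%R -> (0 < rdf_A1_cst s)%R.
Proof.
move=> s1; have c0 : (0 < #|{: n.-tuple bool}|%:R * buckley_cst s)%R.
  by rewrite mulr_gt0 ?(buckley_cst_gt0 s1)// ltr0n card_tuple card_bool expn_gt0.
rewrite /rdf_A1_cst; apply: mulr_gt0; first exact: exprn_gt0.
by rewrite mulr_gt0// mulr_gt0// ?powR_gt0 ?exprn_gt0.
Qed.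

Lemma rdf_cstE (s A : R) : (1 < s)%R -> (0 < A)%R ->
  (6 ^+ n * (2 * rdf_cst (n.-tuple bool) s (A * (2 ^+ n) `^ s)) =
   rdf_A1_cst s * A `^ (s - 1)^-1)%R.
Proof.
move=> s1 A0; rewrite /rdf_cst /rdf_A1_cst.
have b0 := buckley_cst_gt0 s1.
have two_n : (0 <= (2 ^+ n) `^ s :> R)%R by exact: powR_ge0.
have N0 : (0 <= #|{: n.-tuple bool}|%:R * buckley_cst s)%R by rewrite mulr_ge0// ltW.
rewrite (mulrA #|{: n.-tuple bool}|%:R) (powRM _ N0 (powR_ge0 _ _)) -powRrM.
have -> : (s / (s - 1) * s^-1 = (s - 1)^-1)%R.
  by field; rewrite subr_eq0 !gt_eqF// (lt_trans ltr01 s1).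
by rewrite (powRM _ (ltW A0) two_n) (mulrC (A `^ _)%R) !mulrA.
Qed.

(** The function given by [rubio_de_francia] has extended values and is controlled on cells; here it
    becomes a positive real function controlled on all cubes. *)
Lemma rdf_majorant (u : Rn R n -> R) (s A : R) (h0 : Rn R n -> \bar R) :
  measurable_fun setT u -> (forall x, (0 < u x)%R) -> (1 < s)%R -> (0 < A)%R ->
  Achar s (fun x => (u x)%:E) <= A%:E ->
  measurable_fun setT h0 -> (forall x, 0 <= h0 x) ->
  ~ {ae mu, forall x, h0 x = 0} -> \int[mu]_x (h0 x `^ s * (u x)%:E) < +oo ->
  exists h : Rn R n -> R,
    [/\ measurable_fun setT h, forall x, (0 < h x)%R,
        {ae mu, forall x, h0 x <= (h x)%:E},
        \int[mu]_x (h x `^ s * u x)%:E <=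
          (2 `^ s)%:E * \int[mu]_x (h0 x `^ s * (u x)%:E) &
        forall a l, (0 < l)%R -> {ae mu, forall x, cube a l x ->
          mean mu (cube a l) (fun x => (h x)%:E) <=
          (rdf_A1_cst s * A `^ (s - 1)^-1 * h x)%:E}].
Proof.
move=> mu_ u0 s1 A0 HA mh0 h0_ge0 N0 Noo.
have s0 : (0 < s)%R by exact: lt_trans s1.
have q0 : (0 < s - 1)%R by rewrite subr_gt0.
have [K KE] : exists K, K = (A * (2 ^+ n) `^ s)%R by eexists.
have K0 : (0 < K)%R by rewrite KE mulr_gt0// powR_gt0// exprn_gt0.
have card0 : (0 < #|{: n.-tuple bool}|)%N by rewrite card_tuple card_bool expn_gt0.
have lam (i j : I) : i.1 = j.1 ->
    [\/ Q i `<=` Q j, Q j `<=` Q i | Q i `&` Q j = set0] by exact: cell_laminar.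
have AQ (i : I) : Aweight_on mu Q u s K i.
  by rewrite KE; exact: (cell_Aweight i mu_ u0 s1 A0 HA).
have [H [mH h0H NH meanH A1H]] := @rubio_de_francia _ _ _ mu I (n.-tuple bool : finType)
  fst Q (@measurable_cell R n) lam u s K mu_ u0 s1 K0 AQ card0 h0 mh0 h0_ge0.
have c0 := @rdf_cst_gt0 _ (n.-tuple bool : finType) _ _ s1 K0 card0.
have cE := rdf_cstE s1 A0; rewrite -KE in cE.
move: (rdf_cst _ s K) => c in A1H c0 cE.
have H0 x : 0 <= H x := le_trans (h0_ge0 x) (h0H x).
have Hs0 x : 0 <= H x `^ s * (u x)%:E by rewrite mule_ge0 ?poweR_ge0// lee_fin ltW.
have muE : measurable_fun setT (fun x => (u x)%:E) by exact/measurable_EFinP.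
have mHs : measurable_fun setT (fun x => H x `^ s * (u x)%:E).
  exact: (emeasurable_funM (measurable_poweR_comp s mH) muE).
have Hfin : {ae mu, forall x, H x < +oo}.
  have : mu.-integrable setT (fun x => H x `^ s * (u x)%:E).
    apply/integrableP; split => //.
    under eq_integral do rewrite gee0_abs//.
    by apply: (le_lt_trans NH); rewrite lte_mul_pinfty ?lee_fin ?powR_ge0.
  move=> /(integrable_ae measurableT); apply: filterS => x /(_ Logic.I).
  rewrite ge0_fin_numE// => HH; rewrite ltey; apply/eqP => Hx; move: HH.
  by rewrite Hx poweRyr ?gt_eqF// gt0_mulye ?lte_fin// ltxx.
(* Some cell carries positive [h0]-mass, a cell [Q j] contains it together with [x], and the $A_1$
   bound on [Q j] bounds [H x] from below. *)
have Hpos x : 0 < H x.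
  have [i i0] := cell_integral_gt0 mh0 h0_ge0 N0.
  have [j ij jx] := cell_through i x.
  have mj : 0 < mean mu (Q j) h0.
    have [Qj0 Qjoo _] := AQ j.
    have [m m0 [mE _]] := mean_factor Qj0 Qjoo.
    rewrite /mean mE; apply: mule_gt0; first by rewrite lte_fin.
    apply: (lt_le_trans i0); apply: ge0_subset_integral => //.
    - exact: measurable_cell.
    - exact: measurable_cell.
    - exact: measurable_funTS.
  have := lt_le_trans mj (le_trans (meanH j) (A1H j x jx)).
  by rewrite pmule_rgt0// lte_fin mulr_gt0.
pose h x := pos_fine (H x).
have hE x : H x < +oo -> (h x)%:E = H x.
  by move=> Hx; rewrite /h pos_fineK// Hpos.
have h_gt0 x : (0 < h x)%R by exact: pos_fine_gt0.
have mh : measurable_fun setT h := measurable_pos_fine mH.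
have mhE : measurable_fun setT (fun x => (h x)%:E) by exact/measurable_EFinP.
have aehH : {ae mu, forall x, (h x)%:E = H x} by apply: filterS Hfin => x; exact: hE.
have mhs : measurable_fun setT (fun x => (h x `^ s * u x)%:E).
  apply/measurable_EFinP; exact: (measurable_funM (measurable_powR_comp s mh) mu_).
have hs0 x : 0 <= (h x `^ s * u x)%:E by rewrite lee_fin mulr_ge0 ?powR_ge0// ltW.
have Nh : \int[mu]_x (h x `^ s * u x)%:E <= \int[mu]_x (H x `^ s * (u x)%:E).
  apply: (ae_ge0_le_integral measurableT (fun x _ => hs0 x) mhs (fun x _ => Hs0 x) mHs).
  by apply: filterS aehH => x hx _; rewrite EFinM -poweR_EFin hx.
have h0h : {ae mu, forall x, h0 x <= (h x)%:E}.
  by apply: filterS aehH => x ->; exact: h0H.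
exists h; apply: (And5 mh h_gt0 h0h (le_trans Nh NH)).
move=> a l l0; have [i ai il] := cube_sub_some_cell a l0.
have mhmH : mean mu (cube a l) (fun x => (h x)%:E) = mean mu (cube a l) H.
  rewrite /mean (ge0_ae_eq_integral (measurable_cube a l) (measurable_funTS mhE)
    (measurable_funTS mH) _ (fun x _ => H0 x))//.
    by move=> x _; rewrite lee_fin ltW.
  by apply: filterS aehH => x hx _.
rewrite mhmH; apply: filterS aehH => x hx ax.
rewrite EFinM hx -cE.
have ln0 : (0 < l ^+ n)%R by rewrite exprn_gt0.
have Hi := A1H i x (ai x ax).
have Lk : (0 <= (cell_side (i : cell_index) : R))%R by rewrite ltW// cell_side_gt0.
rewrite /mean lebesgueRn_cube ?(ltW l0)// inver gt_eqF//.
apply: (@le_trans _ _ (((l ^+ n)^-1)%:E * \int[mu]_(x in Q i) H x)).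
  apply: lee_wpmul2l; first by rewrite lee_fin invr_ge0 ltW.
  apply: ge0_subset_integral => //.
  - exact: measurable_cube.
  - exact: measurable_cell.
  - exact: measurable_funTS.
have [Qi0 Qioo _] := AQ i.
have [m m0 [mE mE']] := mean_factor Qi0 Qioo.
have -> : \int[mu]_(x in Q i) H x = (m^-1)%:E * mean mu (Q i) H.
  by rewrite /mean mE muleA -EFinM mulVf ?mul1e// gt_eqF.
have mle : (m^-1 <= cell_side (i : cell_index) ^+ n)%R.
  by rewrite -lee_fin -mE'; exact: measure_cell_le.
(* The measure of the cell is at most $(6l)^n$. *)
have cst_le : ((l ^+ n)^-1 * m^-1 <= 6 ^+ n)%R.
  rewrite mulrC ler_pdivrMr// -exprMn; apply: (le_trans mle).
  by apply: lerXn2r; rewrite ?nnegrE ?mulr_ge0 ?(ltW l0) ?(ltW il).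
have cst_ge0 : (0 <= (l ^+ n)^-1 * m^-1)%R by rewrite mulr_ge0 ?invr_ge0 ?(ltW ln0) ?(ltW m0).
rewrite muleA -(EFinM (l ^+ n)^-1) (EFinM (6 ^+ n)%R) -muleA.
apply: lee_pmul; [by rewrite lee_fin|exact: mean_ge0|by rewrite lee_fin|exact: Hi].
Qed.

End majorant.

(** * Extrapolation *)

Section norm_trade.
Local Open Scope ereal_scope.
Context d (T : measurableType d) (R : realType).
Variable mu : {measure set T -> \bar R}.

(** Hoelder's inequality, by integrating [weighted_AMGM_scaled]. Its normalization divides by both
    integrals, so the cases in which one is 0 come first. *)
Lemma integral_geometric_mean (X Y : T -> R) (t : R) :
  measurable_fun setT X -> measurable_fun setT Y ->
  (forall x, (0 <= X x)%R) -> (forall x, (0 <= Y x)%R) -> (0 < t < 1)%R ->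
  \int[mu]_x (X x)%:E < +oo -> \int[mu]_x (Y x)%:E < +oo ->
  \int[mu]_x (X x `^ t * Y x `^ (1 - t))%:E <=
  (\int[mu]_x (X x)%:E) `^ t * (\int[mu]_x (Y x)%:E) `^ (1 - t).
Proof.
move=> mX mY X0 Y0 t01 Xoo Yoo; have /andP[t0 t1] := t01.
have t1' : (0 < 1 - t)%R by rewrite subr_gt0.
have mXE : measurable_fun setT (fun x => (X x)%:E) by exact/measurable_EFinP.
have mYE : measurable_fun setT (fun x => (Y x)%:E) by exact/measurable_EFinP.
have mXY : measurable_fun setT (fun x => (X x `^ t * Y x `^ (1 - t))%:E).
  apply/measurable_EFinP.
  exact: (measurable_funM (measurable_powR_comp _ mX) (measurable_powR_comp _ mY)).
have XY0 x : 0 <= (X x `^ t * Y x `^ (1 - t))%:E by rewrite lee_fin mulr_ge0 ?powR_ge0.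
have IX0 : 0 <= \int[mu]_x (X x)%:E by apply: integral_ge0 => x _; rewrite lee_fin.
have IY0 : 0 <= \int[mu]_x (Y x)%:E by apply: integral_ge0 => x _; rewrite lee_fin.
have zero (Z : T -> R) : measurable_fun setT Z -> (forall x, (0 <= Z x)%R) ->
    \int[mu]_x (Z x)%:E = 0 -> {ae mu, forall x, Z x = 0%R}.
  move=> mZ Z0 IZ.
  have mZE : measurable_fun setT (fun x => (Z x)%:E) by exact/measurable_EFinP.
  have : \int[mu]_x `|(Z x)%:E| = 0.
    by rewrite -IZ; apply: eq_integral => x _; rewrite gee0_abs// lee_fin.
  move=> /(ae_eq_integral_abs mu measurableT mZE).
  by apply: filterS => x /(_ Logic.I) [].
have vanish : {ae mu, forall x, (X x `^ t * Y x `^ (1 - t) = 0)%R} ->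
    \int[mu]_x (X x `^ t * Y x `^ (1 - t))%:E <=
    (\int[mu]_x (X x)%:E) `^ t * (\int[mu]_x (Y x)%:E) `^ (1 - t).
  move=> ae0; rewrite (ae_eq_integral (cst 0))//; first by rewrite integral0 mule_ge0 ?poweR_ge0.
  by apply: filterS ae0 => x /= -> _.
have [/(zero _ mX X0) aeX|nX] := eqVneq (\int[mu]_x (X x)%:E) 0.
  by apply: vanish; apply: filterS aeX => x ->; rewrite powR0 ?mul0r ?gt_eqF.
have [/(zero _ mY Y0) aeY|nY] := eqVneq (\int[mu]_x (Y x)%:E) 0.
  by apply: vanish; apply: filterS aeY => x ->; rewrite powR0 ?mulr0 ?gt_eqF.
have IXp : 0 < \int[mu]_x (X x)%:E by rewrite lt0e nX.
have IYp : 0 < \int[mu]_x (Y x)%:E by rewrite lt0e nY.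
move: IXp IYp Xoo Yoo {IX0 IY0 nX nY vanish}.
case IXE : (\int[mu]_x (X x)%:E) => [a||//]; case IYE : (\int[mu]_x (Y x)%:E) => [b||//];
  rewrite ?ltxx// !lte_fin => a0 b0 _ _.
apply: (@le_trans _ _ (\int[mu]_x ((a `^ t * b `^ (1 - t))%:E *
    ((t / a)%:E * (X x)%:E + ((1 - t) / b)%:E * (Y x)%:E)))).
  apply: ge0_le_integral => //.
  - by apply: measurable_funeM; apply: emeasurable_funD; exact: measurable_funeM.
  move=> x _; rewrite -(EFinM (t / a)) -(EFinM ((1 - t) / b)) -EFinD -EFinM lee_fin.
  exact: weighted_AMGM_scaled.
have c1 : (0 <= t / a)%R by rewrite divr_ge0 ?ltW.
have c2 : (0 <= (1 - t) / b)%R by rewrite divr_ge0 ?ltW.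
rewrite ge0_integralZl//; last 3 first.
- by apply: emeasurable_funD; exact: measurable_funeM.
- by move=> x _; rewrite adde_ge0// mule_ge0// lee_fin.
- by rewrite lee_fin mulr_ge0 ?powR_ge0.
rewrite ge0_integralD//; last 4 first.
- by move=> x _; rewrite mule_ge0// lee_fin.
- exact: measurable_funeM.
- by move=> x _; rewrite mule_ge0// lee_fin.
- exact: measurable_funeM.
rewrite !ge0_integralZl//; try by move=> x _; rewrite lee_fin.
rewrite IXE IYE !poweR_EFin -(EFinM (t / a)) -(EFinM ((1 - t) / b)) -EFinD.
by rewrite !divfK ?gt_eqF// subrKC mule1 EFinM.
Qed.

(* If [a <= F] then the gain [F ^ (P / P0 - 1)] in the first factor is paid for
   by Hoelder's inequality in the second one. The case [P0 = +oo] is [iP0 = 0]. *)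
Section trade.
Variables (a b F : T -> R) (P iP0 c e dl : R) (P0 : \bar R).
Hypotheses (ma : measurable_fun setT a) (mb : measurable_fun setT b)
  (mF : measurable_fun setT F).
Hypotheses (a0 : forall x, (0 <= a x)%R) (b0 : forall x, (0 <= b x)%R)
  (F0 : forall x, (0 < F x)%R).
Hypotheses (Ppos : (0 < P)%R) (cpos : (0 < c)%R) (epos : (0 < e)%R) (dlpos : (0 < dl)%R).
Hypotheses (HP0 : (P0 = +oo /\ iP0 = 0%R) \/ ((0 < iP0)%R /\ P0 = (iP0^-1)%:E)).
Hypotheses (dlP : (P^-1 = iP0 + dl)%R) (dle : (e^-1 = c^-1 + dl)%R).
Hypothesis aF : {ae mu, forall x, (a x <= F x)%R}.
Hypotheses (Foo : \int[mu]_x (F x `^ P)%:E < +oo)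
  (boo : \int[mu]_x (b x `^ c)%:E < +oo).
Hypothesis muT : 0 < mu setT.

Let Phi := \int[mu]_x (F x `^ P)%:E.

Let PhiP : 0 < Phi.
Proof.
apply: integral_gt0 => //; first exact: measurable_powR_comp.
by move=> x; rewrite powR_gt0.
Qed.

(** With $\delta$ for [dl]: $aF^{-\delta P}\le F^{1-\delta P}=F^{P/P_0}$, whose $P_0$-th power is
    $F^P$; for $P_0=\infty$ the bound is the constant 1. *)
Lemma Lnorm_gain :
  Lnorm mu P0 (fun x => (a x * F x `^ (- (dl * P)))%:E) <= Phi `^ iP0.
Proof.
have g0 x : (0 <= a x * F x `^ (- (dl * P)))%R by rewrite mulr_ge0 ?powR_ge0.
have dP : (dl * P = 1 - iP0 * P)%R.
  have -> : dl = (P^-1 - iP0)%R by rewrite dlP addrAC subrr add0r.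
  by rewrite mulrBl mulVf// gt_eqF.
case: HP0 => [[-> i0]|[i0 ->]].
  rewrite i0 poweRe0 unlock muT; apply/ess_supP.
  apply: filterS aF => x ax /=; rewrite ger0_norm// lee_fin.
  by rewrite dP i0 mul0r subr0 powR_inv1 ?(ltW (F0 x))// ler_pdivrMr// mul1r.
rewrite unlock invrK; apply: lee_poweR; first exact: ltW.
  by apply: integral_ge0 => x _; exact: poweR_ge0.
have mg : measurable_fun setT (fun x => (a x * F x `^ (- (dl * P)))%R).
  exact: (measurable_funM ma (measurable_powR_comp _ mF)).
apply: ae_ge0_le_integral => //.
- by move=> x _; exact: poweR_ge0.
- apply: measurable_poweR_comp; apply: measurableT_comp => //.
  exact/measurable_EFinP.
- by move=> x _; rewrite lee_fin powR_ge0.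
- by apply/measurable_EFinP; exact: measurable_powR_comp.
apply: filterS aF => x ax _; rewrite gee0_abs ?lee_fin//.
apply: (@le_trans _ _ ((F x `^ (iP0 * P)) `^ iP0^-1)%R).
  apply: ge0_ler_powR; rewrite ?nnegrE ?powR_ge0 ?invr_ge0 ?(ltW i0)//.
  rewrite (_ : iP0 * P = 1 - dl * P)%R; last by rewrite dP; lra.
  rewrite powRD; last by rewrite (gt_eqF (F0 x)) implybT.
  by rewrite powRr1 ?(ltW (F0 x))// ler_wpM2r ?powR_ge0.
by rewrite -powRrM mulrAC divff ?mul1r// gt_eqF.
Qed.

(** Hoelder's inequality for $(bF^{\delta P})^e=(b^c)^{e/c}(F^P)^{e\delta}$, where
    $e/c+e\delta=1$. *)
Lemma Lnorm_loss : Lnorm mu e%:E (fun x => (b x * F x `^ (dl * P))%:E) <=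
  (\int[mu]_x (b x `^ c)%:E) `^ c^-1 * Phi `^ dl.
Proof.
have ec : (0 < e / c < 1)%R.
  rewrite divr_gt0//= ltr_pdivrMr// mul1r -ltf_pV2// dle ltrDl//.
have ecE : (1 - e / c = e * dl)%R.
  have -> : dl = (e^-1 - c^-1)%R by rewrite dle addrAC subrr add0r.
  by rewrite mulrBr divff// gt_eqF.
have B0 : 0 <= \int[mu]_x (b x `^ c)%:E.
  by apply: integral_ge0 => x _; rewrite lee_fin powR_ge0.
have := integral_geometric_mean (measurable_powR_comp c mb) (measurable_powR_comp P mF)
  (fun x => powR_ge0 _ _) (fun x => powR_ge0 _ _) ec boo Foo.
move=> /(lee_poweR (_ : 0 <= e^-1)%R) H.
rewrite unlock; apply: le_trans (le_trans (H _ _) _).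
- rewrite le_eqVlt; apply/orP; left; apply/eqP; congr (_ `^ _).
  apply: eq_integral => x _; rewrite gee0_abs; last by rewrite lee_fin mulr_ge0 ?powR_ge0.
  rewrite poweR_EFin (powRM _ (b0 x) (powR_ge0 _ _)) -!powRrM ecE.
  have -> : (dl * P * e = P * (e * dl))%R by ring.
  by have -> : (c * (e / c) = e)%R by rewrite mulrC divfK// gt_eqF.
- by rewrite invr_ge0 ltW.
- by apply: integral_ge0 => x _; rewrite lee_fin mulr_ge0 ?powR_ge0.
rewrite poweRM ?poweR_ge0// -!poweRrM ecE.
have -> : (e / c / e = c^-1)%R by field; rewrite !gt_eqF.
by have -> : (e * dl / e = dl)%R by field; rewrite gt_eqF.
Qed.

Lemma Lnorm_trade :
  Lnorm mu P0 (fun x => (a x * F x `^ (- (dl * P)))%:E) *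
  Lnorm mu e%:E (fun x => (b x * F x `^ (dl * P))%:E) <=
  Phi `^ P^-1 * (\int[mu]_x (b x `^ c)%:E) `^ c^-1.
Proof.
have PhiD : Phi `^ P^-1 = Phi `^ iP0 * Phi `^ dl.
  rewrite dlP poweRD//; apply: nneg_neq0_poweRD_def; rewrite ?(ltW dlpos) ?gt_eqF//.
  by case: HP0 => [[_ ->]|[/ltW]].
rewrite PhiD -muleA [leRHS](_ : _ = Phi `^ iP0 *
  ((\int[mu]_x (b x `^ c)%:E) `^ c^-1 * Phi `^ dl)); last by rewrite (muleC (Phi `^ dl)).
by apply: lee_pmul; [exact: Lnorm_ge0|exact: Lnorm_ge0|exact: Lnorm_gain|exact: Lnorm_loss].
Qed.

End trade.
End norm_trade.

(** * From an $A_1$ majorant to the extrapolated weight *)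

Section extrapolation_core.
Local Open Scope ereal_scope.
Context {R : realType} {n : nat}.
Local Notation mu := (lebesgueRn R n).

(** Links the two shapes of the new weight: a power of $F$, suited to the norms, and $u\,h^{s-t}$,
    suited to the $A_t$ characteristic. *)
Lemma powR_jones (u h s t P : R) : (0 < u)%R -> (0 < h)%R -> (0 < s)%R -> (0 < P)%R ->
  (u `^ (t / s) * ((h `^ s * u) `^ P^-1) `^ (- (P * (t / s - 1))) = u * h `^ (s - t))%R.
Proof.
move=> u0 h0 s0 P0.
have e1 : (P^-1 * - (P * (t / s - 1)) = 1 - t / s)%R by field; rewrite !gt_eqF.
have e2 : (s * (1 - t / s) = s - t)%R by field; rewrite gt_eqF.
have e3 : (t / s + (1 - t / s) = 1)%R by ring.
rewrite -powRrM e1 (powRM _ (powR_ge0 _ _) (ltW u0)) -powRrM e2 mulrCA -powRD.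
  by rewrite e3 powRr1 ?(ltW u0)// mulrC.
by rewrite (gt_eqF u0) implybT.
Qed.

(** The norm bound is conditional because no positive [F] can satisfy it when [a] is null; in that
    case [F] only has to produce a weight in $A_t$. *)
Lemma extrapolation_majorant (u a : Rn R n -> R) (s t A P : R) :
  measurable_fun setT u -> (forall x, (0 < u x)%R) -> (1 < s)%R -> (s < t)%R ->
  (0 < A)%R -> Achar s (fun x => (u x)%:E) <= A%:E ->
  (0 < P)%R -> measurable_fun setT a -> (forall x, (0 <= a x)%R) ->
  \int[mu]_x (a x `^ P)%:E < +oo ->
  exists F : Rn R n -> R,
    [/\ measurable_fun setT F, forall x, (0 < F x)%R,
        {ae mu, forall x, (a x <= F x)%R},
        ~ {ae mu, forall x, a x = 0%R} ->
          \int[mu]_x (F x `^ P)%:E <= (2 `^ s)%:E * \int[mu]_x (a x `^ P)%:E &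
        Achar t (fun x => (u x `^ (t / s) * F x `^ (- (P * (t / s - 1))))%:E) <=
          (rdf_A1_cst (n:=n) s `^ (t - s) * A `^ ((t - 1) / (s - 1)))%:E].
Proof.
move=> mu_ u0 s1 st A0 HA P0 ma a0 aoo.
have s0 : (0 < s)%R by exact: lt_trans s1.
have q0 : (0 < s - 1)%R by rewrite subr_gt0.
pose h0 x := ((a x `^ P / u x) `^ s^-1)%R%:E : \bar R.
have minv : measurable_fun setT (fun x => (u x)^-1)%R.
  rewrite (_ : (fun x => _) = (fun x => u x `^ (-1))%R); first exact: measurable_powR_comp.
  by apply/funext => x; rewrite powR_inv1// ltW.
have mh0 : measurable_fun setT h0.
  apply/measurable_EFinP; apply: measurable_powR_comp.
  exact: (measurable_funM (measurable_powR_comp _ ma) minv).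
have h0_ge0 x : 0 <= h0 x by rewrite lee_fin powR_ge0.
have h0s x : h0 x `^ s * (u x)%:E = (a x `^ P)%:E.
  have au0 : (0 <= a x `^ P / u x)%R by rewrite divr_ge0 ?powR_ge0// ltW.
  by rewrite /h0 poweR_EFin -powRrM mulVf ?gt_eqF// powRr1// -EFinM divfK// gt_eqF.
have h0_norm : \int[mu]_x (h0 x `^ s * (u x)%:E) = \int[mu]_x (a x `^ P)%:E.
  by apply: eq_integral => x _; exact: h0s.
have h0_zero x : h0 x = 0 -> a x = 0%R.
  move=> h0x; have := h0s x; rewrite h0x poweR0r ?gt_eqF// mul0e => -[] /esym.
  exact: powR_eq0_eq0.
have [h [mh h_gt0 hN hA1 haF]] : exists h : Rn R n -> R,
    [/\ measurable_fun setT h, forall x, (0 < h x)%R,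
      ~ {ae mu, forall x, a x = 0%R} -> \int[mu]_x (h x `^ s * u x)%:E <=
          (2 `^ s)%:E * \int[mu]_x (h0 x `^ s * (u x)%:E),
      forall c l, (0 < l)%R -> {ae mu, forall x, cube c l x ->
          mean mu (cube c l) (fun x => (h x)%:E) <=
          (rdf_A1_cst (n:=n) s * A `^ (s - 1)^-1 * h x)%:E} &
      {ae mu, forall x, h0 x <= (h x)%:E}].
  have [aez|nz] := pselect {ae mu, forall x, a x = 0%R}; last first.
    have nz' : ~ {ae mu, forall x, h0 x = 0}.
      by move=> z; apply: nz; apply: filterS z => x; exact: h0_zero.
    have h0oo : \int[mu]_x (h0 x `^ s * (u x)%:E) < +oo by rewrite h0_norm.
    have [h [mh hp hh0 hN hA1]] := rdf_majorant mu_ u0 s1 A0 HA mh0 h0_ge0 nz' h0oo.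
    by exists h; apply: (And5 mh hp (fun _ => hN) hA1 hh0).
  (* Here [a] is null. The indicator of a unit cube is a substitute that lies in $L^s(u)$, because
     [u] is locally integrable. *)
  pose Q1 := cube ([tuple 0%R | _ < n] : Rn R n) 1%R.
  have l1 : (0 < 1 :> R)%R by [].
  have mQ1 : measurable Q1 by exact: measurable_cube.
  pose k0 x := (\1_Q1 x : R)%:E.
  have mk0 : measurable_fun setT k0 by apply/measurable_EFinP; exact: measurable_indic.
  have k0_ge0 x : 0 <= k0 x by rewrite lee_fin.
  have knz : ~ {ae mu, forall x, k0 x = 0}.
    move=> k0z; have [x Qx] : exists2 x, Q1 x & k0 x = 0.
      apply: (exists_in_set mQ1 (measure_cube_gt0 _ l1)).
      by apply: filterS k0z => x kx _.
    rewrite /k0 indicE mem_set// => -[] /eqP.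
    by rewrite oner_eq0.
  have koo : \int[mu]_x (k0 x `^ s * (u x)%:E) < +oo.
    have [U [S [U0 _ UE _ _]]] := Achar_means mu_ u0 s1 [tuple 0%R | _ < n] l1 HA.
    have -> : \int[mu]_x (k0 x `^ s * (u x)%:E) = \int[mu]_(x in Q1) (u x)%:E.
      rewrite [RHS]integral_mkcond; apply: eq_integral => x _.
      rewrite epatch_indic /= /k0 indicE; case: (x \in Q1).
        by rewrite powR1 mul1e mule1.
      by rewrite powR0 ?gt_eqF// mul0e mule0.
    move: UE; rewrite /mean lebesgueRn_cube// expr1n inve1 mul1e => ->.
    exact: ltry.
  have [h [mh hp hh0 hN hA1]] := rdf_majorant mu_ u0 s1 A0 HA mk0 k0_ge0 knz koo.
  have hz : {ae mu, forall x, h0 x <= (h x)%:E}; last first.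
    by exists h; apply: (And5 mh hp (fun nz => False_ind _ (nz aez)) hA1 hz).
  apply: filterS aez => x ax; rewrite /h0 ax powR0 ?gt_eqF// mul0r powR0 ?invr_eq0 ?gt_eqF//.
  by rewrite lee_fin ltW.
pose F x := ((h x `^ s * u x) `^ P^-1)%R.
have hu0 x : (0 < h x `^ s * u x)%R by rewrite mulr_gt0// powR_gt0.
have FP x : (F x `^ P = h x `^ s * u x)%R.
  by rewrite /F -powRrM mulVf ?powRr1 ?(ltW (hu0 x))// gt_eqF.
exists F; split.
- apply: measurable_powR_comp.
  exact: (measurable_funM (measurable_powR_comp s mh) mu_).
- by move=> x; rewrite powR_gt0.
- apply: filterS haF => x hx.
  have h0h : (a x `^ P <= h x `^ s * u x)%R.
    rewrite -lee_fin -h0s EFinM; apply: lee_wpmul2r; first by rewrite lee_fin ltW.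
    by rewrite -poweR_EFin; apply: lee_poweR => //; exact: ltW.
  rewrite -[leLHS](powRr1 (a0 x)) -(mulfV (lt0r_neq0 P0)) powRrM.
  by apply: ge0_ler_powR; rewrite ?nnegrE ?powR_ge0 ?invr_ge0 ?(ltW P0) ?(ltW (hu0 x)).
- move=> nz; rewrite -h0_norm; apply: le_trans (hN nz).
  by rewrite le_eqVlt; apply/orP; left; apply/eqP; apply: eq_integral => x _; rewrite FP.
have -> : (fun x => (u x `^ (t / s) * F x `^ (- (P * (t / s - 1))))%:E) =
    (fun x => (u x * h x `^ (s - t))%:E).
  by apply/funext => x; congr EFin; exact: powR_jones.
have cst0 : (0 < rdf_A1_cst (n:=n) s)%R := rdf_A1_cst_gt0 s1.
have K0 : (0 < rdf_A1_cst (n:=n) s * A `^ (s - 1)^-1)%R by rewrite mulr_gt0// powR_gt0.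
apply: (le_trans (Achar_mul_A1 mu_ u0 s1 mh h_gt0 st K0 hA1 HA)).
rewrite lee_fin (powRM _ (ltW cst0) (powR_ge0 _ _)) -mulrA -powRrM.
rewrite -[X in (_ * (_ * X) <= _)%R](powRr1 (ltW A0)) -powRD; last first.
  by rewrite (gt_eqF A0) implybT.
by have -> : ((s - 1)^-1 * (t - s) + 1 = (t - 1) / (s - 1))%R by field; rewrite gt_eqF.
Qed.

Lemma dual_weightK (u : Rn R n -> R) (s : R) x : (1 < s)%R -> (0 < u x)%R ->
  dual_weight (dual_weight u s) (conjR s) x = u x.
Proof.
move=> s1 u0; rewrite /dual_weight conjRE// -powRrM (_ : _ * _ = 1)%R ?powRr1 ?ltW//.
by field; rewrite subr_eq0 gt_eqF//=; apply/eqP; lra.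
Qed.

Lemma conjR_gt1 (s : R) : (1 < s)%R -> (1 < conjR s)%R.
Proof. by move=> s1; rewrite conjRE// ltr_pdivlMr ?subr_gt0// mul1r gtrBl. Qed.

Lemma conjR_sub1 (s : R) : (1 < s)%R -> (conjR s - 1 = (s - 1)^-1)%R.
Proof. by move=> s1; rewrite conjRE//; field; rewrite subr_eq0 gt_eqF. Qed.

(** On each cube the dual product is $S\,U^{1/(s-1)}=(U\,S^{s-1})^{1/(s-1)}$. *)
Lemma Achar_dual (u : Rn R n -> R) (s A : R) :
  measurable_fun setT u -> (forall x, (0 < u x)%R) -> (1 < s)%R -> (0 < A)%R ->
  Achar s (fun x => (u x)%:E) <= A%:E ->
  Achar (conjR s) (fun x => (dual_weight u s x)%:E) <= (A `^ (s - 1)^-1)%:E.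
Proof.
move=> mu_ u0 s1 A0 HA; have q0 : (0 < s - 1)%R by rewrite subr_gt0.
apply/Achar_ubP => [|c l l0]; first exact: conjR_gt1.
have [U [S [U0 S0 UE SE US]]] := Achar_means mu_ u0 s1 c l0 HA.
have -> : (fun x => (dual_weight (dual_weight u s) (conjR s) x)%:E) =
    (fun x => (u x)%:E) by apply/funext => x; rewrite dual_weightK.
rewrite UE SE conjR_sub1// poweR_EFin -EFinM lee_fin.
have -> : (S * U `^ (s - 1)^-1 = (U * S `^ (s - 1)) `^ (s - 1)^-1)%R.
  rewrite (powRM _ (ltW U0) (powR_ge0 _ _)) -powRrM divff ?gt_eqF// powRr1 ?(ltW S0)//.
  exact: mulrC.
by apply: ge0_ler_powR; rewrite ?nnegrE ?invr_ge0 ?mulr_ge0 ?powR_ge0 ?(ltW q0) ?(ltW U0) ?(ltW A0).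
Qed.

Lemma average_ae (f g : Rn R n -> \bar R) (c : Rn R n) (l : R) :
  measurable_fun setT f -> measurable_fun setT g ->
  (forall x, 0 <= f x) -> (forall x, 0 <= g x) ->
  {ae mu, forall x, f x = g x} -> average (cube c l) f = average (cube c l) g.
Proof.
move=> mf mg f0 g0 fg; rewrite /average.
rewrite (ge0_ae_eq_integral (measurable_cube c l) (measurable_funTS mf)
    (measurable_funTS mg) (fun x _ => f0 x) (fun x _ => g0 x))//.
by apply: filterS fg => x fx _.
Qed.

Lemma Achar_ae (s : R) (f g : Rn R n -> \bar R) :
  measurable_fun setT f -> measurable_fun setT g ->
  (forall x, 0 <= f x) -> (forall x, 0 <= g x) ->
  {ae mu, forall x, f x = g x} -> Achar s f = Achar s g.
Proof.
have le (f' g' : Rn R n -> \bar R) : measurable_fun setT f' -> measurable_fun setT g' ->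
    (forall x, 0 <= f' x) -> (forall x, 0 <= g' x) ->
    {ae mu, forall x, f' x = g' x} -> Achar s f' <= Achar s g'.
  move=> mf mg f0 g0 fg; apply: ge_ereal_sup => _ [_ [c [l [l0 ->]]] <-].
  apply: ereal_sup_ubound; exists (cube c l); first by exists c, l.
  rewrite (average_ae c l mf mg f0 g0 fg).
  have fgP : {ae mu, forall x, f' x `^ (1 - conjR s) = g' x `^ (1 - conjR s)}.
    by apply: filterS fg => x ->.
  by rewrite (average_ae c l (measurable_poweR_comp _ mf) (measurable_poweR_comp _ mg)
    (fun x => poweR_ge0 _ _) (fun x => poweR_ge0 _ _) fgP).
move=> mf mg f0 g0 fg; have gf : {ae mu, forall x, g x = f x}.
  by apply: filterS fg => x ->.
by apply/le_anti/andP; split; [exact: (le _ _ mf mg f0 g0 fg)|exact: (le _ _ mg mf g0 f0 gf)].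
Qed.

End extrapolation_core.

Section extrapolation_step.
Local Open Scope ereal_scope.
Context {R : realType} {n : nat}.
Local Notation mu := (lebesgueRn R n).

Lemma lebesgueRn_setT_gt0 : 0 < mu setT.
Proof.
have l1 : (0 < 1 :> R)%R by [].
pose c : Rn R n := [tuple 0%R | _ < n].
apply: lt_le_trans (measure_cube_gt0 c l1) _.
by apply: le_measure; rewrite ?inE; [exact: measurable_cube|exact: measurableT|].
Qed.

Lemma Lnorm_ae0 d (T : measurableType d) (m : {measure set T -> \bar R})
    (P0 : \bar R) (g : T -> \bar R) :
  0 < m setT -> P0 = +oo \/ (exists2 p : R, (0 < p)%R & P0 = p%:E) ->
  measurable_fun setT g -> {ae m, forall x, g x = 0} -> Lnorm m P0 g = 0.
Proof.
move=> mT HP mg g0; case: HP => [->|[p p0 ->]]; rewrite unlock.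
  rewrite mT; apply: ess_sup_ae_cst => //.
  by apply: filterS g0 => x /= ->; rewrite abse0.
rewrite (ae_eq_integral (cst 0))//; last 2 first.
- by apply: measurable_poweR_comp; exact: measurableT_comp.
- by apply: filterS g0 => x -> _ /=; rewrite normr0 powR0// gt_eqF.
by rewrite integral0 poweR0r// invr_eq0 gt_eqF.
Qed.

(** Two abstract functions, so that it serves both directions: $a=|f|w$ and $b=|g|/w$ for $r<r_0$,
    the roles exchanged for $r_0<r$. In the latter case $P_0=q_0'$, which is infinite for $q_0=1$;
    hence the reciprocal [iP0]. *)
Lemma extrapolation_step (u a b : Rn R n -> R) (s t A P iP0 c e dl : R) (P0 : \bar R) :
  measurable_fun setT u -> (forall x, (0 < u x)%R) -> (1 < s)%R -> (s < t)%R ->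
  (0 < A)%R -> Achar s (fun x => (u x)%:E) <= A%:E ->
  measurable_fun setT a -> measurable_fun setT b ->
  (forall x, (0 <= a x)%R) -> (forall x, (0 <= b x)%R) ->
  (0 < P)%R -> (0 < c)%R -> (0 < e)%R -> (0 < dl)%R ->
  (P0 = +oo /\ iP0 = 0%R) \/ ((0 < iP0)%R /\ P0 = (iP0^-1)%:E) ->
  (P^-1 = iP0 + dl)%R -> (e^-1 = c^-1 + dl)%R ->
  \int[mu]_x (a x `^ P)%:E < +oo -> \int[mu]_x (b x `^ c)%:E < +oo ->
  exists F : Rn R n -> R,
    [/\ measurable_fun setT F, forall x, (0 < F x)%R,
        Achar t (fun x => (u x `^ (t / s) * F x `^ (- (P * (t / s - 1))))%:E) <=
          (rdf_A1_cst (n:=n) s `^ (t - s) * A `^ ((t - 1) / (s - 1)))%:E &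
        Lnorm mu P0 (fun x => (a x * F x `^ (- (dl * P)))%:E) *
        Lnorm mu e%:E (fun x => (b x * F x `^ (dl * P))%:E) <=
        (2 `^ (s / P))%:E * ((\int[mu]_x (a x `^ P)%:E) `^ P^-1 *
          (\int[mu]_x (b x `^ c)%:E) `^ c^-1)].
Proof.
move=> mu_ u0 s1 st A0 HA ma mb a0 b0 Ppos cpos epos dlpos HP0 dlP dle aoo boo.
have [F [mF F0 aF NF HV]] := extrapolation_majorant mu_ u0 s1 st A0 HA Ppos ma a0 aoo.
exists F; apply: (And4 mF F0 HV) => {HV}.
(* A null [a] comes without a norm bound for [F], but then the left side is 0, even if the second
   norm is infinite. *)
have [aez|nz] := pselect {ae mu, forall x, a x = 0%R}.
  rewrite [X in X * _](_ : _ = 0).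
    by rewrite mul0e mule_ge0// ?mule_ge0 ?poweR_ge0// lee_fin powR_ge0.
  apply: (Lnorm_ae0 lebesgueRn_setT_gt0).
  - case: HP0 => [[-> _]|[i0 ->]]; first by left.
    by right; exists iP0^-1%R; rewrite ?invr_gt0.
  - apply/measurable_EFinP; exact: (measurable_funM ma (measurable_powR_comp _ mF)).
  - by apply: filterS aez => x ->; rewrite mul0r.
have {}NF := NF nz.
have F_ge0 : 0 <= \int[mu]_x (F x `^ P)%:E.
  by apply: integral_ge0 => x _; rewrite lee_fin powR_ge0.
have a_ge0 : 0 <= \int[mu]_x (a x `^ P)%:E.
  by apply: integral_ge0 => x _; rewrite lee_fin powR_ge0.
have Foo : \int[mu]_x (F x `^ P)%:E < +oo.
  by apply: (le_lt_trans NF); rewrite lte_mul_pinfty ?lee_fin ?powR_ge0.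
apply: (le_trans (Lnorm_trade ma mb mF a0 b0 F0 Ppos cpos epos dlpos HP0 dlP dle
  aF Foo boo lebesgueRn_setT_gt0)).
rewrite muleA; apply: lee_wpmul2r; first exact: poweR_ge0.
apply: (@le_trans _ _ (((2 `^ s)%:E * \int[mu]_x (a x `^ P)%:E) `^ P^-1)).
  by apply: lee_poweR; rewrite ?invr_ge0 ?(ltW Ppos).
rewrite poweRM ?lee_fin ?powR_ge0// -poweR_EFin.
by rewrite (_ : (2 `^ s)%:E `^ P^-1 = (2 `^ (s / P))%:E)// poweR_EFin -powRrM.
Qed.

Lemma Lnorm_ae_real (p : R) (G : Rn R n -> \bar R) (a : Rn R n -> R) :
  (0 < p)%R -> measurable_fun setT a -> (forall x, (0 <= a x)%R) ->
  {ae mu, forall x, G x = (a x)%:E} ->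
  Lnorm mu p%:E G = (\int[mu]_x (a x `^ p)%:E) `^ p^-1.
Proof.
move=> p0 ma a0 Ga.
have maE : measurable_fun setT (fun x => (a x)%:E) by exact/measurable_EFinP.
(* [G] is known only almost everywhere; completeness of the measure makes it measurable. *)
have mG : measurable_fun setT G.
  have cmu : measure_is_complete mu by move=> N; exact: measure_is_complete_caratheodory.
  apply: (ae_measurable_fun cmu _ maE).
  by apply: filterS Ga => x -> _.
rewrite unlock; congr (_ `^ _).
apply: (ge0_ae_eq_integral measurableT).
- by apply: measurable_poweR_comp; exact: measurableT_comp.
- by apply/measurable_EFinP; exact: measurable_powR_comp.
- by move=> x _; exact: poweR_ge0.
- by move=> x _; rewrite lee_fin powR_ge0.
by apply: filterS Ga => x -> _; rewrite gee0_abs ?lee_fin.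
Qed.

Lemma is_weight_real (v : Rn R n -> R) :
  measurable_fun setT v -> (forall x, (0 < v x)%R) -> is_weight (fun x => (v x)%:E).
Proof.
move=> mv v0; split; first exact/measurable_EFinP.
by apply: aeW => x; rewrite lte_fin v0 ltry.
Qed.

Lemma measurable_normc (f : Rn R n -> R[i]%C) : cmeasurable f ->
  measurable_fun setT (fun x => Normc.normc (f x)).
Proof.
move=> [mRe mIm]; rewrite (_ : (fun x => _) = (fun x =>
    ((complex.Re (f x)) ^+ 2 + (complex.Im (f x)) ^+ 2) `^ 2^-1)%R); last first.
  apply/funext => x; case: (f x) => y z /=.
  by rewrite powR12_sqrt// addr_ge0// sqr_ge0.
apply: measurable_powR_comp; apply: measurable_funD; exact: measurable_funX.
Qed.

Lemma normc_ge0 (z : R[i]%C) : (0 <= Normc.normc z)%R.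
Proof. by case: z => y z; rewrite /Normc.normc sqrtr_ge0. Qed.

End extrapolation_step.

(** * Replacing a weight by a positive real function *)

Section weighted_functions.
Local Open Scope ereal_scope.
Context {R : realType} {n : nat}.
Local Notation mu := (lebesgueRn R n).
Variables (w : Rn R n -> \bar R) (f g : Rn R n -> R[i]%C).
Hypotheses (hw : is_weight w) (mf : cmeasurable f) (mg : cmeasurable g).

Definition wreal (x : Rn R n) : R := pos_fine (w x).
Definition fw (x : Rn R n) : R := (Normc.normc (f x) * wreal x)%R.
Definition gw (x : Rn R n) : R := (Normc.normc (g x) * (wreal x)^-1)%R.

Lemma wreal_gt0 x : (0 < wreal x)%R. Proof. exact: pos_fine_gt0. Qed.

Lemma measurable_wreal : measurable_fun setT wreal.
Proof. by case: hw => mw _; exact: measurable_pos_fine. Qed.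

Lemma wrealE : {ae mu, forall x, w x = (wreal x)%:E}.
Proof. by case: hw => _; apply: filterS => x /pos_fineK. Qed.

Lemma fw_ge0 x : (0 <= fw x)%R.
Proof. by rewrite mulr_ge0 ?normc_ge0// ltW// wreal_gt0. Qed.

Lemma gw_ge0 x : (0 <= gw x)%R.
Proof. by rewrite mulr_ge0 ?normc_ge0// invr_ge0 ltW// wreal_gt0. Qed.

Lemma measurable_fw : measurable_fun setT fw.
Proof. exact: (measurable_funM (measurable_normc mf) measurable_wreal). Qed.

Lemma measurable_gw : measurable_fun setT gw.
Proof.
apply: (measurable_funM (measurable_normc mg)).
rewrite (_ : (fun x => _) = (fun x => wreal x `^ (-1))%R).
  exact: (measurable_powR_comp _ measurable_wreal).
by apply/funext => x; rewrite powR_inv1// ltW// wreal_gt0.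
Qed.

Lemma Achar_wreal (s r : R) :
  Achar s (fun x => w x `^ r) = Achar s (fun x => (wreal x `^ r)%:E).
Proof.
have mwr : measurable_fun setT (fun x => w x `^ r).
  by case: hw => mw _; exact: measurable_poweR_comp.
have mr : measurable_fun setT (fun x => (wreal x `^ r)%:E).
  by apply/measurable_EFinP; exact: (measurable_powR_comp _ measurable_wreal).
apply: (Achar_ae _ mwr mr).
- by move=> x; exact: poweR_ge0.
- by move=> x; rewrite lee_fin powR_ge0.
by apply: filterS wrealE => x ->.
Qed.

Lemma weighted_norm_lty (p k : R) (h : Rn R n -> R[i]%C) (G : Rn R n -> R) :
  (0 < p)%R -> cmeasurable h -> measurable_fun setT G ->
  {ae mu, forall x, cmod h x `^ p * w x `^ k = (G x `^ p)%:E} ->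
  weighted_norm p (fun x => w x `^ k) h < +oo -> \int[mu]_x (G x `^ p)%:E < +oo.
Proof.
move=> p0 mh mG hG; rewrite /weighted_norm => /lty_poweRy H.
have {}H := H (lt0r_neq0 (eqbRL (invr_gt0 p) p0)).
apply: le_lt_trans H; rewrite le_eqVlt; apply/orP; left; apply/eqP; apply/esym.
apply: (ge0_ae_eq_integral measurableT).
- apply: emeasurable_funM; apply: measurable_poweR_comp.
    by apply/measurable_EFinP; exact: measurable_normc.
  by case: hw.
- by apply/measurable_EFinP; exact: measurable_powR_comp.
- by move=> x _; rewrite mule_ge0 ?poweR_ge0.
- by move=> x _; rewrite lee_fin powR_ge0.
by apply: filterS hG => x ->.
Qed.

Lemma fw_lty (p : R) : (0 < p)%R -> weighted_norm p (fun x => w x `^ p) f < +oo ->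
  \int[mu]_x (fw x `^ p)%:E < +oo.
Proof.
move=> p0; apply: (weighted_norm_lty p0 mf measurable_fw).
apply: filterS wrealE => x ->; rewrite /cmod !poweR_EFin -EFinM.
by rewrite /fw (powRM _ (normc_ge0 _) (ltW (wreal_gt0 x))).
Qed.

Lemma gw_lty (p : R) : (0 < p)%R -> weighted_norm p (fun x => w x `^ (- p)%R) g < +oo ->
  \int[mu]_x (gw x `^ p)%:E < +oo.
Proof.
move=> p0; apply: (weighted_norm_lty p0 mg measurable_gw).
apply: filterS wrealE => x ->; rewrite /cmod !poweR_EFin -EFinM.
have wi0 : (0 <= (wreal x)^-1)%R by rewrite invr_ge0 ltW// wreal_gt0.
rewrite /gw (powRM _ (normc_ge0 _) wi0) -(powR_inv1 (ltW (wreal_gt0 x))) -powRrM.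
by rewrite mulN1r.
Qed.

Lemma Lnorm_fw (p : R) : (0 < p)%R ->
  Lnorm mu p%:E (fun x => cmod f x * w x) = (\int[mu]_x (fw x `^ p)%:E) `^ p^-1.
Proof.
move=> p0; apply: (Lnorm_ae_real p0 measurable_fw fw_ge0).
by apply: filterS wrealE => x ->; rewrite /cmod -EFinM.
Qed.

Lemma Lnorm_gw (p : R) : (0 < p)%R ->
  Lnorm mu p%:E (fun x => cmod g x * (w x)^-1) = (\int[mu]_x (gw x `^ p)%:E) `^ p^-1.
Proof.
move=> p0; apply: (Lnorm_ae_real p0 measurable_gw gw_ge0).
by apply: filterS wrealE => x ->; rewrite /cmod inver gt_eqF ?wreal_gt0.
Qed.

End weighted_functions.

(** * Conjugate exponents and the three cases *)

Lemma hoelder_conjugateE {R : realType} (q : R) : 1 < q ->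
  hoelder_conjugate q%:E = (conjR q)%:E.
Proof.
move=> q1; rewrite conjRE// /hoelder_conjugate/= gt_eqF ?lte_fin ?(lt_trans ltr01 q1)//.
by rewrite inver subr_eq0 gt_eqF.
Qed.

Lemma conjR_inv {R : realType} (q : R) : 1 < q -> (conjR q)^-1 = 1 - q^-1.
Proof. by move=> q1; rewrite conjRE//; field; apply/andP; split; apply/eqP; lra. Qed.

Lemma conjR_lt {R : realType} (s t : R) : 1 < s -> s < t -> conjR t < conjR s.
Proof.
move=> s1 st; have t1 := lt_trans s1 st.
rewrite -ltf_pV2 ?posrE ?(lt_trans ltr01 (conjR_gt1 _))//.
by rewrite !conjR_inv// ltrD2l ltrN2 ltf_pV2 ?posrE ?(lt_trans ltr01).
Qed.

(** The exponents multiply to $\frac1{s-1}\cdot\frac{s-1}{t-1}\cdot(t-1)=1$: dualizing,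
    extrapolating and dualizing back is linear in the characteristic. *)
Lemma powR_conjRK {R : realType} (A s t : R) : 1 < s -> 1 < t -> 0 < A ->
  ((A `^ (s - 1)^-1) `^ ((conjR t - 1) / (conjR s - 1))) `^ (conjR t - 1)^-1 = A.
Proof.
move=> s1 t1 A0; rewrite (conjR_sub1 s1) (conjR_sub1 t1) !invrK.
have tq : t - 1 != 0 by rewrite subr_eq0 gt_eqF.
have sq : s - 1 != 0 by rewrite subr_eq0 gt_eqF.
have e : (s - 1)^-1 * ((t - 1)^-1 * (s - 1) * (t - 1)) = 1 by field; rewrite sq tq.
by rewrite -(powRrM (A `^ _)) -(powRrM A) e powRr1// ltW.
Qed.

Lemma conjRK {R : realType} (t : R) : 1 < t -> conjR (conjR t) = t.
Proof.
move=> t1; apply: invr_inj.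
by rewrite (conjR_inv (conjR_gt1 t1)) (conjR_inv t1) subKr.
Qed.

(** On the left, $v^{r_0}$ for the [v] suited to the norms; on the right, the dual of the weight
    that [extrapolation_step] builds from the dual of $w^r$. The double sign gives the exponent the
    form [- k] of [cmod_mul_weight]. *)
Lemma powR_dual_jones {R : realType} (x y beta r r0 k : R) :
  0 < x -> 0 < beta -> 0 < r -> 0 < r0 -> 1 < r * beta -> 1 < r0 * beta ->
  (x * y `^ (- (- ((r0^-1 - r^-1) * k)))) `^ r0 =
  (((x `^ r) `^ (- (r * beta - 1)^-1)) `^ (conjR (r0 * beta) / conjR (r * beta)) *
    y `^ (- (k * (conjR (r0 * beta) / conjR (r * beta) - 1)))) `^
    (- (conjR (r0 * beta) - 1)^-1).
Proof.
move=> x0 beta0 r_gt0 r0_gt0 s1 t1.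
have tq : r0 * beta - 1 != 0 by rewrite subr_eq0 gt_eqF.
have sq : r * beta - 1 != 0 by rewrite subr_eq0 gt_eqF.
rewrite (conjR_sub1 t1) invrK (powRM _ (ltW x0) (powR_ge0 _ _)).
rewrite (powRM _ (powR_ge0 _ _) (powR_ge0 _ _)) -!powRrM (conjRE s1) (conjRE t1).
have -> : r * (- (r * beta - 1)^-1 * (r0 * beta / (r0 * beta - 1) /
    (r * beta / (r * beta - 1)) * - (r0 * beta - 1))) = r0.
  by field; rewrite sq tq !gt_eqF.
have -> : - (k * (r0 * beta / (r0 * beta - 1) / (r * beta / (r * beta - 1)) - 1)) *
    - (r0 * beta - 1) = - (- ((r0^-1 - r^-1) * k)) * r0.
  by field; rewrite sq tq !gt_eqF.
by [].
Qed.

Section extrapolation_cases.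
Local Open Scope ereal_scope.
Context {R : realType} {n : nat}.
Local Notation mu := (lebesgueRn R n).
Implicit Types (w : Rn R n -> \bar R) (f g : Rn R n -> R[i]%C).

Lemma Aclass_real (v : Rn R n -> R) (s r M : R) :
  measurable_fun setT v -> (forall x, (0 < v x)%R) ->
  Achar s (fun x => (v x `^ r)%:E) <= M%:E ->
  Aclass s (fun x => (v x)%:E `^ r).
Proof.
move=> mv v0 HM; split; last exact: le_lt_trans HM (ltry _).
apply: is_weight_real; first exact: measurable_powR_comp.
by move=> x; rewrite powR_gt0.
Qed.

Lemma Achar_fin w (s r : R) : is_weight w -> (1 < s)%R ->
  Achar s (fun x => w x `^ r) < +oo ->
  exists2 A : R, (0 < A)%R & Achar s (fun x => w x `^ r) = A%:E.
Proof.
move=> hw s1; rewrite (Achar_wreal hw) => Aoo.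
have u0 x : (0 < wreal w x `^ r)%R by rewrite powR_gt0 ?wreal_gt0.
have A0 := Achar_gt0 (measurable_powR_comp r (measurable_wreal hw)) u0 s1.
by exists (fine (Achar s (fun x => (wreal w x `^ r)%:E)));
  [rewrite fine_gt0// A0|rewrite fineK// gt0_fin_numE].
Qed.

Lemma cmod_mul_weight w f (F : Rn R n -> R) (k : R) :
  (fun x => cmod f x * (wreal w x * F x `^ (- k))%:E) =
  (fun x => (fw w f x * F x `^ (- k))%:E).
Proof. by apply/funext => x; rewrite /cmod -EFinM mulrA. Qed.

Lemma cmod_div_weight w g (F : Rn R n -> R) (k : R) : (forall x, (0 < F x)%R) ->
  (fun x => cmod g x * ((wreal w x * F x `^ (- k))%:E)^-1) =
  (fun x => (gw w g x * F x `^ k)%:E).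
Proof.
move=> F0; apply/funext => x.
have wF0 : (0 < wreal w x * F x `^ (- k))%R.
  by rewrite mulr_gt0 ?wreal_gt0// powR_gt0.
rewrite /cmod inver gt_eqF// -EFinM invfM -powRN opprK.
by rewrite mulrA.
Qed.

Lemma le_two_powR (x y : R) : (x <= y)%R -> (2 `^ x <= 2 `^ y :> R)%R.
Proof. by move=> xy; apply: ler_powR; rewrite ?ler1n. Qed.

Section parameters.
Variables (beta p0 q0 p q r0 r : R).
Hypotheses (hbeta : (0 < beta)%R) (hp0 : (1 <= p0)%R) (hq0 : (1 <= q0)%R)
  (hp : (1 < p)%R) (hq : (1 < q)%R) (hr0 : (beta^-1 < r0)%R) (hr : (beta^-1 < r)%R)
  (hqr : (q^-1 - q0^-1 = r^-1 - r0^-1)%R) (hrp : (r^-1 - r0^-1 = p^-1 - p0^-1)%R).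

Let p_gt0 : (0 < p)%R. Proof. exact: lt_trans ltr01 hp. Qed.
Let q_gt0 : (0 < q)%R. Proof. exact: lt_trans ltr01 hq. Qed.
Let p0_gt0 : (0 < p0)%R. Proof. exact: lt_le_trans ltr01 hp0. Qed.
Let q0_gt0 : (0 < q0)%R. Proof. exact: lt_le_trans ltr01 hq0. Qed.
Let r_gt0 : (0 < r)%R. Proof. by apply: lt_trans hr; rewrite invr_gt0. Qed.
Let r0_gt0 : (0 < r0)%R. Proof. by apply: lt_trans hr0; rewrite invr_gt0. Qed.
Let s_gt1 : (1 < r * beta)%R. Proof. by rewrite -ltr_pdivrMr// div1r. Qed.
Let s0_gt1 : (1 < r0 * beta)%R. Proof. by rewrite -ltr_pdivrMr// div1r. Qed.
Let conjq_gt0 : (0 < conjR q)%R. Proof. exact: lt_trans ltr01 (conjR_gt1 hq). Qed.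

Definition extrapolation_conclusion (C : R) w f g := exists v : Rn R n -> \bar R,
  [/\ is_weight v,
      Aclass (r0 * beta)%R (fun x => v x `^ r0),
      Achar (r0 * beta)%R (fun x => v x `^ r0) <=
        C%:E * Achar (r * beta)%R (fun x => w x `^ r)
          `^ (Num.max 1 ((r0 * beta - 1) / (r * beta - 1)))%R &
      Lnorm mu p0%:E (fun x => cmod f x * v x) *
      Lnorm mu (hoelder_conjugate q0%:E) (fun x => cmod g x * (v x)^-1) <=
        (2 `^ Num.max (r * beta / p) (conjR (r * beta) / conjR q))%R%:E *
        (Lnorm mu p%:E (fun x => cmod f x * w x) *
         Lnorm mu (hoelder_conjugate q%:E) (fun x => cmod g x * (w x)^-1))].

Definition extrapolation_hypotheses w f g :=
  [/\ is_weight w, Aclass (r * beta)%R (fun x => w x `^ r),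
      in_weighted_Lp p (fun x => w x `^ p) f &
      in_weighted_Lp (conjR q) (fun x => w x `^ (- conjR q)%R) g].

(** Equal $r$ and $r_0$ force $p_0=p$ and $q_0=q$, so [w] itself serves. *)
Lemma extrapolation_eq w f g : r = r0 -> extrapolation_hypotheses w f g ->
  extrapolation_conclusion 1 w f g.
Proof.
move=> rr0 [hw hA _ _]; exists w.
have pp0 : p0 = p.
  by apply: invr_inj; apply/eqP; rewrite eq_sym -subr_eq0 -hrp rr0 subrr.
have qq0 : q0 = q.
  by apply: invr_inj; apply/eqP; rewrite eq_sym -subr_eq0 hqr rr0 subrr.
have s0 : (r * beta - 1 != 0)%R by rewrite subr_eq0 gt_eqF.
rewrite -rr0; split => //.
  rewrite divff// maxxx mul1e poweRe1//.
  have [A A0 ->] := Achar_fin hw s_gt1 hA.2.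
  by rewrite lee_fin ltW.
rewrite pp0 qq0; set X := _ * _; have X0 : 0 <= X.
  by apply: mule_ge0; exact: Lnorm_ge0.
rewrite -[leLHS]mul1e; apply: lee_wpmul2r => //; rewrite lee_fin.
have := @le_two_powR 0 (Num.max (r * beta / p) (conjR (r * beta) / conjR q))%R.
rewrite powRr0; apply; rewrite le_max divr_ge0 ?(ltW p_gt0)//.
by rewrite mulr_ge0// ltW.
Qed.

Lemma extrapolation_up w f g : (r < r0)%R -> extrapolation_hypotheses w f g ->
  extrapolation_conclusion
    (rdf_A1_cst (n:=n) (r * beta) `^ (r0 * beta - r * beta)) w f g.
Proof.
move=> rr0 [hw [_ Aoo] [mf Nf] [mg Ng]].
have [A A0 AE] := Achar_fin hw s_gt1 Aoo.
have st : (r * beta < r0 * beta)%R by rewrite ltr_pM2r.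
have [dl dlE] : exists dl, dl = (r^-1 - r0^-1)%R by eexists.
have dl0 : (0 < dl)%R by rewrite dlE subr_gt0 ltf_pV2.
(* $1/q_0=1/q-\delta<1/q$, so $q_0'$ is finite and can play the part of [e]. *)
have q0_gt1 : (1 < q0)%R.
  apply: (lt_trans hq); rewrite -ltf_pV2// -subr_gt0 hqr -dlE//.
have conjq0_gt0 : (0 < conjR q0)%R by exact: lt_trans ltr01 (conjR_gt1 q0_gt1).
have u0 x : (0 < wreal w x `^ r)%R by rewrite powR_gt0 ?wreal_gt0.
have mu_ := measurable_powR_comp r (measurable_wreal hw).
have HA : Achar (r * beta) (fun x => (wreal w x `^ r)%:E) <= A%:E.
  by rewrite -(Achar_wreal hw) AE.
have HP0 : (p0%:E = +oo /\ (p0^-1 = 0)%R) \/ ((0 < p0^-1)%R /\ p0%:E = ((p0^-1)^-1)%:E).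
  by right; rewrite invr_gt0 invrK.
have dlP : (p^-1 = p0^-1 + dl)%R by rewrite dlE hrp subrKC.
have dle : ((conjR q0)^-1 = (conjR q)^-1 + dl)%R.
  by rewrite !conjR_inv// dlE -hqr; ring.
have [F [mF F0 HV HN]] := extrapolation_step mu_ u0 s_gt1 st A0 HA
  (measurable_fw hw mf) (measurable_gw hw mg) (fw_ge0 w f) (gw_ge0 w g)
  p_gt0 conjq_gt0 conjq0_gt0 dl0 HP0 dlP dle
  (fw_lty hw mf p_gt0 Nf) (gw_lty hw mg conjq_gt0 Ng).
pose v x := (wreal w x * F x `^ (- (dl * p)))%R.
have mv : measurable_fun setT v.
  exact: (measurable_funM (measurable_wreal hw) (measurable_powR_comp _ mF)).
have v0 x : (0 < v x)%R by rewrite mulr_gt0 ?wreal_gt0// powR_gt0.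
have vE : (fun x => (v x `^ r0)%:E) = (fun x => ((wreal w x `^ r) `^ (r0 * beta / (r * beta)) *
    F x `^ (- (p * (r0 * beta / (r * beta) - 1))))%:E).
  apply/funext => x; congr EFin.
  have e1 : (r * (r0 * beta / (r * beta)) = r0)%R by field; rewrite !gt_eqF.
  have e2 : (- (dl * p) * r0 = - (p * (r0 * beta / (r * beta) - 1)))%R.
    by rewrite dlE; field; rewrite !gt_eqF.
  rewrite /v (powRM _ (ltW (wreal_gt0 w x)) (powR_ge0 _ _)).
  by rewrite -powRrM e2 -powRrM e1.
rewrite -vE in HV.
exists (fun x => (v x)%:E); split.
- exact: is_weight_real.
- exact: Aclass_real mv v0 HV.
- apply: (le_trans HV); rewrite AE EFinM lee_wpmul2l ?lee_fin ?powR_ge0//.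
  rewrite max_r// ler_pdivlMr ?subr_gt0// mul1r.
  by rewrite lerD2r ltW.
rewrite (hoelder_conjugateE q0_gt1) (hoelder_conjugateE hq).
rewrite (Lnorm_fw hw mf p_gt0) (Lnorm_gw hw mg conjq_gt0).
rewrite /v cmod_mul_weight cmod_div_weight//; apply: (le_trans HN).
apply: lee_wpmul2r; first by rewrite mule_ge0 ?poweR_ge0.
by rewrite lee_fin le_two_powR// le_max lexx.
Qed.

Lemma extrapolation_down w f g : (r0 < r)%R -> extrapolation_hypotheses w f g ->
  extrapolation_conclusion
    ((rdf_A1_cst (n:=n) (conjR (r * beta)) `^ (conjR (r0 * beta) - conjR (r * beta)))
      `^ (r0 * beta - 1)) w f g.
Proof.
move=> rr0 [hw [_ Aoo] [mf Nf] [mg Ng]].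
have [A A0 AE] := Achar_fin hw s_gt1 Aoo.
have ts : (r0 * beta < r * beta)%R by rewrite ltr_pM2r.
have [s sE] : exists s, s = (r * beta)%R by eexists.
have [t tE] : exists t, t = (r0 * beta)%R by eexists.
have [s1 t1] : (1 < s)%R /\ (1 < t)%R by rewrite sE tE.
have sq0 : (0 < s - 1)%R by rewrite subr_gt0.
have tq0 : (0 < t - 1)%R by rewrite subr_gt0.
rewrite -sE -tE in ts *.
have st := conjR_lt t1 ts.
have [dl dlE] : exists dl, dl = (r0^-1 - r^-1)%R by eexists.
have dl0 : (0 < dl)%R by rewrite dlE subr_gt0 ltf_pV2.
have u0 x : (0 < wreal w x `^ r)%R by rewrite powR_gt0 ?wreal_gt0.
have mu_ := measurable_powR_comp r (measurable_wreal hw).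
have HA : Achar s (fun x => (wreal w x `^ r)%:E) <= A%:E.
  by rewrite -(Achar_wreal hw) sE AE.
have HAd := Achar_dual mu_ u0 s1 A0 HA.
have q_inv : ((conjR q)^-1 = (1 - q0^-1) + dl)%R.
  by rewrite conjR_inv// dlE -(opprB (r^-1)%R) -hqr; ring.
(* Here $q_0=1$ is possible and gives the endpoint $q_0'=\infty$. *)
have HP0 : (hoelder_conjugate q0%:E = +oo /\ (1 - q0^-1)%R = 0%R) \/
    ((0 < 1 - q0^-1)%R /\ hoelder_conjugate q0%:E = ((1 - q0^-1)^-1)%:E).
  move: hq0; rewrite le_eqVlt => /predU1P[<-|q01].
    by left; rewrite hoelder_conjugate1 invr1 subrr.
  right; rewrite hoelder_conjugateE// -conjR_inv// invrK invr_gt0.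
  by split=> //; exact: lt_trans ltr01 (conjR_gt1 q01).
have dle : (p0^-1 = p^-1 + dl)%R by rewrite dlE -(opprB (r^-1)%R) hrp; ring.
have [F [mF F0 HV HN]] := extrapolation_step (measurable_dual_weight s mu_)
  (dual_weight_gt0 s u0) (conjR_gt1 s1) st (powR_gt0 (s - 1)^-1 A0) HAd
  (measurable_gw hw mg) (measurable_fw hw mf) (gw_ge0 w g) (fw_ge0 w f)
  conjq_gt0 p_gt0 p0_gt0 dl0 HP0 q_inv dle
  (gw_lty hw mg conjq_gt0 Ng) (fw_lty hw mf p_gt0 Nf).
(* Now $g/v$ gains and $fv$ loses, so [F] enters [v] with a positive exponent. *)
pose v x := (wreal w x * F x `^ (- (- (dl * conjR q))))%R.
have mv : measurable_fun setT v.
  exact: (measurable_funM (measurable_wreal hw) (measurable_powR_comp _ mF)).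
have v0 x : (0 < v x)%R by rewrite mulr_gt0 ?wreal_gt0// powR_gt0.
pose V x := (dual_weight (fun x => wreal w x `^ r)%R s x `^ (conjR t / conjR s) *
    F x `^ (- (conjR q * (conjR t / conjR s - 1))))%R.
have V0 x : (0 < V x)%R.
  by apply: mulr_gt0; apply: powR_gt0; [exact: (dual_weight_gt0 s u0 x)|exact: F0].
have mV : measurable_fun setT V.
  exact: (measurable_funM (measurable_powR_comp _ (measurable_dual_weight s mu_))
    (measurable_powR_comp _ mF)).
have vE : (fun x => (v x `^ r0)%:E) = (fun x => (dual_weight V (conjR t) x)%:E).
  apply/funext => x; rewrite /v /V /dual_weight dlE sE tE.
  by rewrite (powR_dual_jones _ _ (wreal_gt0 w x) hbeta r_gt0 r0_gt0 s_gt1 s0_gt1).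
have cst0 : (0 < rdf_A1_cst (n:=n) (conjR s))%R := rdf_A1_cst_gt0 (conjR_gt1 s1).
have cstV0 : (0 < rdf_A1_cst (n:=n) (conjR s) `^ (conjR t - conjR s) *
   (A `^ (s - 1)^-1) `^ ((conjR t - 1) / (conjR s - 1)))%R.
  by rewrite mulr_gt0 ?powR_gt0.
(* Duality leads back from $A_{t'}$ to $A_t$ and raises the constant to the power $t-1$. *)
have HV' := Achar_dual mV V0 (conjR_gt1 t1) cstV0 HV.
rewrite -vE (conjRK t1) in HV'.
have cstE : ((rdf_A1_cst (n:=n) (conjR s) `^ (conjR t - conjR s) *
   (A `^ (s - 1)^-1) `^ ((conjR t - 1) / (conjR s - 1))) `^ (conjR t - 1)^-1 =
   (rdf_A1_cst (n:=n) (conjR s) `^ (conjR t - conjR s)) `^ (t - 1) * A)%R.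
  rewrite (powRM _ (powR_ge0 _ _) (powR_ge0 _ _)) (powR_conjRK s1 t1 A0).
  by rewrite (conjR_sub1 t1) invrK.
rewrite cstE in HV'.
have max1 : Num.max 1%R ((t - 1) / (s - 1))%R = 1%R.
  by apply: max_l; rewrite ler_pdivrMr// mul1r lerD2r ltW.
rewrite -sE in AE.
have A_ge0 : 0 <= A%:E by rewrite lee_fin ltW.
exists (fun x => (v x)%:E); rewrite -tE -sE; split.
- exact: is_weight_real.
- exact: Aclass_real mv v0 HV'.
- by rewrite AE max1 (poweRe1 A_ge0) -EFinM.
rewrite (hoelder_conjugateE hq) (Lnorm_fw hw mf p_gt0) (Lnorm_gw hw mg conjq_gt0).
rewrite /v cmod_mul_weight cmod_div_weight// opprK muleC.
apply: (le_trans HN); rewrite (muleC (_ `^ p^-1)).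
apply: lee_wpmul2r; first by rewrite mule_ge0 ?poweR_ge0.
by rewrite lee_fin le_two_powR// le_max lexx orbT.
Qed.

End parameters.
End extrapolation_cases.

Local Open Scope ereal_scope.

Theorem theorem4p6 (R : realType) (n : nat) (beta p0 q0 p q r0 r : R)
    (hn : (0 < n)%N) (hbeta : (0 < beta)%R)
    (hp0 : (1 <= p0)%R) (hq0 : (1 <= q0)%R) (hp : (1 < p)%R) (hq : (1 < q)%R)
    (hr0 : (beta^-1 < r0)%R) (hr : (beta^-1 < r)%R)
    (hqr : (q^-1 - q0^-1 = r^-1 - r0^-1)%R)
    (hrp : (r^-1 - r0^-1 = p^-1 - p0^-1)%R) :
  exists C : R, (0 < C)%R /\
    forall (w : Rn R n -> \bar R) (f g : Rn R n -> R[i]%C),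
      is_weight w ->
      Aclass (r * beta)%R (fun x => w x `^ r) ->
      in_weighted_Lp p (fun x => w x `^ p) f ->
      in_weighted_Lp (conjR q) (fun x => w x `^ (- conjR q)%R) g ->
      exists v : Rn R n -> \bar R,
        [/\ is_weight v,
            Aclass (r0 * beta)%R (fun x => v x `^ r0),
            Achar (r0 * beta)%R (fun x => v x `^ r0) <=
              C%:E * Achar (r * beta)%R (fun x => w x `^ r)
                `^ (Num.max 1 ((r0 * beta - 1) / (r * beta - 1)))%R &
            Lnorm (lebesgueRn R n) p0%:E (fun x => cmod f x * v x) *
            Lnorm (lebesgueRn R n) (hoelder_conjugate q0%:E)
              (fun x => cmod g x * (v x)^-1) <=
              (2 `^ Num.max (r * beta / p) (conjR (r * beta) / conjR q))%R%:E *
              (Lnorm (lebesgueRn R n) p%:E (fun x => cmod f x * w x) *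
               Lnorm (lebesgueRn R n) (hoelder_conjugate q%:E)
                 (fun x => cmod g x * (w x)^-1))].
Proof.
have [rr0|rr0|rr0] := ltrgtP r r0.
- exists (rdf_A1_cst (n:=n) (r * beta) `^ (r0 * beta - r * beta))%R; split.
    rewrite powR_gt0// rdf_A1_cst_gt0//.
    by rewrite -ltr_pdivrMr// div1r.
  move=> w f g hw hA hf hg.
  exact: (extrapolation_up hbeta hp0 hq0 hp hq hr0 hr hqr hrp rr0 (And4 hw hA hf hg)).
- exists ((rdf_A1_cst (n:=n) (conjR (r * beta)) `^
    (conjR (r0 * beta) - conjR (r * beta))) `^ (r0 * beta - 1))%R; split.
    rewrite powR_gt0// powR_gt0// rdf_A1_cst_gt0// conjR_gt1//.
    by rewrite -ltr_pdivrMr// div1r.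
  move=> w f g hw hA hf hg.
  exact: (extrapolation_down hbeta hp0 hq0 hp hq hr0 hr hqr hrp rr0 (And4 hw hA hf hg)).
exists 1%R; split=> // w f g hw hA hf hg.
exact: (extrapolation_eq hbeta hp hr hqr hrp rr0 (And4 hw hA hf hg)).
Qed.
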